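(* Let $(M,F)$ be a Finsler manifold and let $(F_\varepsilon)_{\varepsilon\in(0,1)}$ be a mollifier smoothing of $F$. Let $X$ be an arbitrary (smooth) vector field on $TM\setminus0$ and let $E$ be an arbitrary (smooth) section of $\pi^*TM$. Let $\nabla$ and $\nabla_\varepsilon$ be the Chern connections of $F$ and $F_\varepsilon$ respectively. Then $(\nabla_\varepsilon)_XE$ converges uniformly to $\nabla_XE$ on compact subsets of $TM\setminus0$ as $\varepsilon\to0$. The same statement holds with the Chern connections replaced by the Cartan connections, by the Hashiguchi connections, and by the Berwald connections of $F$ and $F_\varepsilon$.
   Context: Finsler notions. $M$ is a smooth manifold of dimension $n$. A Minkowski norm on a real vector space $\mathbb V$ is a function $N:\mathbb V\to\mathbb R$, smooth on $\mathbb V\setminus\{0\}$, with $N(\mu y)=\mu N(y)$ for $\mu>0$ and $\left(\frac12\frac{\partial^2N^2}{\partial y^i\partial y^j}(y)\right)$ positive definite for $y\neq0$. A Finsler structure on $M$ is a function $F:TM\to\mathbb R$, smooth on $TM\setminus 0=\{(x,y)\in TM:y\ne0\}$, whose restriction to each $T_xM$ is a Minkowski norm; $(M,F)$ is then a Finsler manifold. An asymmetric norm is a nonnegative function $N$ with $N(y)=0$ only if $y=0$, $N(\mu y)=\mu N(y)$ for $\mu\geq0$ and $N(y+z)\le N(y)+N(z)$. Let $\pi:TM\setminus0\to M$ be the projection; $\pi^*TM$ is the pulled-back bundle over $TM\setminus0$, with fiber $T_xM$ over $(x,y)$ and local frame $\frac{\partial}{\partial x^i}$. In natural coordinates $(x^i,y^i)$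 on $TU$ (summation convention): $g_{ij}=\frac12\frac{\partial^2F^2}{\partial y^i\partial y^j}$, $(g^{ij})=(g_{ij})^{-1}$, $C_{ijk}=\frac12\frac{\partial g_{ij}}{\partial y^k}$, $C^i{}_{jk}=g^{is}C_{sjk}$, $\gamma^i{}_{jk}=\frac12g^{is}\left(\frac{\partial g_{sj}}{\partial x^k}-\frac{\partial g_{jk}}{\partial x^s}+\frac{\partial g_{ks}}{\partial x^j}\right)$, $N^i{}_j=\gamma^i{}_{jk}y^k-C^i{}_{jk}\gamma^k{}_{rs}y^ry^s$, $\delta y^i=dy^i+N^i{}_jdx^j$, $\Gamma^l{}_{jk}=\gamma^l{}_{jk}-g^{li}(C_{ijs}N^s{}_k-C_{jks}N^s{}_i+C_{kis}N^s{}_j)$, $\sigma^i=\gamma^i{}_{jk}y^jy^k$, $\dot A^i{}_{jk}=\frac12\frac{\partial^2\sigma^i}{\partial y^j\partial y^k}-\Gamma^i{}_{jk}$. A linear connection on $\pi^*TM$ with connection forms $\theta_j{}^i$ satisfies $\nabla_X\frac{\partial}{\partial x^j}=\theta_j{}^i(X)\frac{\partial}{\partial x^i}$. With $\omega_j{}^i=\Gamma^i{}_{jk}dx^k$, the connection forms are: Chern: $\omega_j{}^i$; Cartan: $\omega_j{}^i+C^i{}_{jk}\delta y^k$; Hashiguchi: $\omega_j{}^i+C^i{}_{jk}\delta y^k+\dot A^i{}_{jk}dx^k$; Berwald: $\omega_j{}^i+\dot A^i{}_{jk}dx^k$. Uniform convergence. A $C^0$-Finsler structure on $\pi^*TM$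 is a continuous $F_\pi:\pi^*TM\to\mathbb R$ whose restriction to each fiber is an asymmetric norm. A family of continuous sections $E_\varepsilon$ of $\pi^*TM$ converges uniformly to a continuous section $E$ on a compact $K\subset TM\setminus0$ if there is a $C^0$-Finsler structure $F_\pi$ on $\pi^*TM$ such that for every $\delta>0$ there is $\beta>0$ with $F_\pi(x,y,E_\varepsilon(x,y)-E(x,y))<\delta$ for all $(x,y)\in K$, $\varepsilon\in(0,\beta)$. Standard mollifier: $\eta:\mathbb R^n\to\mathbb R$, $\eta(x)=C\exp\left(\frac1{\|x\|^2-1}\right)$ if $\|x\|<1$ and $\eta(x)=0$ otherwise, with $C>0$ such that $\int\eta=1$; $\eta_\varepsilon(x)=\varepsilon^{-n}\eta(x/\varepsilon)$. Local vertical smoothing. Let $U_0\subset M$ be open with coordinates $(x^1,\dots,x^n)$ and let $U$ be open with compact closure, $\overline U\subset U_0$. Identify $U$ with its image in $\mathbb R^n$ and $TU$ with $U\times\mathbb R^n$ via natural coordinates $(x,y)$; $\|\cdot\|$ is the Euclidean norm in the $y$-coordinates. Put $r_U=\max\{F(x,y):x\in\overline U,\|y\|=1\}$, $r_u=\min\{F(x,y):x\in\overline U,\|y\|=1\}$. Fix an increasing $u:(0,1)\to(0,\infty)$ with $\lim_{\varepsilon\to0}u(\varepsilon)=0$ and $\tau\in\left(0,\frac{r_u}{16nr_U}\right)$ such that $u(\varepsilon)\in\left(0,\frac{r_u}{16nr_U}\right)$ for all $\varepsilon\in(0,\tau)$. For $\varepsilon\in(0,\tau)$ let $\zeta_\varepsilon=(1-u(\varepsilon))\eta_\varepsilon+u(\varepsilon)\eta_{2r_U/r_u}$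 and $(\zeta_\varepsilon\ast_vF)(x,y)=\int_{\mathbb R^n}\zeta_\varepsilon(z)F(x,y-z)\,dz$. For each $x\in U$ the set $(\zeta_\varepsilon\ast_vF)^{-1}(r_U)\cap T_xU$ meets each open ray from the origin in exactly one point and bounds a convex set containing the origin; $G_\varepsilon:TU\to\mathbb R$ is the function such that $G_\varepsilon(x,\cdot)$ is the asymmetric norm on $T_xU$ whose sphere of radius $r_U$ centered at $0$ is this set. Mollifier smoothing. Choose a locally finite covering of $M$ by coordinate open sets $(U_\lambda,(x^i)_\lambda)_{\lambda\in\Lambda}$, each $U_\lambda$ having compact closure contained in an open set to which the coordinate system $(x^i)_\lambda$ extends, and a smooth partition of unity $\{\varphi_\lambda\}$ subordinate to it. For each $\lambda$ put $r_{U_\lambda}=\max\{F(x,y):x\in\overline{U_\lambda},\|y\|=1\}$ and $r_{u_\lambda}=\min\{F(x,y):x\in\overline{U_\lambda},\|y\|=1\}$ (Euclidean norm in the coordinates of $U_\lambda$), and choose an increasing function $u_\lambda:(0,1)\to(0,\infty)$ with $\lim_{\varepsilon\to0}u_\lambda(\varepsilon)=0$ and a number $\tau_\lambda\in\left(0,\frac{r_{u_\lambda}}{16nr_{U_\lambda}}\right)$ such that $u_\lambda(\varepsilon)\in\left(0,\frac{r_{u_\lambda}}{16nr_{U_\lambda}}\right)$ for all $\varepsilon\in(0,\tau_\lambda)$. Let $G_{\varepsilon,\lambda}:TU_\lambda\to\mathbb R$, $\varepsilon\in(0,\tau_\lambda)$, be the function $G_\varepsilon$ given by the local vertical smoothing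 with $U=U_\lambda$, $u=u_\lambda$, $\tau=\tau_\lambda$. Let $V_\lambda=\mathrm{int}(\mathrm{supp}\,\varphi_\lambda)$, $\nu_\lambda=\mathrm{dist}_{\mathbb R^n}(\partial V_\lambda,\partial U_\lambda)$ (in the coordinates of $U_\lambda$), $\delta_\lambda=\min\{\tau_\lambda,\nu_\lambda\}$, $\psi_\lambda(\varepsilon)=\varepsilon\delta_\lambda$ for $\varepsilon\in(0,1)$. Define $F_{\varepsilon,\lambda}\ge0$ by $F_{\varepsilon,\lambda}^2(x,y)=\int\eta_{\psi_\lambda(\varepsilon)}(x-z)\,G^2_{\psi_\lambda(\varepsilon),\lambda}(z,y)\,dz$ for $(x,y)\in TO_{\varepsilon,\lambda}$, where $O_{\varepsilon,\lambda}\subset U_\lambda$ is an open set containing $\overline{V_\lambda}$ on which this is well defined. A mollifier smoothing of $F$ is a family $F_\varepsilon:TM\to[0,\infty)$, $\varepsilon\in(0,1)$, obtained in this way by $F_\varepsilon^2(x,y)=\sum_{\lambda\in\Lambda}\varphi_\lambda(x)F^2_{\varepsilon,\lambda}(x,y)$ (terms with $\varphi_\lambda(x)=0$ being $0$). Each $F_\varepsilon$ is a Finsler structure on $M$. *)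

(* Defs.v *)
From HB Require Import structures.
From mathcomp Require Import all_boot all_order all_algebra.
From mathcomp Require Import all_classical all_reals all_analysis.
Set Implicit Arguments.
Unset Strict Implicit.
Unset Printing Implicit Defensive.
Import Order.TTheory GRing.Theory Num.Theory numFieldNormedType.Exports.
Local Open Scope classical_set_scope.
Local Open Scope ring_scope.

Section Calculus.
Variable R : realType.

(* Used on open sets [A] of finite-dimensional spaces [V] only. *)
Fixpoint Ck_on (V W : normedModType R) (k : nat) (A : set V) (f : V -> W) : Prop :=
  match k with
  | 0 => forall x, A x -> {for x, continuous f}
  | k'.+1 => (forall x, A x -> differentiable f x) /\
             (forall v : V, Ck_on k' A (fun x => 'D_v f x))
  end.

Definition smooth_on (V W : normedModType R) (A : set V) (f : V -> W) : Prop :=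
  forall k, Ck_on k A f.

(* The library norm on ['rV[R]_n] is the sup norm. *)
Definition enorm n (x : 'rV[R]_n) : R := Num.sqrt (\sum_(i < n) x 0 i ^+ 2).

(* Iterated Lebesgue integral.  It is only applied to continuous functions with
   compact support, where it agrees with the Lebesgue integral on R^n. *)
Fixpoint Rn_integral (n : nat) : ('rV[R]_n -> R) -> R :=
  match n with
  | 0 => fun f => f 0
  | n'.+1 => fun f => (\int[lebesgue_measure]_(t in setT)
      Rn_integral (fun v : 'rV[R]_n' => f (row_mx (t%:M : 'rV[R]_1) v)))%R
  end.

Variable n : nat.
Implicit Types (N : 'rV[R]_n -> R) (x y z : 'rV[R]_n).

Definition hessian_half_sq N y : 'M[R]_n :=
  \matrix_(i, j) (2^-1 * 'D_(delta_mx 0 j) ('D_(delta_mx 0 i) (fun z => N z ^+ 2)) y).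

Definition minkowski_norm N : Prop :=
  [/\ smooth_on [set y | y != 0] N,
      forall (m : R) y, 0 < m -> N (m *: y) = m * N y &
      forall y, y != 0 -> forall v : 'rV[R]_n, v != 0 ->
        0 < (v *m hessian_half_sq N y *m v^T) 0 0].

Definition asymmetric_norm N : Prop :=
  [/\ forall y, 0 <= N y,
      forall y, N y = 0 -> y = 0,
      forall (m : R) y, 0 <= m -> N (m *: y) = m * N y &
      forall y z, N (y + z) <= N y + N z].

Definition mollifier_bump x : R :=
  if enorm x < 1 then expR ((enorm x ^+ 2 - 1)^-1) else 0.

Definition mollifier x : R := (Rn_integral mollifier_bump)^-1 * mollifier_bump x.

Definition mollifier_scaled (e : R) x : R := e ^- n * mollifier (e^-1 *: x).

(* Euclidean distance, [+oo] when one of the two sets is empty. *)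
Definition euclid_dist (A B : set 'rV[R]_n) : \bar R :=
  ereal_inf [set (enorm (a - b))%:E | a in A & b in B].

Definition frontier (T : topologicalType) (A : set T) : set T :=
  closure A `\` interior A.

End Calculus.

Section Manifold.
Variables (R : realType) (n : nat).

Record chart (M : topologicalType) := Chart {
  cdom : set M;
  cmap : M -> 'rV[R]_n;
  cinv : 'rV[R]_n -> M;
  cdom_open : open cdom;
  cimg_open : open (cmap @` cdom);
  cmapK : forall x, cdom x -> cinv (cmap x) = x;
  cmap_continuous : forall x, cdom x -> {for x, continuous cmap};
  cinv_continuous : forall a, (cmap @` cdom) a -> {for a, continuous cinv} }.

Definition cimg (M : topologicalType) (c : chart M) : set 'rV[R]_n :=
  cmap c @` cdom c.

Definition smooth_transition (M : topologicalType) (c c' : chart M) : Prop :=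
  smooth_on (cmap c @` (cdom c `&` cdom c')) (cmap c' \o cinv c).

(* [atlas] is a maximal atlas: its elements are all the local coordinate
   systems of the manifold. *)
Record smooth_manifold := SmoothManifold {
  carrier :> topologicalType;
  carrier_hausdorff : hausdorff_space carrier;
  carrier_second_countable : @second_countable carrier;
  atlas : set (chart carrier);
  atlas_cover : forall x, exists c, atlas c /\ cdom c x;
  atlas_compatible : forall c c', atlas c -> atlas c' -> smooth_transition c c';
  atlas_maximal : forall c,
    (forall c', atlas c' -> smooth_transition c c' /\ smooth_transition c' c) ->
    atlas c }.

Variable M : smooth_manifold.

Definition chart_at (x : M) : chart M := sval (cid (atlas_cover x)).

(* A tangent vector at [x] is given by its components in the coordinates
   [chart_at x]; [tvec_coord] and [tvec_point] convert to and from the components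
   in the coordinates [c]. *)
Definition tangent (x : M) : Type := 'rV[R]_n.

Definition tvec_coord (c : chart M) (x : M) (v : tangent x) : 'rV[R]_n :=
  'd (cmap c \o cinv (chart_at x)) (cmap (chart_at x) x) v.

Definition tvec_point (c : chart M) (x : M) (y : 'rV[R]_n) : tangent x :=
  'd (cmap (chart_at x) \o cinv c) (cmap c x) y.

Record tangent_bundle := TVec { base : M; vec : tangent base }.

HB.instance Definition _ := gen_eqMixin tangent_bundle.
HB.instance Definition _ := gen_choiceMixin tangent_bundle.

(* Natural coordinates (x^i, y^i) on TM and their inverse. *)
Definition tcoord (c : chart M) (p : tangent_bundle) : 'rV[R]_n * 'rV[R]_n :=
  (cmap c (base p), tvec_coord c (vec p)).

Definition tpoint (c : chart M) (q : 'rV[R]_n * 'rV[R]_n) : tangent_bundle :=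
  TVec (tvec_point c (cinv c q.1) q.2).

(* The topology of TM: a set is open when it is open in all natural coordinates. *)
Definition tangent_open (W : set tangent_bundle) : Prop :=
  forall c, atlas c ->
    open [set q : 'rV[R]_n * 'rV[R]_n | cimg c q.1 /\ W (tpoint c q)].

Fact tangent_openT : tangent_open setT.
Proof.
move=> c _; rewrite (_ : [set _ | _] = fst @^-1` cimg c).
  by apply: open_comp => [q _|]; [exact: cvg_fst|exact: cimg_open].
by apply/seteqP; split => q //= -[].
Qed.

Fact tangent_openI (A B : set tangent_bundle) :
  tangent_open A -> tangent_open B -> tangent_open (A `&` B).
Proof.
move=> oA oB c ac; have := openI (oA c ac) (oB c ac); congr open.
by apply/seteqP; split => q /= => [[[? ?] []]|[? []]].
Qed.

Fact tangent_open_bigU (I : Type) (f : I -> set tangent_bundle) :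
  (forall i, tangent_open (f i)) -> tangent_open (\bigcup_i f i).
Proof.
move=> of_ c ac; have := bigcup_open (fun i (_ : setT i) => of_ i c ac).
congr open; apply/seteqP; split => q /= => [[i _ [? ?]]|[? [i _ ?]]].
  by split=> //; exists i.
by exists i.
Qed.

HB.instance Definition _ := isOpenTopological.Build tangent_bundle
  tangent_openT tangent_openI tangent_open_bigU.

(* TM \ 0 *)
Definition slit : set tangent_bundle := [set p | vec p != 0 :> 'rV[R]_n].

Definition chart_slit (c : chart M) : set tangent_bundle :=
  [set p | cdom c (base p)] `&` slit.

(* The part of the open set [W] of TM covered by the natural coordinates [c]. *)
Definition tcoord_img (W : set tangent_bundle) (c : chart M) :
    set ('rV[R]_n * 'rV[R]_n) :=
  [set q | cimg c q.1 /\ W (tpoint c q)].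

Definition smooth_function_on (W : set tangent_bundle) (f : tangent_bundle -> R) : Prop :=
  forall c, atlas c -> smooth_on (tcoord_img W c) (f \o tpoint c).

(* Sections of pi^* TM; their values outside of TM \ 0 are irrelevant. *)
Definition section : Type := forall p : tangent_bundle, tangent (base p).

Definition section_coord (c : chart M) (E : section) (p : tangent_bundle) : 'rV[R]_n :=
  tvec_coord c (E p).

Definition smooth_section_on (W : set tangent_bundle) (E : section) : Prop :=
  forall c, atlas c -> smooth_on (tcoord_img W c) (section_coord c E \o tpoint c).

Definition continuous_section_on (W : set tangent_bundle) (E : section) : Prop :=
  forall c, atlas c -> forall q, tcoord_img W c q ->
    {for q, continuous (section_coord c E \o tpoint c)}.

(* Vector fields on TM \ 0: the value at [p] is given by its components in the
   natural coordinates induced by [chart_at (base p)], the components in the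
   other natural coordinates being obtained by differentiating the transition. *)
Definition vector_field : Type := tangent_bundle -> 'rV[R]_n * 'rV[R]_n.

Definition vfield_coord (c : chart M) (X : vector_field) (p : tangent_bundle) :
    'rV[R]_n * 'rV[R]_n :=
  'd (tcoord c \o tpoint (chart_at (base p))) (tcoord (chart_at (base p)) p) (X p).

Definition smooth_vfield_on (W : set tangent_bundle) (X : vector_field) : Prop :=
  forall c, atlas c -> smooth_on (tcoord_img W c) (vfield_coord c X \o tpoint c).

(* X(f) *)
Definition vfield_apply (X : vector_field) (f : tangent_bundle -> R) (p : tangent_bundle) : R :=
  'd (f \o tpoint (chart_at (base p)) : _ -> R^o) (tcoord (chart_at (base p)) p) (X p).

(* Linear connections on pi^* TM, acting on sections over open subsets of TM \ 0. *)
Record linear_connection := LinearConnection {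
  nabla :> vector_field -> section -> section;
  nabla_smooth : forall W X E, open W -> W `<=` slit ->
    smooth_vfield_on W X -> smooth_section_on W E ->
    smooth_section_on W (nabla X E);
  nabla_tensorial : forall W f X Y E, open W -> W `<=` slit ->
    smooth_function_on W f -> smooth_vfield_on W X -> smooth_vfield_on W Y ->
    smooth_section_on W E -> forall p, W p ->
    nabla (fun q => f q *: X q + Y q) E p =
      (f p *: (nabla X E p : 'rV[R]_n) + nabla Y E p)%R :> 'rV[R]_n;
  nabla_additive : forall W X E E', open W -> W `<=` slit ->
    smooth_vfield_on W X -> smooth_section_on W E -> smooth_section_on W E' ->
    forall p, W p ->
    nabla X (fun q => (E q : 'rV[R]_n) + E' q) p =
      (nabla X E p : 'rV[R]_n) + nabla X E' p :> 'rV[R]_n;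
  nabla_leibniz : forall W f X E, open W -> W `<=` slit ->
    smooth_function_on W f -> smooth_vfield_on W X -> smooth_section_on W E ->
    forall p, W p ->
    nabla X (fun q => f q *: (E q : 'rV[R]_n)) p =
      vfield_apply X f p *: (E p : 'rV[R]_n) + f p *: (nabla X E p : 'rV[R]_n)
      :> 'rV[R]_n }.

(* The local frame d/dx^j of pi^* TM. *)
Definition frame (c : chart M) (j : 'I_n) : section :=
  fun p => tvec_point c (base p) (delta_mx 0 j).

(* [theta j i q Z] stands for theta_j^i(Z), [q] being the natural coordinates of
   the point and [Z] the components of a tangent vector of TM at that point. *)
Definition connection_forms : Type :=
  'I_n -> 'I_n -> 'rV[R]_n * 'rV[R]_n -> 'rV[R]_n * 'rV[R]_n -> R.

Definition has_connection_forms (D : linear_connection) (c : chart M)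
    (theta : connection_forms) : Prop :=
  forall W X, open W -> W `<=` chart_slit c -> smooth_vfield_on W X ->
  forall p, W p -> forall j : 'I_n,
    D X (frame c j) p =
      \sum_(i < n) theta j i (tcoord c p) (vfield_coord c X p) *:
        (frame c i p : 'rV[R]_n) :> 'rV[R]_n.

(* C^0-Finsler structures on pi^* TM; only the fibers over TM \ 0 are relevant. *)
Definition C0_finsler (Fpi : forall p : tangent_bundle, tangent (base p) -> R) : Prop :=
  (forall c, atlas c -> forall (q : 'rV[R]_n * 'rV[R]_n) (w : 'rV[R]_n),
    tcoord_img slit c q ->
    {for (q, w), continuous (fun s : ('rV[R]_n * 'rV[R]_n) * 'rV[R]_n =>
       Fpi (tpoint c s.1) (tvec_point c (base (tpoint c s.1)) s.2))}) /\
  (forall p, slit p -> asymmetric_norm (Fpi p)).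

(* Families are indexed by the parameters e in (0, 1). *)
Definition converges_uniformly (K : set tangent_bundle)
    (E_ : R -> section) (E : section) : Prop :=
  [/\ forall e : R, 0 < e < 1 -> continuous_section_on slit (E_ e),
      continuous_section_on slit E &
      exists2 Fpi : forall p : tangent_bundle, tangent (base p) -> R, C0_finsler Fpi &
        forall d : R, 0 < d -> exists2 b : R, 0 < b &
          forall p (e : R), K p -> 0 < e < b -> e < 1 ->
            Fpi p ((E_ e p : 'rV[R]_n) - E p) < d].

Definition is_finsler (F : tangent_bundle -> R) : Prop :=
  smooth_function_on slit F /\ forall x, minkowski_norm (fun y => F (@TVec x y)).

Definition local_expr (F : tangent_bundle -> R) (c : chart M) (x y : 'rV[R]_n) : R :=
  F (tpoint c (x, y)).

End Manifold.

Arguments tpoint {R n M}.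
Arguments tcoord {R n M}.
Arguments slit {R n M}.

Section FinslerTensors.
Variables (R : realType) (n : nat).
Notation V := 'rV[R]_n.

Definition dx (k : 'I_n) (f : V -> V -> R) (x y : V) : R :=
  'D_(delta_mx 0 k) (f ^~ y) x.
Definition dy (k : 'I_n) (f : V -> V -> R) (x y : V) : R :=
  'D_(delta_mx 0 k) (f x) y.

(* A Finsler structure in natural coordinates.  In the names below, upper indices
   come first, e.g. [gamma i j k] is gamma^i_{jk}. *)
Variable L : V -> V -> R.
Implicit Types (i j k l s : 'I_n) (x y : V).

Definition g_ i j x y : R :=
  2^-1 * dy j (dy i (fun x y => L x y ^+ 2)) x y.
Definition g_inv i j x y : R := invmx (\matrix_(a, b) g_ a b x y) i j.
Definition C_ i j k x y : R := 2^-1 * dy k (g_ i j) x y.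
Definition C_up i j k x y : R := \sum_s g_inv i s x y * C_ s j k x y.
Definition gamma i j k x y : R :=
  2^-1 * \sum_s g_inv i s x y *
    (dx k (g_ s j) x y - dx s (g_ j k) x y + dx j (g_ k s) x y).
Definition sigma i x y : R := \sum_j \sum_k gamma i j k x y * y 0 j * y 0 k.
Definition N_ i j x y : R :=
  \sum_k gamma i j k x y * y 0 k -
  \sum_k \sum_r \sum_s C_up i j k x y * gamma k r s x y * y 0 r * y 0 s.
Definition Gamma l j k x y : R :=
  gamma l j k x y -
  \sum_i g_inv l i x y *
    (\sum_s C_ i j s x y * N_ s k x y - \sum_s C_ j k s x y * N_ s i x y +
     \sum_s C_ k i s x y * N_ s j x y).
Definition A_dot i j k x y : R :=
  2^-1 * dy k (dy j (sigma i)) x y - Gamma i j k x y.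

Definition delta_y i (q Z : V * V) : R :=
  Z.2 0 i + \sum_j N_ i j q.1 q.2 * Z.1 0 j.
Definition omega j i (q Z : V * V) : R :=
  \sum_k Gamma i j k q.1 q.2 * Z.1 0 k.
Definition C_form j i (q Z : V * V) : R :=
  \sum_k C_up i j k q.1 q.2 * delta_y k q Z.
Definition A_dot_form j i (q Z : V * V) : R :=
  \sum_k A_dot i j k q.1 q.2 * Z.1 0 k.

End FinslerTensors.

Inductive connection_kind := Chern | Cartan | Hashiguchi | Berwald.

Definition finsler_forms (R : realType) (n : nat) (kind : connection_kind)
    (L : 'rV[R]_n -> 'rV[R]_n -> R) : connection_forms R n :=
  fun j i q Z =>
  match kind with
  | Chern => omega L j i q Z
  | Cartan => omega L j i q Z + C_form L j i q Z
  | Hashiguchi => omega L j i q Z + C_form L j i q Z + A_dot_form L j i q Z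
  | Berwald => omega L j i q Z + A_dot_form L j i q Z
  end.

(* [D] is the Chern (resp. Cartan, Hashiguchi, Berwald) connection of [F]. *)
Definition is_connection_of (R : realType) (n : nat) (M : smooth_manifold R n)
    (kind : connection_kind) (F : tangent_bundle M -> R) (D : linear_connection M) : Prop :=
  forall c, atlas c -> has_connection_forms D c (finsler_forms kind (local_expr F c)).

Section MollifierSmoothing.
Variables (R : realType) (n : nat) (M : smooth_manifold R n).
Notation V := 'rV[R]_n.
Variable F : tangent_bundle M -> R.

(* Values of F on the Euclidean unit spheres over the closure of U. *)
Definition sphere_values (c : chart R n M) (U : set M) : set R :=
  [set local_expr F c a y | a in cmap c @` closure U & y in [set y | enorm y = 1]].

(* r_U and r_u: the sup and the inf are attained, the closure of U being compact. *)
Definition radius_max c U : R := sup (sphere_values c U).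
Definition radius_min c U : R := inf (sphere_values c U).

Definition smoothing_bound c U : R :=
  radius_min c U / (16 * n%:R * radius_max c U).

Definition zeta c U (u : R -> R) (e : R) (z : V) : R :=
  (1 - u e) * mollifier_scaled e z +
  u e * mollifier_scaled (2 * radius_max c U / radius_min c U) z.

Definition vertical_convolution c U u (e : R) (x y : V) : R :=
  Rn_integral (fun z => zeta c U u e z * local_expr F c x (y - z)).

Definition is_vertical_smoothing c U u (tau : R) (G : R -> V -> V -> R) : Prop :=
  forall e : R, 0 < e < tau -> forall x, (cmap c @` U) x ->
    asymmetric_norm (G e x) /\
    [set y | G e x y = radius_max c U] =
    [set y | vertical_convolution c U u e x y = radius_max c U].

Record smoothing_data := SmoothingData {
  sd_index : choiceType;
  sd_chart : sd_index -> chart R n M;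
  sd_U : sd_index -> set M;
  sd_phi : sd_index -> M -> R;
  sd_u : sd_index -> R -> R;
  sd_tau : sd_index -> R;
  sd_G : sd_index -> R -> V -> V -> R }.

Definition closed_support (phi : M -> R) : set M := closure [set x | phi x != 0].

(* (U_l) is a locally finite covering of M; (U_l, (x^i)_l) is the restriction to
   U_l of the coordinate system [sd_chart l], defined around its closure. *)
Definition valid_covering (S : smoothing_data) : Prop :=
  [/\ forall l, [/\ atlas (sd_chart l), open (sd_U (s := S) l), compact (closure (sd_U l)) &
        closure (sd_U l) `<=` cdom (sd_chart l)],
      forall x, exists l, sd_U (s := S) l x &
      forall x : M, exists2 W : set M, nbhs x W &
        finite_set [set l | sd_U (s := S) l `&` W !=set0]].

Definition partition_of_unity (S : smoothing_data) : Prop :=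
  [/\ forall l c, atlas c -> smooth_on (cimg c) (sd_phi (s := S) l \o cinv c : _ -> R^o),
      forall l x, 0 <= sd_phi (s := S) l x,
      forall l, closed_support (sd_phi (s := S) l) `<=` sd_U l &
      forall x, \sum_(l \in [set: sd_index S]) sd_phi l x = 1].

Definition valid_parameters (S : smoothing_data) (l : sd_index S) : Prop :=
  let b := smoothing_bound (sd_chart l) (sd_U l) in
  [/\ forall e : R, 0 < e < 1 -> 0 < sd_u l e,
      forall e e' : R, 0 < e -> e <= e' -> e' < 1 -> sd_u l e <= sd_u l e',
      sd_u l e @[e --> 0^'+] --> (0 : R),
      0 < sd_tau l < b &
      forall e : R, 0 < e < sd_tau l -> sd_u l e < b].

Definition valid_smoothing_data (S : smoothing_data) : Prop :=
  [/\ valid_covering S, partition_of_unity S,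
      forall l : sd_index S, valid_parameters l &
      forall l : sd_index S, is_vertical_smoothing (sd_chart l) (sd_U l)
        (sd_u l) (sd_tau l) (sd_G l)].

Section LocalSmoothing.
Variables (S : smoothing_data) (l : sd_index S).

Definition sd_nu : \bar R :=
  euclid_dist (frontier (cmap (sd_chart l) @` interior (closed_support (sd_phi l))))
        (frontier (cmap (sd_chart l) @` sd_U l)).

Definition sd_delta : R := fine (Order.min (sd_tau l)%:E sd_nu).

Definition sd_psi (e : R) : R := e * sd_delta.

(* F_{e,l} in the natural coordinates of U_l.  For x near the closure of V_l the
   factor [mollifier_scaled] vanishes when z is not in U_l, hence the values of
   G outside of U_l play no role. *)
Definition local_smoothing (e : R) (x y : V) : R :=
  Num.sqrt (Rn_integral (fun z =>
    mollifier_scaled (sd_psi e) (x - z) * sd_G l (sd_psi e) z y ^+ 2)).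

End LocalSmoothing.

Definition is_mollifier_smoothing (F_ : R -> tangent_bundle M -> R) : Prop :=
  exists2 S : smoothing_data, valid_smoothing_data S &
    forall e : R, 0 < e < 1 -> forall p, 0 <= F_ e p /\
      F_ e p ^+ 2 = \sum_(l \in [set: sd_index S])
        sd_phi l (base p) *
        (let q := tcoord (sd_chart l) p in local_smoothing l e q.1 q.2) ^+ 2.

End MollifierSmoothing.

(* Main.v *)
(* The Cartan-type forms are rational expressions in y and in the derivatives of L^2,
   L being the Finsler structure in natural coordinates, with denominator the
   determinant of the Hessian of L^2, which does not vanish in the limit.  So
   everything reduces to the locally uniform convergence on TM \ 0 of F_e^2 to F^2
   together with all derivatives.  The notion [scv] of such a convergence is stable
   under algebraic operations, composition, mollification and the implicit function
   theorem; the latter is needed because 1 / G_e is, up to the factor r_U, the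
   solution s of (zeta_e * F)(x, s y) = r_U.  Finally D_e X E - D X E is
   C^oo-linear in E, hence it is determined by the difference of the connection
   forms. *)
Require Import Defs.
From HB Require Import structures.
From mathcomp Require Import all_boot all_order all_algebra finmap.
From mathcomp Require Import all_classical all_reals all_analysis.
From mathcomp Require Import ring lra.
Set Implicit Arguments.
Unset Strict Implicit.
Unset Printing Implicit Defensive.
Import Order.TTheory GRing.Theory Num.Theory numFieldNormedType.Exports.
Local Open Scope classical_set_scope.
Local Open Scope ring_scope.

(** * Families converging with their derivatives *)

(** The smoothed objects exist only for [e > 0]. Each family is therefore prolonged to [e <= 0] by
    its limit, so that convergence from the right, jointly with the point, becomes continuity at
    [e = 0], and local statements become uniform by compactness. The shape of [scv] comes from the
    convolutions. [F] is not smooth on the zero section, and the wide mollifier of radius 2 r_U /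
    r_u can reach it. In the narrow kernel the scale is moved into the argument of [F], so that
    derivatives fall on [F] near a nonzero vector. In the wide kernel the vertical derivatives fall
    on the mollifier, and [F] is differentiated only along the base, which keeps it homogeneous,
    hence continuous at zero vectors. The integration variable is thus a parameter in which only
    continuity is available: this is the variable [w]. A Finsler structure is assumed neither
    nonnegative nor subadditive. Both properties are recovered from the smoothing data, that is from
    the radii and the norms [G_e]; then [F] itself serves as the C^0-Finsler structure that measures
    the convergence. *)

Section Differentiability.
Variables (R : numFieldType) (V W : normedModType R).

(** Entry point for the functions whose differential is found by an estimate: uniqueness of the
    differential turns a candidate [ell] with small remainder into both existence and value. *)
Lemma differentiable_eps (f ell : V -> W) (x : V) :
  linear ell -> continuous ell ->
  (forall e : R, 0 < e -> \forall h \near 0, `|f (h + x) - f x - ell h| <= e * `|h|) ->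
  differentiable f x /\ 'd f x = ell :> (V -> W).
Proof.
move=> lin_ell cell fell.
pose g : {linear V -> W} := HB.pack ell (GRing.isLinear.Build _ _ _ _ ell lin_ell).
have E : f \o shift x = cst (f x) + g +o_ 0 id.
  apply/eqaddoP => e e0; have := fell e e0; apply: filterS => h.
  by rewrite !fctE /= opprD addrA.
have dE : 'd f x = g :> (V -> W) by exact: diff_unique.
split; last by [].
by apply/diff_locallyP; rewrite dE.
Qed.

Lemma diff_near (f g : V -> W) (x : V) :
  (\forall y \near x, f y = g y) -> differentiable f x ->
  differentiable g x /\ 'd g x = 'd f x :> (V -> W).
Proof.
move=> fg df; have fgx := nbhs_singleton fg.
apply: differentiable_eps; [exact: linearP|exact: diff_continuous|] => e e0.
have /diff_locally/eqaddoP/(_ e e0) := df.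
have : \forall h \near (0 : V), f (h + x) = g (h + x).
  by move: fg; rewrite (near_shift 0) /=; apply: filterS => h /=; rewrite subr0.
apply: filterS2 => h E; rewrite !fctE /= E fgx opprD addrA; exact.
Qed.

Lemma differentiable_near (f g : V -> W) (x : V) :
  (\forall y \near x, f y = g y) -> differentiable f x -> differentiable g x.
Proof. by move=> fg /(diff_near fg)[]. Qed.

Lemma derive_bigsum (J : finType) (f : J -> V -> W) (x v : V) :
  (forall j, differentiable (f j) x) ->
  'D_v (fun z => \sum_j f j z) x = \sum_j 'D_v (f j) x.
Proof.
move=> df; suff H (s : seq J) : differentiable (fun z => \sum_(j <- s) f j z) x /\
    'D_v (fun z => \sum_(j <- s) f j z) x = \sum_(j <- s) 'D_v (f j) x.
  by case: (H (index_enum J)).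
elim: s => [|j s [IH1 IH2]].
  rewrite big_nil (_ : (fun z => _) = cst 0); last by apply/funext => z; rewrite big_nil.
  by split; [exact: differentiable_cst|rewrite derive_cst].
rewrite big_cons (_ : (fun z => _) = f j + (fun z => \sum_(j <- s) f j z)); last first.
  by apply/funext => z; rewrite big_cons.
split; first exact: differentiableD.
by rewrite deriveD ?IH2 //; exact: diff_derivable.
Qed.

End Differentiability.

Lemma cvg_to_pair (T : Type) (F : set_system T) (U V : topologicalType)
  (f : T -> U) (g : T -> V) (a : U) (b : V) : Filter F ->
  f @ F --> a -> g @ F --> b -> (fun x => (f x, g x)) @ F --> (a, b).
Proof. by move=> FF fa gb; exact: cvg_pair. Qed.

Lemma cts_comp (S T U : topologicalType) (f : S -> T) (g : T -> U) (x : S) :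
  {for x, continuous f} -> {for f x, continuous g} ->
  {for x, continuous (fun y => g (f y))}.
Proof. by move=> cf cg; exact: (cvg_comp _ _ cf cg). Qed.

Lemma cts_pair (S T U : topologicalType) (f : S -> T) (g : S -> U) (x : S) :
  {for x, continuous f} -> {for x, continuous g} ->
  {for x, continuous (fun y => (f y, g y))}.
Proof. by move=> cf cg; exact: cvg_to_pair. Qed.

Lemma cts_cst (S T : topologicalType) (a : T) (x : S) : {for x, continuous (fun _ : S => a)}.
Proof. exact: cst_continuous. Qed.

Lemma cts_id (S : topologicalType) (x : S) : {for x, continuous (fun y : S => y)}.
Proof. exact: cvg_id. Qed.

Lemma cts_near (S T : topologicalType) (f g : S -> T) (x : S) :
  (\forall y \near x, f y = g y) -> {for x, continuous f} -> {for x, continuous g}.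
Proof.
move=> fg cf; have fgx := nbhs_singleton fg.
rewrite /prop_for /continuous_at -fgx; apply: cvg_trans cf; apply: near_eq_cvg.
by move: fg; apply: filterS => y ->.
Qed.

Lemma near_and (T : topologicalType) (x : T) (P Q : T -> Prop) :
  (\forall y \near x, P y) -> (\forall y \near x, Q y) -> \forall y \near x, P y /\ Q y.
Proof. exact: filterI. Qed.

Lemma near_forall (T : topologicalType) (x : T) (J : finType) (P : J -> T -> Prop) :
  (forall j, \forall y \near x, P j y) -> \forall y \near x, forall j, P j y.
Proof. by move=> h; exact: (@filter_forall _ J P _ _ h). Qed.

Lemma cts_fst (S T : topologicalType) (x : S * T) : {for x, continuous fst}.
Proof. by case: x => a b; exact: cvg_fst. Qed.

Lemma cts_snd (S T : topologicalType) (x : S * T) : {for x, continuous snd}.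
Proof. by case: x => a b; exact: cvg_snd. Qed.

Lemma cts_22 (S T U : topologicalType) (t : S * (T * U)) :
  {for t, continuous (fun t : S * (T * U) => t.2.2)}.
Proof. exact: (@cts_comp _ _ _ snd snd t (@cts_snd _ _ _) (@cts_snd _ _ _)). Qed.

Lemma cts_21 (S T U : topologicalType) (t : S * (T * U)) :
  {for t, continuous (fun t : S * (T * U) => t.2.1)}.
Proof. exact: (@cts_comp _ _ _ snd fst t (@cts_snd _ _ _) (@cts_fst _ _ _)). Qed.

Section Families.
Variables (R : realType) (I W : topologicalType) (Z : normedModType R).
Implicit Types (e : I) (w : W) (z : Z).

(** The interior of a neighbourhood is a neighbourhood of each of its points; restricting it to a
    slice gives the germs needed to compare derivatives in [z] at all nearby points. *)
Lemma near_slice (P : I * (W * Z) -> Prop) e0 w0 z0 :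
  (\forall t \near (e0, (w0, z0)), P t) ->
  \forall t \near (e0, (w0, z0)), \forall z \near t.2.2, P (t.1, (t.2.1, z)).
Proof.
move=> /nbhs_interior; apply: filterS => -[e [w z]] /= h.
have : (fun z => (e, (w, z))) @ z --> (e, (w, z)).
  by apply: cvg_to_pair; [exact: cvg_cst|apply: cvg_to_pair; [exact: cvg_cst|exact: cvg_id]].
by move=> c; exact: (c _ h).
Qed.

Lemma near_slice2 (P : I * (W * Z) -> Prop) e0 w0 z0 :
  (\forall t \near (e0, (w0, z0)), P t) ->
  \forall t \near (e0, (w0, z0)), \forall s \near t.2, P (t.1, s).
Proof.
move=> /nbhs_interior; apply: filterS => -[e s] /= h.
have : (fun s => (e, s)) @ s --> (e, s).
  by apply: cvg_to_pair; [exact: cvg_cst|exact: cvg_id].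
by move=> c; exact: (c _ h).
Qed.

(* [scv k e0 w0 z0 f]: as [e -> e0], [w -> w0], [z -> z0], the derivatives of order
   at most [k] of [f e w] in [z] converge to those of [f e0 w0] at [z0].  Only the
   continuity in [(w, z)] is required for a fixed [e != e0]. *)
Fixpoint scv (Y : normedModType R) (k : nat) e0 w0 z0 (f : I -> W -> Z -> Y) : Prop :=
  [/\ {for (e0, (w0, z0)), continuous (fun t : I * (W * Z) => f t.1 t.2.1 t.2.2)},
      \forall t \near (e0, (w0, z0)),
        {for t.2, continuous (fun s : W * Z => f t.1 s.1 s.2)} &
      if k is k'.+1 then
        (\forall t \near (e0, (w0, z0)), differentiable (f t.1 t.2.1) t.2.2) /\
        (forall v, scv k' e0 w0 z0 (fun e w => 'D_v (f e w)))
      else True].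

Section Basic.
Variable Y : normedModType R.
Implicit Types f g : I -> W -> Z -> Y.

Lemma scv_cts k e0 w0 z0 f : scv k e0 w0 z0 f ->
  {for (e0, (w0, z0)), continuous (fun t : I * (W * Z) => f t.1 t.2.1 t.2.2)}.
Proof. by case: k => [|k] []. Qed.

Lemma scv_near_cts k e0 w0 z0 f : scv k e0 w0 z0 f ->
  \forall t \near (e0, (w0, z0)),
        {for t.2, continuous (fun s : W * Z => f t.1 s.1 s.2)}.
Proof. by case: k => [|k] []. Qed.

Lemma scv_diff k e0 w0 z0 f : scv k.+1 e0 w0 z0 f ->
  \forall t \near (e0, (w0, z0)), differentiable (f t.1 t.2.1) t.2.2.
Proof. by case=> _ _ []. Qed.

Lemma scv_derive k e0 w0 z0 f v : scv k.+1 e0 w0 z0 f ->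
  scv k e0 w0 z0 (fun e w => 'D_v (f e w)).
Proof. by case=> _ _ [] _ h; exact: h. Qed.

Lemma scvW k e0 w0 z0 f : scv k.+1 e0 w0 z0 f -> scv k e0 w0 z0 f.
Proof.
elim: k f => [|k IH] f; first by case.
by case=> h1 h2 [h3 h4]; split => //; split => // v; exact/IH/h4.
Qed.

(** Every clause of [scv] concerns only germs at [(e0, w0, z0)]. This lets a family defined by cases
    on the sign of [e], or through a square root, be replaced by a formula valid near the point. *)
Lemma scv_eq k e0 w0 z0 f g :
  (\forall t \near (e0, (w0, z0)), f t.1 t.2.1 t.2.2 = g t.1 t.2.1 t.2.2) ->
  scv k e0 w0 z0 f -> scv k e0 w0 z0 g.
Proof.
elim: k f g => [|k IH] f g fg [h1 h2 h3].
all: have fg0 := nbhs_singleton fg; rewrite /= in fg0.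
all: have g1 : {for (e0, (w0, z0)), continuous (fun t : I * (W * Z) => g t.1 t.2.1 t.2.2)}
  by rewrite /prop_for /continuous_at /= -fg0;
     apply: cvg_trans h1; apply: near_eq_cvg; move: fg; apply: filterS => t ->.
all: have g2 : \forall t \near (e0, (w0, z0)),
        {for t.2, continuous (fun s : W * Z => g t.1 s.1 s.2)}
  by have := near_slice2 fg; move: h2; apply: filterS2 => -[e s] /= c1 E;
     have Es := nbhs_singleton E; rewrite /prop_for /continuous_at /= -Es;
     apply: cvg_trans c1; apply: near_eq_cvg; move: E; apply: filterS => t ->.
- by split.
case: h3 => h3 h4; split => //; split.
  have := near_slice fg; move: h3; apply: filterS2 => -[e [w z]] /= d1 E.
  exact: differentiable_near d1.
move=> v; apply: (IH (fun e w => 'D_v (f e w))); last exact: h4.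
have := near_slice fg; apply: filterS => -[e [w z]] /= E.
exact: near_eq_derive.
Qed.

(** All derivatives in [z] vanish, so continuity suffices. The weight [u] and the integration
    variable enter the convolutions in this way. *)
Lemma scv_param k e0 w0 z0 (a : I -> W -> Y) :
  {for (e0, w0), continuous (fun s : I * W => a s.1 s.2)} ->
  (\forall s \near (e0, w0), {for s.2, continuous (a s.1)}) ->
  scv k e0 w0 z0 (fun e w _ => a e w).
Proof.
have H (b : I -> W -> Y) : {for (e0, w0), continuous (fun s : I * W => b s.1 s.2)} ->
    (\forall s \near (e0, w0), {for s.2, continuous (b s.1)}) ->
    {for (e0, (w0, z0)), continuous (fun t : I * (W * Z) => b t.1 t.2.1)} /\
    \forall t \near (e0, (w0, z0)),
        {for t.2, continuous (fun s : W * Z => b t.1 s.1)}.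
  move=> b1 b2; have c : (fun t : I * (W * Z) => (t.1, t.2.1)) @ (e0, (w0, z0)) --> (e0, w0).
    by apply: cts_pair; [exact: cts_fst|exact: (cts_comp (@cts_snd _ _ _) (@cts_fst _ _ _))].
  split; first exact: (cts_comp (g := fun s => b s.1 s.2) c b1).
  have : \forall t \near (e0, (w0, z0)), {for t.2.1, continuous (b t.1)} := c _ b2.
  apply: filterS => -[e [w z]] /= h.
  by apply: (@cts_comp _ _ _ fst (b e) (w, z)) h; exact: cts_fst.
elim: k a => [|k IH] a a1 a2; have [h1 h2] := H a a1 a2; split => //; split.
  by near=> t; exact: differentiable_cst.
move=> v; apply: (scv_eq (f := fun _ _ _ => 0)).
  by near=> t; rewrite derive_cst.
by apply: (IH (fun _ _ => 0)); [exact: cvg_cst|near=> s; exact: cvg_cst].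
Unshelve. all: by end_near. Qed.

Lemma scv_cst k e0 w0 z0 (a : Y) : scv k e0 w0 z0 (fun _ _ _ => a).
Proof.
apply: (@scv_param _ _ _ _ (fun _ _ => a)); first exact: cvg_cst.
by near=> s; exact: cvg_cst.
Unshelve. all: by end_near. Qed.

Lemma scv_lin k e0 w0 z0 (l : {linear Z -> Y}) : continuous l ->
  scv k e0 w0 z0 (fun _ _ z => l z).
Proof.
move=> cl.
have h1 : {for (e0, (w0, z0)), continuous (fun t : I * (W * Z) => l t.2.2)}.
  by apply: (@cts_comp _ _ _ (fun t : I * (W * Z) => t.2.2) l) (cl _); exact: (cts_comp (@cts_snd _ _ _) (@cts_snd _ _ _)).
have h2 : \forall t \near (e0, (w0, z0)), {for t.2, continuous (fun s : W * Z => l s.2)}.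
  by near=> t; apply: (@cts_comp _ _ _ snd l) (cl _); exact: cts_snd.
case: k => [|k]; split => //; split.
  by near=> t; exact: linear_differentiable.
move=> v; apply: (scv_eq (f := fun _ _ _ => l v)); last exact: scv_cst.
near=> t; rewrite deriveE; last exact: linear_differentiable.
by rewrite diff_lin.
Unshelve. all: by end_near. Qed.

Lemma scvD k e0 w0 z0 f g : scv k e0 w0 z0 f -> scv k e0 w0 z0 g ->
  scv k e0 w0 z0 (fun e w z => f e w z + g e w z).
Proof.
elim: k f g => [|k IH] f g hf hg; split.
1,4: exact: cvgD (scv_cts hf) (scv_cts hg).
1,3: have := scv_near_cts hg; have := scv_near_cts hf; apply: filterS2 => -[e [w z]] /= cf cg;
  exact: cvgD cf cg.
  by [].
split.
  have := scv_diff hg; have := scv_diff hf; apply: filterS2 => t df dg.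
  exact: differentiableD.
move=> v; have := IH _ _ (scv_derive v hf) (scv_derive v hg); apply: scv_eq.
have := scv_diff hg; have := scv_diff hf; apply: filterS2 => t df dg.
by rewrite -deriveD //; exact: diff_derivable.
Qed.

Lemma scvN k e0 w0 z0 f : scv k e0 w0 z0 f ->
  scv k e0 w0 z0 (fun e w z => - f e w z).
Proof.
elim: k f => [|k IH] f hf; split.
1,4: exact: cvgN (scv_cts hf).
1,3: have := scv_near_cts hf; apply: filterS => -[e [w z]] /= cf; exact: cvgN cf.
  by [].
split.
  have := scv_diff hf; apply: filterS => t df.
  exact: differentiableN.
move=> v; have := IH _ (scv_derive v hf); apply: scv_eq.
have := scv_diff hf; apply: filterS => t df.
by rewrite -deriveN //; exact: diff_derivable.
Qed.

Lemma scvB k e0 w0 z0 f g : scv k e0 w0 z0 f -> scv k e0 w0 z0 g ->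
  scv k e0 w0 z0 (fun e w z => f e w z - g e w z).
Proof. by move=> hf hg; apply: scvD => //; exact: scvN. Qed.

Lemma scv_sum (J : Type) (s : seq J) (P : pred J) k e0 w0 z0 (f : J -> I -> W -> Z -> Y) :
  (forall j, P j -> scv k e0 w0 z0 (f j)) ->
  scv k e0 w0 z0 (fun e w z => \sum_(j <- s | P j) f j e w z).
Proof.
move=> hf; elim: s => [|j s IH].
  apply: (scv_eq (f := fun _ _ _ => 0)); last exact: scv_cst.
  by near=> t; rewrite big_nil.
case: (boolP (P j)) => Pj.
  apply: (scv_eq (f := fun e w z => f j e w z + \sum_(j <- s | P j) f j e w z)).
    by near=> t; rewrite big_cons Pj.
  by apply: scvD => //; exact: hf.
apply: scv_eq IH.
by near=> t; rewrite big_cons (negbTE Pj).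
Unshelve. all: by end_near. Qed.

End Basic.

Section Scalar.
Implicit Types f g : I -> W -> Z -> R.

Lemma scvM k e0 w0 z0 f g : scv k e0 w0 z0 f -> scv k e0 w0 z0 g ->
  scv k e0 w0 z0 (fun e w z => f e w z * g e w z).
Proof.
elim: k f g => [|k IH] f g hf hg; split.
1,4: exact: cvgM (scv_cts hf) (scv_cts hg).
1,3: have := scv_near_cts hg; have := scv_near_cts hf; apply: filterS2 => -[e [w z]] /= cf cg;
  exact: cvgM cf cg.
  by [].
split.
  have := scv_diff hg; have := scv_diff hf; apply: filterS2 => t df dg.
  exact: differentiableM.
move=> v; have := scvD (IH _ _ (scvW hf) (scv_derive v hg)) (IH _ _ (scvW hg) (scv_derive v hf)).
apply: scv_eq.
have := scv_diff hg; have := scv_diff hf; apply: filterS2 => t df dg.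
by rewrite deriveM //; exact: diff_derivable.
Qed.

Lemma scvV k e0 w0 z0 f : f e0 w0 z0 != 0 -> scv k e0 w0 z0 f ->
  scv k e0 w0 z0 (fun e w z => (f e w z)^-1).
Proof.
move=> f0; elim: k f f0 => [|k IH] f f0 hf.
all: have fn0 : \forall t \near (e0, (w0, z0)), f t.1 t.2.1 t.2.2 != 0
  by exact: (cvgr_neq0 _ (scv_cts hf)).
all: have h1 : {for (e0, (w0, z0)), continuous (fun t : I * (W * Z) => (f t.1 t.2.1 t.2.2)^-1)}
  by exact: (cvgV f0 (scv_cts hf)).
all: have h2 : \forall t \near (e0, (w0, z0)),
   {for t.2, continuous (fun s : W * Z => (f t.1 s.1 s.2)^-1)}
  by have := fn0; have := scv_near_cts hf; apply: filterS2 => -[e [w z]] /= cf fn; exact: (cvgV fn cf).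
  by split.
split => //; split.
  have := fn0; have := scv_diff hf; apply: filterS2 => t df fn; exact: differentiableV.
move=> v; have iV := IH f f0 (scvW hf).
have := scvN (scvM (scvM iV iV) (scv_derive v hf)); apply: scv_eq.
have := fn0; have := scv_diff hf; apply: filterS2 => t df fn.
by rewrite deriveV //; [rewrite /GRing.scale /= expr2 invfM mulNr|exact: diff_derivable].
Qed.

Lemma scv_prod (J : Type) (s : seq J) (P : pred J) k e0 w0 z0 (f : J -> I -> W -> Z -> R) :
  (forall j, P j -> scv k e0 w0 z0 (f j)) ->
  scv k e0 w0 z0 (fun e w z => \prod_(j <- s | P j) f j e w z).
Proof.
move=> hf; elim: s => [|j s IH].
  apply: (scv_eq (f := fun _ _ _ => (1 : R))); last exact: (@scv_cst R^o).
  by near=> t; rewrite big_nil.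
case: (boolP (P j)) => Pj.
  apply: (scv_eq (f := fun e w z => f j e w z * \prod_(j <- s | P j) f j e w z)).
    by near=> t; rewrite big_cons Pj.
  by apply: scvM => //; exact: hf.
apply: scv_eq IH.
by near=> t; rewrite big_cons (negbTE Pj).
Unshelve. all: by end_near. Qed.

Lemma scvX m k e0 w0 z0 f : scv k e0 w0 z0 f ->
  scv k e0 w0 z0 (fun e w z => f e w z ^+ m).
Proof.
move=> hf; elim: m => [|m IH].
  by apply: (scv_eq (f := fun _ _ _ => (1 : R))); [near=> t; rewrite expr0|exact: (@scv_cst R^o)].
by apply: scv_eq (scvM hf IH); near=> t; rewrite exprS.
Unshelve. all: by end_near. Qed.

End Scalar.

Lemma scv_smooth (Y : normedModType R) (A : set Z) (f : Z -> Y) k e0 w0 z0 :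
  open A -> A z0 -> smooth_on A f -> scv k e0 w0 z0 (fun _ _ => f).
Proof.
move=> oA Az0.
have nA : \forall t \near (e0, (w0, z0)), A t.2.2.
  have c : (fun t : I * (W * Z) => t.2.2) @ (e0, (w0, z0)) --> z0.
    exact: (@cts_comp _ _ _ snd snd (e0, (w0, z0)) (@cts_snd _ _ _) (@cts_snd _ _ _)).
  by apply: c; exact: open_nbhs_nbhs.
have H (g : Z -> Y) : Ck_on 0 A g -> scv 0 e0 w0 z0 (fun _ _ => g).
  move=> cg; split => //.
    exact: (@cts_comp _ _ _ (fun t : I * (W * Z) => t.2.2) g (e0, (w0, z0)) (@cts_22 _ _ _ _) (cg _ Az0)).
  move: nA; apply: filterS => t Az; apply: (@cts_comp _ _ _ snd g) (cg _ Az); exact: cts_snd.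
suff : Ck_on k A f -> scv k e0 w0 z0 (fun _ _ => f) by move=> h sf; exact/h/sf.
elim: k f => [|k IH] f; first exact: H.
move=> [df Df]; have [h1 h2 _] : scv 0 e0 w0 z0 (fun _ _ => f).
  by apply: H => x Ax; exact/differentiable_continuous/df.
split => //; split; last by move=> v; exact: (IH _ (Df v)).
by move: nA; apply: filterS => t; exact: df.
Qed.

(** Converse of [scv_smooth]: for a constant family, [scv] at all orders is smoothness. Smoothness
    on a set can thus be proved with the calculus of [scv]. *)
Lemma smooth_scv (Y : normedModType R) (A : set Z) (f : Z -> Y) e0 w0 :
  (forall z, A z -> forall k, scv k e0 w0 z (fun _ _ => f)) -> smooth_on A f.
Proof.
move=> h k; elim: k f h => [|k IH] f h.
  by move=> x Ax; have /nbhs_singleton := scv_near_cts (h x Ax 0%N);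
    move=> c; apply: (@cts_comp _ _ _ (fun z => (w0, z)) (fun s => f s.2) x _ c);
    apply: cts_pair; [exact: cvg_cst|exact: cvg_id].
split; first by move=> x Ax; exact: (nbhs_singleton (scv_diff (h x Ax 1%N))).
by move=> v; apply: IH => z Az m; exact: (scv_derive v (h z Az m.+1)).
Qed.

End Families.

Section Composition.
Variables (R : realType) (I W : topologicalType) (Z : normedModType R).

Lemma scv_post (Y Y' : normedModType R) (l : {linear Y -> Y'}) k (e0 : I) (w0 : W)
    (z0 : Z) (f : I -> W -> Z -> Y) : continuous l ->
  scv k e0 w0 z0 f -> scv k e0 w0 z0 (fun e w z => l (f e w z)).
Proof.
move=> cl; elim: k f => [|k IH] f hf; split.
1,4: exact: (@cts_comp _ _ _ (fun t : I * (W * Z) => f t.1 t.2.1 t.2.2) l _ (scv_cts hf) (cl _)).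
1,3: have := scv_near_cts hf; apply: filterS => t cf;
  exact: (@cts_comp _ _ _ (fun s : W * Z => f t.1 s.1 s.2) l _ cf (cl _)).
  by [].
split.
  have := scv_diff hf; apply: filterS => t df.
  by apply: (@differentiable_comp _ _ _ _ (f t.1 t.2.1) l t.2.2) df _; exact: linear_differentiable.
move=> v; have := IH _ (scv_derive v hf); apply: scv_eq.
have := scv_diff hf; apply: filterS => t df.
have dl : differentiable l (f t.1 t.2.1 t.2.2) by exact: linear_differentiable.
rewrite [RHS]deriveE; last exact: (@differentiable_comp _ _ _ _ (f t.1 t.2.1) l t.2.2).
by rewrite (@diff_comp _ _ _ _ (f t.1 t.2.1) l t.2.2) //= diff_lin // deriveE.
Qed.

Lemma scvZl (Y : normedModType R) (b : Y) k (e0 : I) (w0 : W) (z0 : Z)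
    (f : I -> W -> Z -> R) :
  scv k e0 w0 z0 f -> scv k e0 w0 z0 (fun e w z => f e w z *: b).
Proof.
pose l : {linear R^o -> Y} := HB.pack (fun x : R^o => x *: b)
  (GRing.isLinear.Build R R^o Y *:%R _ (fun a x y => etrans (scalerDl _ _ _) (congr1 (+%R^~ (y *: b)) (esym (scalerA _ _ _))))).
by move=> hf; apply: (@scv_post R^o Y l) hf => x; exact: scalel_continuous.
Qed.

Lemma scv_coord m (i : 'I_m) k (e0 : I) (w0 : W) (z0 : Z) (f : I -> W -> Z -> 'rV[R]_m) :
  scv k e0 w0 z0 f -> scv k e0 w0 z0 (fun e w z => f e w z 0 i).
Proof.
have lin : linear (fun x : 'rV[R]_m => x 0 i : R^o) by move=> a x y; rewrite !mxE.
pose l : {linear 'rV[R]_m -> R^o} := HB.pack (fun x : 'rV[R]_m => x 0 i : R^o)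
  (GRing.isLinear.Build _ _ _ _ _ lin).
by move=> hf; apply: (@scv_post 'rV[R]_m R^o l) hf => x; exact: coord_continuous.
Qed.

Lemma scv_row m k (e0 : I) (w0 : W) (z0 : Z) (f : I -> W -> Z -> 'rV[R]_m) :
  (forall i, scv k e0 w0 z0 (fun e w z => f e w z 0 i)) -> scv k e0 w0 z0 f.
Proof.
move=> hf.
apply: (scv_eq (f := fun e w z => \sum_i f e w z 0 i *: delta_mx 0 i)).
  by near=> t; rewrite -row_sum_delta.
by apply: scv_sum => i _; exact: scvZl.
Unshelve. all: by end_near. Qed.

(** The inner map is given as a combination of fixed vectors [b j] because [scv] differentiates only
    along fixed directions: the chain rule becomes the sum of D_v(c_j) times the derivative of [h]
    along [b j], to which the induction hypothesis applies. *)
Lemma scv_comp (T : normedModType R) (J : finType) (b : J -> T) k (e0 : I) (w0 : W)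
    (z0 : Z) (c : J -> I -> W -> Z -> R) (h : I -> W -> T -> R) :
  (forall j, scv k e0 w0 z0 (c j)) ->
  scv k e0 w0 (\sum_j c j e0 w0 z0 *: b j) h ->
  scv k e0 w0 z0 (fun e w z => h e w (\sum_j c j e w z *: b j)).
Proof.
pose phi e w z := \sum_j c j e w z *: b j.
have phiE k' : (forall j, scv k' e0 w0 z0 (c j)) -> scv k' e0 w0 z0 phi.
  by move=> hc; apply: scv_sum => j _; exact: scvZl.
pose m (t : I * (W * Z)) := (t.1, (t.2.1, phi t.1 t.2.1 t.2.2)).
have cm k' : (forall j, scv k' e0 w0 z0 (c j)) -> {for (e0, (w0, z0)), continuous m}.
  move=> /phiE/scv_cts cphi; apply: cts_pair; first exact: cts_fst.
  by apply: cts_pair cphi; exact: cts_21.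
have nm k' : (forall j, scv k' e0 w0 z0 (c j)) -> \forall t \near (e0, (w0, z0)),
    {for t.2, continuous (fun s : W * Z => (s.1, phi t.1 s.1 s.2))}.
  move=> /phiE/scv_near_cts; apply: filterS => t ct.
  by apply: cts_pair ct; exact: cts_fst.
elim: k h => [|k IH] h hc hh; split.
1,4: exact: (@cts_comp _ _ _ m (fun t => h t.1 t.2.1 t.2.2) _ (cm _ hc) (scv_cts hh)).
1,3: have N : \forall t \near (e0, (w0, z0)), {for (m t).2,
    continuous (fun s : W * T => h (m t).1 s.1 s.2)} := cm _ hc _ (scv_near_cts hh);
  have := nm _ hc; move: N; apply: filterS2 => t ch cphi;
  exact: (@cts_comp _ _ _ (fun s : W * Z => (s.1, phi t.1 s.1 s.2))
     (fun s => h t.1 s.1 s.2) _ cphi ch).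
  by [].
have N : \forall t \near (e0, (w0, z0)),
  differentiable (h t.1 t.2.1) (phi t.1 t.2.1 t.2.2) := cm _ hc _ (scv_diff hh).
have dphi := scv_diff (phiE _ hc).
split.
  move: N dphi; apply: filterS2 => t dh dphi; exact: (@differentiable_comp _ _ _ _ (phi t.1 t.2.1) (h t.1 t.2.1) t.2.2).
move=> v; apply: (scv_eq (f := fun e w z => \sum_j 'D_v (c j e w) z * 'D_(b j) (h e w) (phi e w z))).
  have dc : \forall t \near (e0, (w0, z0)), forall j, differentiable (c j t.1 t.2.1) t.2.2.
    have H j : \forall t \near (e0, (w0, z0)), differentiable (c j t.1 t.2.1) t.2.2 := scv_diff (hc j).
    exact: (@filter_forall _ J (fun j t => differentiable (c j t.1 t.2.1) t.2.2) _ _ H).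
  move: N dphi dc; apply: filterS3 => t dh dphi dc.
  rewrite [RHS]deriveE; last exact: (@differentiable_comp _ _ _ _ (phi t.1 t.2.1) (h t.1 t.2.1) t.2.2).
  rewrite (@diff_comp _ _ _ _ (phi t.1 t.2.1) (h t.1 t.2.1) t.2.2) //= -(deriveE _ dphi).
  have -> : 'D_v (phi t.1 t.2.1) t.2.2 = \sum_j 'D_v (c j t.1 t.2.1) t.2.2 *: b j.
    rewrite (derive_bigsum (f := fun j z => c j t.1 t.2.1 z *: b j)); last first.
      by move=> j; exact: differentiableZl.
    by apply: eq_bigr => j _; rewrite deriveE; [rewrite diffZl // deriveE|exact: differentiableZl].
  rewrite linear_sum; apply: eq_bigr => j _.
  by rewrite (deriveE _ dh) linearZ.
apply: scv_sum => j _; apply: scvM; first exact: scv_derive.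
apply: (IH (fun e w => 'D_(b j) (h e w))); last exact: scv_derive.
by move=> i; exact: scvW.
Qed.

Lemma scv_map (I' W' : topologicalType) (Y : normedModType R) (r : I' -> I) (q : W' -> W) k
   (e0 : I') (w0 : W') (z0 : Z) (f : I -> W -> Z -> Y) :
  {for e0, continuous r} -> continuous q ->
  scv k (r e0) (q w0) z0 f -> scv k e0 w0 z0 (fun e w => f (r e) (q w)).
Proof.
move=> cr cq; pose m (t : I' * (W' * Z)) := (r t.1, (q t.2.1, t.2.2)).
have cm : {for (e0, (w0, z0)), continuous m}.
  apply: cts_pair; first exact: (@cts_comp _ _ _ fst r (e0, (w0, z0)) (@cts_fst _ _ _) cr).
  apply: cts_pair; last exact: cts_22.
  exact: (@cts_comp _ _ _ (fun t => t.2.1) q (e0, (w0, z0)) (@cts_21 _ _ _ _) (cq _)).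
have cm2 (s : W' * Z) : {for s, continuous (fun s : W' * Z => (q s.1, s.2))}.
  apply: cts_pair; last exact: cts_snd.
  exact: (@cts_comp _ _ _ fst q s (@cts_fst _ _ _) (cq _)).
elim: k f => [|k IH] f hf; split.
1,4: exact: (@cts_comp _ _ _ m (fun t => f t.1 t.2.1 t.2.2) _ cm (scv_cts hf)).
1,3: have N : \forall t \near (e0, (w0, z0)), {for (m t).2,
    continuous (fun s : W * Z => f (m t).1 s.1 s.2)} := cm _ (scv_near_cts hf);
  move: N; apply: filterS => t ch;
  exact: (@cts_comp _ _ _ (fun s : W' * Z => (q s.1, s.2))
     (fun s => f (r t.1) s.1 s.2) _ (cm2 t.2) ch).
  by [].
split; first exact: (cm _ (scv_diff hf)).
by move=> v; apply: (IH (fun e w => 'D_v (f e w))); exact: scv_derive.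
Qed.

End Composition.

(** * The iterated integral *)

Section RowNorm.
Variable R : realType.

Lemma rV_norm_le n (x : 'rV[R]_n) (B : R) : 0 <= B ->
  (forall i, `|x 0 i| <= B) -> `|x| <= B.
Proof.
move=> B0 h; rewrite [leLHS]mx_normrE; apply/bigmax_leP; split=> // -[i j] _ /=.
by rewrite (ord1 i).
Qed.

Lemma rV_coord_le n (x : 'rV[R]_n) i : `|x 0 i| <= `|x|.
Proof. by rewrite [leRHS]mx_normrE; exact: (le_bigmax _ (fun ij => `|x ij.1 ij.2|) (0, i)). Qed.

Lemma norm_row_mx_l n (t : R) (v : 'rV[R]_n) : `|t| <= `|row_mx (t%:M : 'rV_1) v|.
Proof.
have := rV_coord_le (row_mx (t%:M : 'rV_1) v) (lshift n 0).
by rewrite row_mxEl mxE eqxx mulr1n.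
Qed.

Lemma norm_row_mx_r n (t : R) (v : 'rV[R]_n) : `|v| <= `|row_mx (t%:M : 'rV_1) v|.
Proof.
apply: rV_norm_le => // i.
by have := rV_coord_le (row_mx (t%:M : 'rV_1) v) (rshift 1 i); rewrite row_mxEr.
Qed.

Lemma norm_row_mx n (t : R) (v : 'rV[R]_n) (B : R) : `|t| <= B -> `|v| <= B ->
  `|row_mx (t%:M : 'rV_1) v| <= B.
Proof.
move=> tB vB; apply: rV_norm_le; first exact: le_trans tB.
move=> i; rewrite -(splitK i); case: (fintype.split i) => j /=.
  by rewrite row_mxEl mxE ord1 eqxx mulr1n.
by rewrite row_mxEr (le_trans (rV_coord_le _ _)).
Qed.

Lemma row_mx_split n (x : 'rV[R]_(1 + n)) :
  x = row_mx ((x 0 (lshift n 0))%:M : 'rV_1) (rsubmx x).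
Proof.
rewrite -{1}(hsubmxK x); congr row_mx; apply/rowP => i.
by rewrite !mxE ord1 eqxx mulr1n.
Qed.

Lemma row_mxB n (t t' : R) (v v' : 'rV[R]_n) :
  row_mx (t%:M : 'rV_1) v - row_mx (t'%:M : 'rV_1) v' = row_mx ((t - t')%:M : 'rV_1) (v - v').
Proof. by rewrite opp_row_mx add_row_mx -raddfN -raddfD. Qed.

Lemma row_mx_continuous n :
  continuous (fun s : R * 'rV[R]_n => row_mx (s.1%:M : 'rV_1) s.2).
Proof.
move=> [t v]; apply/cvgrPdist_le => e e0.
have : \forall s \near ((t, v) : R * 'rV[R]_n), `|(t, v) - s| <= e.
  by have /cvgrPdist_le := @cvg_id _ (nbhs ((t, v) : R * 'rV[R]_n)); apply.
apply: filterS => -[t' v']; rewrite prod_normE /= ge_max => /andP[h1 h2].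
by rewrite row_mxB; exact: norm_row_mx.
Qed.

Lemma box_compact n (r : R) : compact [set x : 'rV[R]_n | `|x| <= r].
Proof.
have -> : [set x : 'rV[R]_n | `|x| <= r] = closed_ball_ (fun x => `|x|) 0 r.
  by apply/seteqP; split=> x /=; rewrite /closed_ball_ /= sub0r normrN.
apply: bounded_closed_compact; last exact: closed_closed_ball_.
exists r; split; first exact: num_real.
move=> x rx y; rewrite /closed_ball_ /= sub0r normrN => yr.
exact: le_trans yr (ltW rx).
Qed.

End RowNorm.

Section OneDim.
Variable R : realType.
Notation mu := (@lebesgue_measure R).

Definition supported (V : normedModType R) (r : R) (f : V -> R) : Prop :=
  continuous f /\ forall v, r < `|v| -> f v = 0.

Lemma supported_Rintegral (r : R) (g : R -> R) : supported r g ->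
  \int[mu]_(t in setT) g t = \int[mu]_(t in `[- r, r]) g t.
Proof.
move=> [_ g0]; rewrite [RHS]Rintegral_mkcond; apply: eq_Rintegral => t _.
rewrite patchE; case: ifPn => // /negP; rewrite inE /= in_itv /= => nt.
by apply: g0; rewrite ltNge ler_norml; apply/negP.
Qed.

Lemma supported_integrable (r : R) (g : R -> R) : supported r g ->
  mu.-integrable setT (EFin \o g).
Proof.
move=> [cg g0].
have -> : EFin \o g = (EFin \o g) \_ `[- r, r].
  apply/funext => t; rewrite patchE; case: ifPn => // /negP; rewrite inE /= in_itv /= => nt.
  by rewrite /= g0 // ltNge ler_norml; apply/negP.
apply/(@integrable_mkcond _ _ _ mu `[- r, r] (EFin \o g)) => //.
apply: continuous_compact_integrable; first exact: segment_compact.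
by apply: continuous_subspaceT => x; exact: cg.
Qed.

Lemma supported_bound (r B : R) (g : R -> R) : 0 <= r -> supported r g ->
  (forall t, `|g t| <= B) -> `|\int[mu]_(t in setT) g t| <= 2 * r * B.
Proof.
move=> r0 sg gB; rewrite (supported_Rintegral sg).
have ig : mu.-integrable `[- r, r] (EFin \o g).
  by apply: integrableS (supported_integrable sg).
apply: le_trans (le_normr_Rintegral _ ig) _ => //.
apply: (@le_trans _ _ (\int[mu]_(t in `[- r, r]) B)).
  apply: le_Rintegral; [by []|exact: (@integrable_norm _ _ _ mu)| |by move=> x _; exact: gB].
  apply: continuous_compact_integrable; first exact: segment_compact.
  by apply: continuous_subspaceT => x; exact: cvg_cst.
have E := lebesgue_measure_itv `[- r, r]; rewrite Rintegral_cst // [X in fine X]E /= lte_fin; case: ifPn => h /=.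
  by rewrite mulrC; lra.
have -> : r = 0 by lra.
by rewrite !mulr0 mul0r.
Qed.

Lemma supported_opp (r : R) (g : R -> R) : 0 <= r -> supported r g ->
  \int[mu]_(t in setT) g (- t) = \int[mu]_(t in setT) g t.
Proof.
move=> r0 [cg g0]; have sg' : supported r (fun t => g (- t)).
  split; last by move=> v rv; apply: g0; rewrite normrN.
  by move=> t; apply: (@cts_comp _ _ _ -%R g); [exact: opp_continuous|exact: cg].
rewrite (supported_Rintegral sg') (@supported_Rintegral r g) //; congr fine.
have := @integration_by_substitution_oppr R g (- r) r; rewrite opprK => -> //.
- lra.
- by apply: continuous_subspaceT => x; exact: cg.
Qed.

Lemma supported_affine_pos (r a c : R) (g : R -> R) : 0 <= r -> supported r g -> 0 < a ->
  \int[mu]_(t in setT) g (a * t + c) = a^-1 * \int[mu]_(t in setT) g t.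
Proof.
move=> r0 sg a0; have [cg g0] := sg.
have cF : continuous (fun t : R => a * t + c).
  by move=> t; apply: cvgD; [apply: cvgM; [exact: cvg_cst|exact: cvg_id]|exact: cvg_cst].
have sg' : supported ((r + `|c|) / a) (fun t => g (a * t + c)).
  split; first by move=> t; exact: (@cts_comp _ _ _ (fun t : R => a * t + c) g _ (cF t) (cg _)).
  move=> v; rewrite ltr_pdivrMr // => h; apply: g0.
  have := ler_normB (a * v + c) c; rewrite addrK normrM (gtr0_norm a0) mulrC.
  lra.
have aV : a * a^-1 = 1 by rewrite divff // gt_eqF.
pose F t := a * t + c.
have dF t : is_derive t (1:R) F a.
  rewrite (_ : F = (a *: (id : R -> R)) + cst c); last by apply/funext.
  by apply: is_derive_eq; rewrite addr0 /GRing.scale /= mulr1.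
have F1 : derive1 F = cst a by apply/funext => t; rewrite derive1E derive_val.
(* Preimages of the ends of the support: the substitution takes place on a segment. *)
pose A := (- r - c) / a; pose B := (r - c) / a.
have FA : F A = - r by rewrite /F /A mulrCA aV mulr1 subrK.
have FB : F B = r by rewrite /F /B mulrCA aV mulr1 subrK.
have AB : A <= B by rewrite ler_pM2r ?invr_gt0 //; lra.
have -> : \int[mu]_(t in setT) g (F t) = \int[mu]_(t in `[A, B]) g (F t).
  rewrite [RHS]Rintegral_mkcond; apply: eq_Rintegral => t _.
  rewrite patchE; case: ifPn => // /negP; rewrite inE /= in_itv /= => nt.
  apply: g0; rewrite ltNge ler_norml; apply/negP => /andP[h1 h2]; apply: nt.
  by rewrite /A /B ler_pdivrMr // ler_pdivlMr // /F in h1 h2 *; apply/andP; split; lra.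
rewrite (supported_Rintegral sg).
have iF : mu.-integrable `[A, B] (EFin \o (fun t => g (F t))).
  by apply: integrableS (supported_integrable sg').
have := @integration_by_substitution_increasing R F g A B AB.
rewrite FA FB F1 => H; rewrite /Rintegral H //.
- transitivity (a^-1 * \int[mu]_(t in `[A, B]) (a * g (F t))).
    by rewrite RintegralZl // mulKf // gt_eqF.
  congr (_ * fine _); apply: eq_integral => t _ /=; congr EFin.
  by rewrite fctE mulrC.
- by move=> x y _ _ xy; rewrite /F ltrD2r ltr_pM2l.
- by move=> x _; exact: cvg_cst.
- exact: is_cvg_cst.
- exact: is_cvg_cst.
- split.
  + by move=> x _; exact: ex_derive.
  + exact/cvg_at_right_filter/cF.
  + exact/cvg_at_left_filter/cF.
- by apply: continuous_subspaceT => x; exact: cg.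
Qed.

Lemma supported_affine (r a c : R) (g : R -> R) : 0 <= r -> supported r g -> a != 0 ->
  \int[mu]_(t in setT) g (a * t + c) = `|a|^-1 * \int[mu]_(t in setT) g t.
Proof.
move=> r0 sg; rewrite neq_lt => /orP[a0|a0]; last first.
  by rewrite (supported_affine_pos _ r0 sg) // gtr0_norm.
have := @supported_affine_pos r (- a) c g r0 sg; rewrite oppr_gt0 ltr0_norm // => <- //.
have cF : continuous (fun t : R => a * t + c).
  by move=> t; apply: cvgD; [apply: cvgM; [exact: cvg_cst|exact: cvg_id]|exact: cvg_cst].
have [cg g0] := sg.
have sg' : supported ((r + `|c|) / `|a|) (fun t => g (a * t + c)).
  split; first by move=> t; exact: (@cts_comp _ _ _ (fun t : R => a * t + c) g _ (cF t) (cg _)).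
  move=> v; rewrite ltr_pdivrMr ?normr_gt0 ?lt_eqF // => h; apply: g0.
  have := ler_normB (a * v + c) c; rewrite addrK normrM mulrC.
  lra.
rewrite -(supported_opp _ sg'); last by rewrite divr_ge0 // addr_ge0.
by apply: eq_Rintegral => t _; rewrite mulrN mulNr.
Qed.

End OneDim.

Section RnIntegral.
Variables (R : realType) (r : R).
Hypothesis r0 : 0 <= r.

Lemma supported_comb (V : normedModType R) (a : R) (f g : V -> R) :
  supported r f -> supported r g -> supported r (fun v => a * f v + g v).
Proof.
move=> [cf f0] [cg g0]; split; last by move=> v rv; rewrite f0 // g0 // mulr0 addr0.
by move=> v; apply: cvgD; [apply: cvgM; [exact: cvg_cst|exact: cf]|exact: cg].
Qed.

Lemma supported_slice n (f : 'rV[R]_(1 + n) -> R) t : supported r f ->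
  supported r (fun v : 'rV[R]_n => f (row_mx (t%:M : 'rV_1) v)).
Proof.
move=> [cf f0]; split; last first.
  by move=> v rv; apply: f0; exact: lt_le_trans rv (norm_row_mx_r _ _).
move=> v; apply: (@cts_comp _ _ _ (fun v => row_mx (t%:M : 'rV_1) v) f); last exact: cf.
apply: (@cts_comp _ _ _ (fun v : 'rV[R]_n => (t, v)) (fun s => row_mx (s.1%:M : 'rV_1) s.2)).
  exact: (cts_pair (@cts_cst _ _ t v) (@cts_id _ v)).
exact: row_mx_continuous.
Qed.

(** Compactness of the closed ball makes the continuity in [t] at [t0] uniform in [v]; both
    [Phi t v'] and [Phi t0 v'] are compared with the value at a nearby centre [v]. *)
Lemma uniform_near n (T : topologicalType) (t0 : T) (Phi : T -> 'rV[R]_n -> R) (s : R) :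
  (forall v, `|v| <= s -> {for (t0, v), continuous (fun x : T * 'rV[R]_n => Phi x.1 x.2)}) ->
  forall e : R, 0 < e -> \forall t \near t0, forall v, `|v| <= s ->
    `|Phi t v - Phi t0 v| <= e.
Proof.
move=> cPhi e e0.
have /compact_near_coveringP := @box_compact R n s.
apply=> v vs.
have e2 : 0 < e / 2 by rewrite divr_gt0.
have /cvgrPdist_le /(_ _ e2) := cPhi v vs => /= H.
have [[U V] /= [Ut Vv] UV] := H.
exists (V, U) => //= -[v' t'] /= [Vv' Ut'].
have h1 := UV (t', v') (conj Ut' Vv'); have h2 := UV (t0, v') (conj (nbhs_singleton Ut) Vv').
move: h1 h2 => /= h1 h2.
have -> : Phi t' v' - Phi t0 v' = (Phi t0 v - Phi t0 v') - (Phi t0 v - Phi t' v') by ring.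
apply: le_trans (ler_normB _ _) _; rewrite [leRHS](splitr e); exact: lerD.
Qed.

Lemma uniform_near_supported n (T : topologicalType) (t0 : T) (Phi : T -> 'rV[R]_n -> R) :
  (forall v, `|v| <= r -> {for (t0, v), continuous (fun x : T * 'rV[R]_n => Phi x.1 x.2)}) ->
  (\forall t \near t0, forall v, r < `|v| -> Phi t v = 0) ->
  forall e : R, 0 < e -> \forall t \near t0, forall v, `|Phi t v - Phi t0 v| <= e.
Proof.
move=> cPhi sPhi e e0; have := uniform_near cPhi e0.
have s0 := nbhs_singleton sPhi; move: sPhi; apply: filterS2 => t st h v.
have [/h//|rv] := leP `|v| r.
by rewrite st // s0 // subrr normr0 ltW.
Qed.

(** The three properties are proved together: before the integral in dimension n + 1 can be handled
    as one on the line, its slice integrals have to be continuous in [t], which is the third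
    property in dimension n, and to vanish for large [t], which follows from the first one. *)
Lemma Rn_integral_base n :
  (forall (a : R) (f g : 'rV[R]_n -> R), supported r f -> supported r g ->
    Rn_integral (fun v => a * f v + g v) = a * Rn_integral f + Rn_integral g) /\
  (forall (B : R) (f : 'rV[R]_n -> R), supported r f -> (forall v, `|f v| <= B) ->
    `|Rn_integral f| <= (2 * r) ^+ n * B) /\
  (forall (T : topologicalType) (t0 : T) (Phi : T -> 'rV[R]_n -> R),
    (forall v, `|v| <= r -> {for (t0, v), continuous (fun x : T * 'rV[R]_n => Phi x.1 x.2)}) ->
    (\forall t \near t0, supported r (Phi t)) ->
    (fun t => Rn_integral (Phi t)) @ t0 --> Rn_integral (Phi t0)).
Proof.
elim: n => [|n [IHl [IHb IHc]]].
  split=> [//|]; split=> [B f _ fB|T t0 Phi cPhi sPhi] /=.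
    by rewrite expr0 mul1r.
  have c0 := cPhi 0; rewrite normr0 in c0.
  have cp : {for t0, continuous (fun t : T => (t, 0 : 'rV[R]_0))}.
    by apply: cts_pair; [exact: cts_id|exact: cts_cst].
  have H : {for t0, continuous (fun t => Phi t 0)}.
    by apply: (@cts_comp _ _ _ _ (fun x : T * 'rV[R]_0 => Phi x.1 x.2) _ cp); exact: c0.
  exact: H.
have sl (f : 'rV[R]_n.+1 -> R) : supported r f ->
    supported r (fun t : R => Rn_integral (fun v : 'rV[R]_n => f (row_mx (t%:M : 'rV_1) v))).
  move=> [cf f0]; split; last first.
    move=> t rt; rewrite (_ : (fun v => _) = fun _ => 0).
      have z : supported r (fun _ : 'rV[R]_n => 0 : R) by split=> // v; exact: cts_cst.
      by have := IHl (-1) _ _ z z; rewrite mulr0 addr0 => ->; rewrite mulN1r addNr.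
    by apply/funext => v; apply: f0; exact: lt_le_trans rt (norm_row_mx_l _ _).
  move=> t; apply: (IHc _ t (fun t v => f (row_mx (t%:M : 'rV_1) v))).
    move=> v _; apply: (@cts_comp _ _ _ (fun s : R * 'rV[R]_n => row_mx (s.1%:M : 'rV_1) s.2) f).
      exact: row_mx_continuous.
    exact: cf.
  by near=> t'; exact: supported_slice.
have L (a : R) (f g : 'rV[R]_n.+1 -> R) : supported r f -> supported r g ->
    Rn_integral (fun v => a * f v + g v) = a * Rn_integral f + Rn_integral g.
  move=> sf sg /=.
  rewrite -RintegralZl //; last exact: supported_integrable (sl _ sf).
  rewrite -RintegralD //.
  - by apply: eq_Rintegral => t _; rewrite IHl //; exact: supported_slice.
  - have z : supported r (fun _ : R => 0 : R) by split=> // v; exact: cts_cst.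
    have := supported_integrable (supported_comb a (sl _ sf) z).
    by under eq_fun do rewrite addr0.
  - exact: supported_integrable (sl _ sg).
have Bd (B : R) (f : 'rV[R]_n.+1 -> R) : supported r f -> (forall v, `|f v| <= B) ->
    `|Rn_integral f| <= (2 * r) ^+ n.+1 * B.
  move=> sf fB /=; rewrite exprS -mulrA; apply: supported_bound (sl _ sf) _ => // t.
  by apply: IHb => //; exact: supported_slice.
split => //; split => // T t0 Phi cPhi sPhi.
apply/cvgrPdist_le => e e0.
(* The volume of the box, increased by 1 so as to be positive even when [r = 0]. *)
pose c := (2 * r) ^+ n.+1 + 1.
have c0 : 0 < c by rewrite ltr_wpDl // exprn_ge0 // mulr_ge0.
have ec : 0 < e / c by rewrite divr_gt0.
have sPhi' : \forall t \near t0, forall v, r < `|v| -> Phi t v = 0.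
  by move: sPhi; apply: filterS => t [].
have := uniform_near_supported cPhi sPhi' ec.
have s0 := nbhs_singleton sPhi; move: sPhi; apply: filterS2 => t st h.
have := L (-1) _ _ st s0; rewrite mulN1r addrC => <-.
apply: (@le_trans _ _ ((2 * r) ^+ n.+1 * (e / c))).
  apply: Bd; first exact: supported_comb.
  by move=> v; rewrite mulN1r addrC distrC.
rewrite mulrCA ger_pMr // ler_pdivrMr // mul1r /c; lra.
Unshelve. all: by end_near. Qed.

Lemma supported_slice_integral n (f : 'rV[R]_n.+1 -> R) : supported r f ->
  supported r (fun t : R => Rn_integral (fun v : 'rV[R]_n => f (row_mx (t%:M : 'rV_1) v))).
Proof.
have [IHl [_ IHc]] := Rn_integral_base n.
move=> [cf f0]; split; last first.
  move=> t rt; rewrite (_ : (fun v => _) = fun _ => 0).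
    have z : supported r (fun _ : 'rV[R]_n => 0 : R) by split=> // v; exact: cts_cst.
    by have := IHl (-1) _ _ z z; rewrite mulr0 addr0 => ->; rewrite mulN1r addNr.
  by apply/funext => v; apply: f0; exact: lt_le_trans rt (norm_row_mx_l _ _).
move=> t; apply: (IHc _ t (fun t v => f (row_mx (t%:M : 'rV_1) v))).
  move=> v _; apply: (@cts_comp _ _ _ (fun s : R * 'rV[R]_n => row_mx (s.1%:M : 'rV_1) s.2) f).
    exact: row_mx_continuous.
  exact: cf.
by near=> t'; exact: supported_slice.
Unshelve. all: by end_near. Qed.

Section Corollaries.
Variable n : nat.
Implicit Types f g : 'rV[R]_n -> R.

Lemma Rn_integral_comb (a : R) f g : supported r f -> supported r g ->
  Rn_integral (fun v => a * f v + g v) = a * Rn_integral f + Rn_integral g.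
Proof. by case: (Rn_integral_base n) => + _; exact. Qed.

Lemma Rn_integral_bound (B : R) f : supported r f -> (forall v, `|f v| <= B) ->
  `|Rn_integral f| <= (2 * r) ^+ n * B.
Proof. by case: (Rn_integral_base n) => _ [+ _]; exact. Qed.

Lemma Rn_integral_cvg (T : topologicalType) (t0 : T) (Phi : T -> 'rV[R]_n -> R) :
  (forall v, `|v| <= r -> {for (t0, v), continuous (fun x : T * 'rV[R]_n => Phi x.1 x.2)}) ->
  (\forall t \near t0, supported r (Phi t)) ->
  (fun t => Rn_integral (Phi t)) @ t0 --> Rn_integral (Phi t0).
Proof. by case: (Rn_integral_base n) => _ [_ +]; exact. Qed.

Lemma supported0 : supported r (fun _ : 'rV[R]_n => 0 : R).
Proof. by split=> // v; exact: cts_cst. Qed.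

Lemma Rn_integral0 : Rn_integral (fun _ : 'rV[R]_n => 0 : R) = 0.
Proof.
have := Rn_integral_comb (-1) supported0 supported0.
by rewrite mulr0 addr0 => ->; rewrite mulN1r addNr.
Qed.

Lemma supportedZ (a : R) f : supported r f -> supported r (fun v => a * f v).
Proof.
move=> sf; have := supported_comb a sf supported0.
by under eq_fun do rewrite addr0.
Qed.

Lemma Rn_integralZ (a : R) f : supported r f ->
  Rn_integral (fun v => a * f v) = a * Rn_integral f.
Proof.
move=> sf; have := Rn_integral_comb a sf supported0.
by under eq_fun do rewrite addr0; rewrite Rn_integral0 addr0.
Qed.

Lemma supportedD f g : supported r f -> supported r g -> supported r (fun v => f v + g v).
Proof.
move=> sf sg; have := supported_comb 1 sf sg.
by under eq_fun do rewrite mul1r.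
Qed.

End Corollaries.

End RnIntegral.

Section AffineChange.
Variable R : realType.

Lemma supported_affine_rV n (r a : R) (c : 'rV[R]_n) (f : 'rV[R]_n -> R) : a != 0 ->
  supported r f -> supported ((r + `|c|) / `|a|) (fun z => f (a *: z + c)).
Proof.
move=> a0 [cf f0]; split.
  move=> z; apply: (@cts_comp _ _ _ (fun z : 'rV[R]_n => a *: z + c) f); last exact: cf.
  have cz : {for z, continuous ( *:%R a : 'rV[R]_n -> 'rV[R]_n)}.
    exact: differentiable_continuous.
  exact: cvgD cz (@cts_cst _ _ c z).
move=> v; rewrite ltr_pdivrMr ?normr_gt0 // => h; apply: f0.
have := ler_normB (a *: v + c) c; rewrite addrK normrZ mulrC.
lra.
Qed.

(** Induction on the dimension: the tail is treated by the induction hypothesis and the first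
    coordinate by substitution on the line, each coordinate contributing a factor [|a|^-1]. *)
Lemma Rn_integral_affine n (r a : R) (c : 'rV[R]_n) (f : 'rV[R]_n -> R) : 0 <= r ->
  a != 0 -> supported r f ->
  Rn_integral (fun z => f (a *: z + c)) = `|a| ^- n * Rn_integral f.
Proof.
move=> r0 a0; elim: n c f => [|n IH] c f sf.
  by rewrite /= expr0 invr1 mul1r; congr f; apply/rowP => -[].
rewrite /= exprS invfM -mulrA.
pose c' : 'rV_(1 + n) := c; pose c0 := c' 0 (lshift n 0); pose c1 := rsubmx c'.
pose J t := Rn_integral (fun v : 'rV[R]_n => f (row_mx (t%:M : 'rV_1) v)).
have sJ : supported r J by exact: supported_slice_integral.
have [cJ J0] := sJ.
have sl t : supported r (fun v : 'rV[R]_n => f (row_mx (t%:M : 'rV_1) v)) by exact: supported_slice.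
have E t : Rn_integral (fun v : 'rV[R]_n => f (a *: row_mx (t%:M : 'rV_1) v + c)) =
    `|a| ^- n * J (a * t + c0).
  rewrite /J -(IH c1 _ (sl _)); congr Rn_integral; apply/funext => v; congr f.
  by rewrite -/c' [in LHS](row_mx_split c') scale_row_mx add_row_mx scale_scalar_mx -raddfD.
under eq_Rintegral do rewrite E.
rewrite RintegralZl //; first by rewrite (supported_affine _ r0 sJ) // mulrCA.
apply: (@supported_integrable _ ((r + `|c0|) / `|a|)); split.
  move=> t; apply: (@cts_comp _ _ _ (fun t : R => a * t + c0) J); last exact: cJ.
  by apply: cvgD; [apply: cvgM; [exact: cvg_cst|exact: cvg_id]|exact: cvg_cst].
move=> v; rewrite ltr_pdivrMr ?normr_gt0 // => h; apply: J0.
have := ler_normB (a * v + c0) c0; rewrite addrK normrM mulrC.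
lra.
Qed.

(* Lower bound by induction on the dimension: the slice through the origin keeps the
   hypothesis, and a continuous function which is positive at [0] is bounded below
   near [0]. *)
Lemma Rn_integral_gt0 n (r : R) (f : 'rV[R]_n -> R) : 0 < r -> supported r f ->
  (forall v, 0 <= f v) -> 0 <= Rn_integral f /\ (0 < f 0 -> 0 < Rn_integral f).
Proof.
move=> r0; elim: n f => [|n IH] f sf f0; first by split; [exact: f0|].
pose J t := Rn_integral (fun v : 'rV[R]_n => f (row_mx (t%:M : 'rV_1) v)).
have sJ : supported r J by exact: (supported_slice_integral (ltW r0)).
have sl t : supported r (fun v : 'rV[R]_n => f (row_mx (t%:M : 'rV_1) v)).
  exact: supported_slice.
have J0 t : 0 <= J t by have [] := IH _ (sl t) (fun v => f0 _).
split; first by apply: Rintegral_ge0 => t _; exact: J0.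
move=> f00; have Jp : 0 < J 0.
  have [_] := IH _ (sl 0) (fun v => f0 _); apply.
  by rewrite raddf0 row_mx0.
have [cJ _] := sJ.
have : \forall t \near (0 : R), J 0 / 2 < J t.
  by apply: (cvgr_gt _ (cJ 0)); lra.
move=> /nbhs_ballP [d /= d0 Hd].
apply: (@lt_le_trans _ _ (\int[lebesgue_measure]_(t in `[0, d / 2]) (J 0 / 2))).
  have E := lebesgue_measure_itv `[0, d / 2]; rewrite Rintegral_cst // [X in fine X]E /=.
  rewrite lte_fin divr_gt0 //= subr0 !mulr_gt0 // ?invr_gt0 //.
have iJ := supported_integrable sJ.
apply: (@le_trans _ _ (\int[lebesgue_measure]_(t in `[0, d / 2]) J t)).
  apply: le_Rintegral => //.
  - apply: continuous_compact_integrable; first exact: segment_compact.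
    by apply: continuous_subspaceT => x; exact: cvg_cst.
  - exact: integrableS iJ.
  - move=> t /=; rewrite in_itv /= => /andP[t1 t2]; apply/ltW/Hd.
    by rewrite /ball /= sub0r normrN ger0_norm //; lra.
rewrite Rintegral_mkcond; apply: le_Rintegral => //.
- rewrite (_ : EFin \o J \_ `[0, d / 2] = (EFin \o J) \_ `[0, d / 2]); last by rewrite restrict_EFin.
  apply/(@integrable_mkcond _ _ _ lebesgue_measure `[0, d / 2] (EFin \o J)) => //.
  exact: integrableS iJ.
- by move=> t _; rewrite -/(J t) patchE; case: ifPn => _; [exact: lexx|exact: J0].
Qed.

End AffineChange.

Lemma cts_sum (R : realType) (T : topologicalType) (J : finType) (f : J -> T -> R) (x : T) :
  (forall j, {for x, continuous (f j)}) -> {for x, continuous (fun y => \sum_j f j y)}.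
Proof.
move=> cf; elim: (index_enum J) => [|j s IH].
  by rewrite (_ : (fun y => _) = (fun _ => 0)); [exact: cts_cst|apply/funext => y; rewrite big_nil].
rewrite (_ : (fun y => _) = (fun y => f j y + \sum_(j <- s) f j y)).
  exact: cvgD (cf j) IH.
by apply/funext => y; rewrite big_cons.
Qed.

Lemma supported_sum (R : realType) (r : R) n (J : finType) (f : J -> 'rV[R]_n -> R) :
  0 <= r -> (forall j, supported r (f j)) -> supported r (fun y => \sum_j f j y).
Proof.
move=> r0 sf; elim: (index_enum J) => [|j s IH].
  by rewrite (_ : (fun y => _) = (fun _ => 0)); [exact: supported0|apply/funext => y; rewrite big_nil].
rewrite (_ : (fun y => _) = (fun y => f j y + \sum_(j <- s) f j y)).
  exact: supportedD.
by apply/funext => y; rewrite big_cons.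
Qed.

(** * Differentiation under the integral sign *)

Section DiffUnder.
Variables (R : realType) (Z : normedModType R) (J : finType) (b : J -> Z) (co : J -> Z -> R).
Hypothesis coE : forall z, z = \sum_j co j z *: b j.
Hypothesis co_cts : forall j, continuous (co j).
Hypothesis co_le : forall j z, `|co j z| <= `|z|.
Variables (n : nat) (r : R).
Hypothesis r0 : 0 <= r.

(** Total differentiability, the candidate [ell h] being the integral of D_h Phi. The remainder of
    [Phi w] is estimated by the mean value theorem on the segment from [z] to [h + z] and by the
    closeness of the partial derivatives, which is uniform in [w] since they are continuous and
    vanish outside the ball. *)
Lemma differentiable_Rn_integral (Phi : 'rV[R]_n -> Z -> R) (z : Z) :
  (\forall z' \near z, supported r (Phi ^~ z')) ->
  (\forall z' \near z, forall w, differentiable (Phi w) z') ->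
  (forall v, supported r (fun w => 'D_v (Phi w) z)) ->
  (\forall z' \near z, forall j w, r < `|w| -> 'D_(b j) (Phi w) z' = 0) ->
  (forall j w, `|w| <= r ->
    {for (z, w), continuous (fun s : Z * 'rV[R]_n => 'D_(b j) (Phi s.2) s.1)}) ->
  differentiable (fun z => Rn_integral (Phi ^~ z)) z /\
  forall v, 'D_v (fun z => Rn_integral (Phi ^~ z)) z = Rn_integral (fun w => 'D_v (Phi w) z).
Proof.
move=> H1 H2 H3 H4 H5.
have d0 := nbhs_singleton H2.
pose ell h := Rn_integral (fun w => 'D_h (Phi w) z).
have lin : linear ell.
  move=> a h h'; rewrite /ell -(@Rn_integral_comb _ r) //; congr Rn_integral.
  by apply/funext => w; rewrite !deriveE // linearP.
have ellE h : ell h = \sum_j co j h * ell (b j).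
  pose g : {linear Z -> R^o} := HB.pack (ell : Z -> R^o) (GRing.isLinear.Build _ _ _ _ (ell : Z -> R^o) lin).
  have : g h = \sum_j co j h * g (b j).
    by rewrite {1}(coE h) linear_sum; apply: eq_bigr => j _; rewrite linearZ.
  by [].
have cell : continuous ell.
  rewrite (_ : ell = fun h => \sum_j co j h * ell (b j)); last exact/funext.
  move=> h; apply: cts_sum => j; apply: cvgM; [exact: co_cts|exact: cvg_cst].
suff [d E] : differentiable (fun z => Rn_integral (Phi ^~ z)) z /\
    'd (fun z => Rn_integral (Phi ^~ z)) z = ell :> (Z -> R).
  by split => // v; rewrite deriveE // E.
apply: differentiable_eps => // e e0.
pose c := (2 * r) ^+ n + 1.
have c0 : 0 < c by rewrite ltr_wpDl // exprn_ge0 // mulr_ge0.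
(* [c] absorbs the volume of the box and #|J| + 1 the number of coordinates of [h], so that the
   total error is at most [e] times the norm of [h]. *)
pose e1 := e / c / (#|J|%:R + 1).
have e10 : 0 < e1 by rewrite !divr_gt0 // ltr_wpDl.
have U : \forall z' \near z, forall j w, `|'D_(b j) (Phi w) z' - 'D_(b j) (Phi w) z| <= e1.
  pose P j z' := forall w, `|'D_(b j) (Phi w) z' - 'D_(b j) (Phi w) z| <= e1.
  have UP j : \forall z' \near z, P j z'.
    apply: (@uniform_near_supported R r n Z z (fun z' w => 'D_(b j) (Phi w) z')) => //.
      exact: H5.
    by move: H4; apply: filterS => z' h w; exact: h.
  exact: (@filter_forall _ J P _ _ UP).
have [d /= d_gt0 Hd] := iffLR (nbhs_ballP z _) (filterI H1 (filterI H2 U)).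
have : \forall h \near (0 : Z), `|h| < d.
  by apply/nbhs_ballP; exists d => //= h; rewrite -ball_normE /= sub0r normrN.
apply: filterS => h hd.
have inb (s : R) : 0 <= s <= 1 -> ball z d (s *: h + z).
  move=> /andP[s0 s1]; rewrite -ball_normE /= opprD addrCA subrr addr0 normrN normrZ.
  by rewrite ger0_norm //; apply: le_lt_trans hd; rewrite ler_piMl.
have key w : `|Phi w (h + z) - Phi w z - 'D_h (Phi w) z| <= e / c * `|h|.
  pose inner (s : R) := s *: h + z.
  have dinner s : is_diff s inner (fun t => t *: h).
    rewrite /inner (_ : (fun s => _) = (fun s : R^o => s *: h) + cst z); last exact/funext.
    by apply: is_diff_eq; rewrite addr0.
  have D (s : R) : 0 <= s <= 1 -> differentiable (fun s => Phi w (inner s)) s /\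
      is_derive s (1 : R) (fun s => Phi w (inner s)) ('D_h (Phi w) (inner s)).
    move=> s01; have [_ [dP _]] := Hd _ (inb s s01).
    have di : differentiable inner s by apply: ex_diff.
    have dc : differentiable (fun s => Phi w (inner s)) s.
      exact: (@differentiable_comp _ _ _ _ inner (Phi w) s).
    split=> //; apply: DeriveDef; first exact: diff_derivable.
    rewrite deriveE // (@diff_comp _ _ _ _ inner (Phi w) s) //= deriveE //.
    by rewrite diff_val /= scale1r.
  have [s s01] : exists2 s, s \in `]0, 1[%R & Phi w (inner 1) - Phi w (inner 0) =
      'D_h (Phi w) (inner s) * (1 - 0).
    apply: (@MVT R (fun s => Phi w (inner s)) (fun s => 'D_h (Phi w) (inner s))) => //.
      by move=> s; rewrite in_itv /= => /andP[s0 s1]; have [] := D s => //; rewrite !ltW.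
    apply: continuous_in_subspaceT => s; rewrite inE /= in_itv /= => s01.
    by have [ds _] := D s s01; exact: differentiable_continuous.
  rewrite /inner scale1r scale0r add0r subr0 mulr1 => ->.
  move: s01; rewrite in_itv /= => /andP[s0 s1].
  have s01 : 0 <= s <= 1 by rewrite !ltW.
  have [_ [dP Us]] := Hd _ (inb s s01).
  have E z' : differentiable (Phi w) z' ->
      'D_h (Phi w) z' = \sum_j co j h * 'D_(b j) (Phi w) z'.
    move=> dz; rewrite deriveE // {1}(coE h) linear_sum; apply: eq_bigr => j _.
    by rewrite linearZ deriveE.
  rewrite !E // -sumrB; apply: le_trans (ler_norm_sum _ _ _) _.
  apply: (@le_trans _ _ (\sum_(j : J) `|h| * e1)).
    apply: ler_sum => j _; rewrite -mulrBr normrM ler_pM // ; exact: Us.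
  rewrite sumr_const -mulr_natr mulrC [X in _ * X]mulrC mulrA ler_wpM2r // /e1.
  rewrite mulrCA ger_pMr ?divr_gt0 // ler_pdivrMr ?ltr_wpDl // mul1r; lra.
have [sh _] : supported r (Phi ^~ (h + z)) /\ True.
  by split => //; have [+ _] := Hd _ (inb 1 ltac:(lra)); rewrite scale1r.
have s0 := nbhs_singleton H1.
have E : Rn_integral (Phi ^~ (h + z)) - Rn_integral (Phi ^~ z) - ell h =
    Rn_integral (fun w => Phi w (h + z) - Phi w z - 'D_h (Phi w) z).
  have E1 := Rn_integral_comb r0 (-1) s0 sh.
  have E2 := Rn_integral_comb r0 (-1) (H3 h) (supported_comb (-1) s0 sh).
  transitivity (Rn_integral (fun w => -1 * 'D_h (Phi w) z + (-1 * Phi w z + Phi w (h + z)))).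
    by rewrite E2 E1 /ell; ring.
  by congr Rn_integral; apply/funext => w; ring.
rewrite E; apply: (@le_trans _ _ ((2 * r) ^+ n * (e / c * `|h|))).
  apply: (Rn_integral_bound r0) => //.
  have := supported_comb (-1) (H3 h) (supported_comb (-1) s0 sh).
  by congr supported; apply/funext => w; ring.
rewrite mulrA ler_wpM2r // mulrCA ger_pMr // ler_pdivrMr // mul1r /c; lra.
Qed.

Section Family.
Variables (I : topologicalType) (e0 : I) (z0 : Z).

(** Compactness of the ball exchanges the quantifiers: one neighbourhood of [(e0, z0)] serves all
    [w] in the ball. *)
Lemma near_box (P : I * ('rV[R]_n * Z) -> Prop) :
  (forall w, `|w| <= r -> \forall t \near (e0, (w, z0)), P t) ->
  \forall s \near (e0, z0), forall w, `|w| <= r -> P (s.1, (w, s.2)).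
Proof.
move=> HP; have /compact_near_coveringP cov := @box_compact R n r.
apply: (cov _ (nbhs (e0, z0)) (fun s w => P (s.1, (w, s.2)))) => w wr; have := HP w wr.
pose m (t : 'rV[R]_n * (I * Z)) := (t.2.1, (t.1, t.2.2)).
have cm : {for (w, (e0, z0)), continuous m}.
  apply: cts_pair; first exact: cts_21.
  by apply: cts_pair; [exact: cts_fst|exact: cts_22].
by move=> H; exact: (cm _ H).
Qed.

Lemma near_drop (W : topologicalType) (w1 : W) (P : I * Z -> Prop) :
  (\forall s \near (e0, z0), P s) -> \forall t \near (e0, (w1, z0)), P (t.1, t.2.2).
Proof.
have cm : {for (e0, (w1, z0)), continuous (fun t : I * (W * Z) => (t.1, t.2.2))}.
  by apply: cts_pair; [exact: cts_fst|exact: cts_22].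
by move=> H; exact: (cm _ H).
Qed.

Lemma near_pair_slice (P : I * Z -> Prop) :
  (\forall s \near (e0, z0), P s) -> \forall s \near (e0, z0), \forall z \near s.2, P (s.1, z).
Proof.
move=> /nbhs_interior; apply: filterS => -[e z] /= h.
by have c : {for z, continuous (fun z => (e, z))}; [exact: (cts_pair (@cts_cst _ _ e z) (@cts_id _ z))|exact: (c _ h)].
Qed.

(** On the closed ball, continuity in [w] is part of [scv]; outside, the function vanishes on a
    whole neighbourhood of [w]. *)
Lemma near_supported (Phi : I -> 'rV[R]_n -> Z -> R) :
  (forall w, `|w| <= r -> scv 0 e0 w z0 Phi) ->
  (\forall s \near (e0, z0), forall w, r < `|w| -> Phi s.1 w s.2 = 0) ->
  \forall s \near (e0, z0), supported r (fun w => Phi s.1 w s.2).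
Proof.
move=> hPhi sPhi.
have := near_box (fun w wr => scv_near_cts (hPhi w wr)).
move: sPhi; apply: filterS2 => -[e z] /= z0' c0; split => // w.
have [wr|wr] := leP `|w| r.
  have cw : {for w, continuous (fun w : 'rV[R]_n => (w, z))}.
    exact: (cts_pair (@cts_id _ w) (@cts_cst _ _ z w)).
  exact: (@cts_comp _ _ _ (fun w => (w, z)) (fun s => Phi e s.1 s.2) w cw (c0 w wr)).
apply: (@cts_near _ _ (fun _ => 0)); last exact: cts_cst.
have H : \forall w' \near w, r < `|w'|.
  exact: (cvgr_gt _ (@norm_continuous _ _ w) _ wr).
by move: H; apply: filterS => w' /z0' ->.
Qed.

Lemma scv0_Rn_integral (W : topologicalType) (w1 : W) (Phi : I -> 'rV[R]_n -> Z -> R) :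
  (forall w, `|w| <= r -> scv 0 e0 w z0 Phi) ->
  (\forall s \near (e0, z0), forall w, r < `|w| -> Phi s.1 w s.2 = 0) ->
  scv 0 e0 w1 z0 (fun e _ z => Rn_integral (fun w => Phi e w z)).
Proof.
move=> hPhi sPhi; have supp := near_supported hPhi sPhi; split => //.
  have H : {for (e0, z0), continuous (fun s : I * Z => Rn_integral (fun w => Phi s.1 w s.2))}.
    apply: (@Rn_integral_cvg R r r0 n _ (e0, z0) (fun s w => Phi s.1 w s.2)); last exact: supp.
    move=> w wr; apply: (@cts_comp _ _ _ (fun x : I * Z * 'rV[R]_n => (x.1.1, (x.2, x.1.2)))
      (fun t => Phi t.1 t.2.1 t.2.2) ((e0, z0), w)); last exact: (scv_cts (hPhi w wr)).
    apply: cts_pair.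
      exact: (@cts_comp _ _ _ fst fst ((e0, z0), w) (@cts_fst _ _ _) (@cts_fst _ _ _)).
    apply: cts_pair; first exact: cts_snd.
    exact: (@cts_comp _ _ _ fst snd ((e0, z0), w) (@cts_fst _ _ _) (@cts_snd _ _ _)).
  apply: (@cts_comp _ _ _ (fun t : I * (W * Z) => (t.1, t.2.2)) _ (e0, (w1, z0)) _ H).
  by apply: cts_pair; [exact: cts_fst|exact: cts_22].
have N := near_box (fun w wr => scv_near_cts (hPhi w wr)).
have ND : \forall t \near (e0, (w1, z0)), (forall w, `|w| <= r ->
    {for (w, t.2.2), continuous (fun x : 'rV[R]_n * Z => Phi t.1 x.1 x.2)}) /\
    \forall z \near t.2.2, supported r (fun w => Phi t.1 w z)
   := near_drop w1 (near_and N (near_pair_slice supp)).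
move: ND; apply: filterS => -[e [w z]] /= [c1 s1].
have H : {for z, continuous (fun z => Rn_integral (fun w => Phi e w z))}.
  have c2 w' : `|w'| <= r -> {for (z, w'), continuous (fun s : Z * 'rV[R]_n => Phi e s.2 s.1)}.
    move=> wr; apply: (@cts_comp _ _ _ (fun s : Z * 'rV[R]_n => (s.2, s.1)) (fun s => Phi e s.1 s.2) (z, w')).
      by apply: cts_pair; [exact: cts_snd|exact: cts_fst].
    exact: c1.
  exact: (@Rn_integral_cvg R r r0 n _ z (fun z w => Phi e w z) c2 s1).
exact: (@cts_comp _ _ _ snd _ (w, z) (@cts_snd _ _ _) H).
Qed.

(** The integration variable takes the place of the parameter of [scv], where only continuity is
    asked, and compactness of the ball makes the hypotheses uniform in it. The integral itself
    depends on no parameter, so [w1] is arbitrary. *)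
Theorem scv_Rn_integral (W : topologicalType) (w1 : W) k (Phi : I -> 'rV[R]_n -> Z -> R) :
  (forall w, `|w| <= r -> scv k e0 w z0 Phi) ->
  (\forall s \near (e0, z0), forall w, r < `|w| -> Phi s.1 w s.2 = 0) ->
  scv k e0 w1 z0 (fun e _ z => Rn_integral (fun w => Phi e w z)).
Proof.
have scv0 k' (Psi : I -> 'rV[R]_n -> Z -> R) w : scv k' e0 w z0 Psi -> scv 0 e0 w z0 Psi.
  by move=> h; split => //; [exact: scv_cts h|exact: scv_near_cts h].
elim: k Phi => [|k IH] Phi hPhi sPhi; first exact: scv0_Rn_integral.
have supp := near_supported (fun w wr => scv0 _ _ _ (hPhi w wr)) sPhi.
have [h1 h2 _] := scv0_Rn_integral w1 (fun w wr => scv0 _ _ _ (hPhi w wr)) sPhi.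
have sD : \forall s \near (e0, z0), forall v w, r < `|w| ->
    'D_v (Phi s.1 w) s.2 = 0 /\ differentiable (Phi s.1 w) s.2.
  have := near_pair_slice sPhi; apply: filterS => -[e z] /= h v w wr.
  have hw : \forall z' \near z, Phi e w z' = cst 0 z' by move: h; apply: filterS => z' ->.
  split; first by rewrite (near_eq_derive _ hw) derive_cst.
  apply: (@differentiable_near _ _ _ (cst 0)); last exact: differentiable_cst.
  by move: hw; apply: filterS => z' ->.
have sDv v : \forall s \near (e0, z0), forall w, r < `|w| -> 'D_v (Phi s.1 w) s.2 = 0.
  by move: sD; apply: filterS => s h w /(h v) [].
have suppD v := near_supported (fun w wr => scv0 _ _ _ (scv_derive v (hPhi w wr))) (sDv v).
have D : \forall s \near (e0, z0),
   differentiable (fun z => Rn_integral (fun w => Phi s.1 w z)) s.2 /\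
    forall v, 'D_v (fun z => Rn_integral (fun w => Phi s.1 w z)) s.2 = Rn_integral (fun w => 'D_v (Phi s.1 w) s.2).
  have N1 := near_box (fun w wr => scv_diff (hPhi w wr)).
  have N2 j := near_box (fun w wr => scv_near_cts (scv_derive (b j) (hPhi w wr))).
  have N2' := near_forall N2.
  have N3 := near_forall (fun j => suppD (b j)).
  have NA := near_pair_slice (P := fun s => (forall w, `|w| <= r -> differentiable (Phi s.1 w) s.2) /\
    supported r (fun w => Phi s.1 w s.2) /\ forall v w, r < `|w| ->
    'D_v (Phi s.1 w) s.2 = 0 /\ differentiable (Phi s.1 w) s.2) (near_and N1 (near_and supp sD)).
  move: NA N2' N3; apply: filterS3 => -[e z] /= A B C.
  have dz : \forall z' \near z, forall w, differentiable (Phi e w) z'.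
    move: A; apply: filterS => z' [a1 [_ a3]] w.
    by have [wr|wr] := leP `|w| r; [exact: a1|have [] := a3 0 w wr].
  apply: differentiable_Rn_integral.
  - by move: A; apply: filterS => z' [_ []].
  - exact: dz.
  - move=> v; rewrite (_ : (fun w => _) = fun w => \sum_j co j v * 'D_(b j) (Phi e w) z).
      by apply: supported_sum => // j; apply: supportedZ => //; exact: C.
    apply/funext => w; have dw := nbhs_singleton dz w.
    rewrite deriveE // {1}(coE v) linear_sum; apply: eq_bigr => j _.
    by rewrite linearZ deriveE.
  - by move: A; apply: filterS => z' [_ [_ a3]] j w wr; have [] := a3 (b j) w wr.
  - move=> j w wr; apply: (@cts_comp _ _ _ (fun s : Z * 'rV[R]_n => (s.2, s.1)) (fun s => 'D_(b j) (Phi e s.1) s.2) (z, w)).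
      by apply: cts_pair; [exact: cts_snd|exact: cts_fst].
    exact: (B j w wr).
split => //; split.
  have ND : \forall t \near (e0, (w1, z0)),
    differentiable (fun z => Rn_integral (fun w => Phi t.1 w z)) t.2.2 /\ _ := near_drop w1 D.
  by move: ND; apply: filterS => t [].
move=> v; apply: scv_eq (IH (fun e w => 'D_v (Phi e w)) _ _) => //.
  have ND : \forall t \near (e0, (w1, z0)), _ /\
    forall v, 'D_v (fun z => Rn_integral (fun w => Phi t.1 w z)) t.2.2 =
      Rn_integral (fun w => 'D_v (Phi t.1 w) t.2.2) := near_drop w1 D.
  by move: ND; apply: filterS => t [_ ->].
by move=> w wr; exact: scv_derive (hPhi w wr).
Qed.

End Family.

End DiffUnder.

(** * Mollifiers *)

Section Flat.
Variable R : realType.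

(** The factor [t^-1 ^+ j] makes the family closed under differentiation; [flat 0] is the profile of
    the bump as a function of 1 minus the squared norm. *)
Definition flat (j : nat) (t : R) : R := if 0 < t then t^-1 ^+ j * expR (- t^-1) else 0.

(** With m = j + 1, exp(1/t) is the m-th power of exp(1/(m t)), which exceeds 1/(m t); this is the
    origin of the constant m^m. *)
Lemma flat_le (j : nat) (t : R) : 0 < t -> flat j t <= j.+1%:R ^+ j.+1 * t.
Proof.
move=> t0; rewrite /flat t0 expRN ler_pdivrMr ?expR_gt0 //.
have t1 : 0 < t^-1 by rewrite invr_gt0.
have -> : expR t^-1 = expR (t^-1 / j.+1%:R) ^+ j.+1.
  by rewrite -expRM_natl; congr expR; rewrite mulrCA divff ?mulr1 // pnatr_eq0.
have h : (t^-1 / j.+1%:R) ^+ j.+1 <= expR (t^-1 / j.+1%:R) ^+ j.+1.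
  rewrite lerXn2r // ?nnegrE ?expR_ge0 ?divr_ge0 // ?ltW //.
  by apply: lt_le_trans (expR_ge1Dx _); rewrite ltrDr.
apply: le_trans (ler_wpM2l _ h); last by rewrite mulr_ge0 ?exprn_ge0 // ltW.
rewrite expr_div_n mulrAC mulrCA divff ?mulr1; last by rewrite expf_neq0 // pnatr_eq0.
by rewrite exprSr -mulrA mulVf ?mulr1 // gt_eqF.
Qed.

Lemma flat_ge0 j t : 0 <= flat j t.
Proof.
by rewrite /flat; case: ifPn => // t0; rewrite mulr_ge0 ?expR_ge0 // exprn_ge0 // invr_ge0 ltW.
Qed.

Lemma differentiable_flat j (t : R) : differentiable (flat j) t /\
  forall v, 'D_v (flat j) t = v * (flat j.+2 t - j%:R * flat j.+1 t).
Proof.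
suff [d E] : differentiable (flat j) t /\
    'd (flat j) t = (fun v => v * (flat j.+2 t - j%:R * flat j.+1 t)) :> (R -> R).
  by split => // v; rewrite deriveE // E.
have [t0|t0|->] := ltrgtP t 0.
- have nE : \forall s \near t, cst 0 s = flat j s.
    by have := lt_nbhsl t0; apply: filterS => s s0; rewrite /flat ltNge ltW.
  have d : differentiable (flat j) t by apply: differentiable_near nE _; exact: differentiable_cst.
  split => //; apply/funext => v; rewrite -deriveE // -(near_eq_derive _ nE) derive_cst.
  by rewrite /flat ltNge (ltW t0) /= mulr0 subrr mulr0.
- have tn : t != 0 by rewrite gt_eqF.
  have nE : \forall s \near t, s^-1 ^+ j * expR (- s^-1) = flat j s.
    by have := lt_nbhsr t0; apply: filterS => s s0; rewrite /flat s0.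
  have dV : is_derive t (1 : R) (fun s : R => s^-1) (- t^-1 ^+ 2).
    apply: DeriveDef; first by apply: derivableV => //; exact: derivable_id.
    by rewrite deriveV //= derive_id /GRing.scale /= mulr1 exprVn.
  have dX : is_derive t (1 : R) (fun s : R => s^-1 ^+ j) (- (j%:R * t^-1 ^+ j.+1)).
    have d := @is_deriveX _ _ _ j t 1 _ dV; rewrite exprfctE in d.
    suff E : (j%:R * t^-1 ^+ j.-1) * (- t^-1 ^+ 2) = - (j%:R * t^-1 ^+ j.+1) by rewrite -E; exact: d.
    case: (j) => [|i]; first by rewrite !mul0r oppr0.
    by rewrite mulrN -!mulrA -exprD addn2.
  have dE : is_derive t (1 : R) (fun s : R => expR (- s^-1)) (t^-1 ^+ 2 * expR (- t^-1)).
    have dN : is_derive t (1 : R) (fun s : R => - s^-1) (t^-1 ^+ 2).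
      by have := @is_deriveN _ _ _ (fun s : R => s^-1) t 1 _ dV; rewrite opprK.
    by have := @is_derive1_comp R (@expR R) (fun s => - s^-1) t _ _ (is_derive_expR _) dN; rewrite mulrC.
  have dM := is_deriveM dX dE.
  have dF : is_derive t (1 : R) (flat j) (flat j.+2 t - j%:R * flat j.+1 t).
    apply: (near_eq_is_derive nE); apply: is_derive_eq.
    by rewrite /flat t0 /GRing.scale /= !exprS; ring.
  have d : differentiable (flat j) t by apply/derivable1_diffP.
  split => //; apply/funext => v; rewrite diff1E // /GRing.scale /=; congr (_ * _).
  by rewrite derive1E derive_val.
- rewrite [X in (_ = X)](_ : _ = (fun v : R => 0)); last first.
    by apply/funext => v; rewrite /flat ltxx mulr0 subrr mulr0.
  apply: differentiable_eps => [a x y|x|e e0]; first by rewrite scaler0 addr0.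
    exact: cst_continuous.
  (* For [h > 0], [flat j h] equals [h] times [flat j.+1 h], and the latter is at most [c * h] by
     [flat_le] at index j + 1. *)
  pose c : R := j.+2%:R ^+ j.+2.
  have c0 : 0 < c by rewrite exprn_gt0.
  have : \forall h \near (0 : R), `|h| < e / c.
    apply/nbhs_ballP; exists (e / c) => /=; first by rewrite divr_gt0.
    by move=> h; rewrite /ball /= sub0r normrN.
  apply: filterS => h hc; rewrite addr0 subr0 {2}/flat ltxx subr0.
  rewrite ger0_norm ?flat_ge0 //.
  have [h0|h0] := ltP 0 h; last by rewrite /flat ltNge h0 /= mulr_ge0 // ltW.
  have -> : flat j h = h * flat j.+1 h.
    by rewrite /flat h0 exprS -!mulrA mulrCA mulrA mulVf ?mul1r // gt_eqF.
  rewrite mulrC ler_pM ?flat_ge0 ?ler_norm // ?ltW //.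
  apply: le_lt_trans (flat_le _ h0) _; rewrite -/c mulrC -ltr_pdivlMr //.
  exact: le_lt_trans (ler_norm _) hc.
Qed.

Lemma scv_flat (I W : topologicalType) (k j : nat) (e0 : I) (w0 : W) (t0 : R) :
  scv k e0 w0 (t0 : R^o) (fun _ _ => flat j : R^o -> R).
Proof.
have cf i (t : R) : {for t, continuous (flat i)}.
  by have [d _] := differentiable_flat i t; exact: differentiable_continuous.
elim: k j => [|k IH] j.
all: have h1 : {for (e0, (w0, t0)), continuous (fun t : I * (W * R^o) => flat j t.2.2)}
  by apply: (@cts_comp _ _ _ (fun t : I * (W * R^o) => t.2.2) (flat j) (e0, (w0, t0))); [exact: cts_22|exact: cf].
all: have h2 : \forall t \near (e0, (w0, t0 : R^o)), {for t.2, continuous (fun s : W * R^o => flat j s.2)}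
  by near=> t; apply: (@cts_comp _ _ _ snd (flat j) t.2); [exact: cts_snd|exact: cf].
  by split.
split => //; split; first by near=> t; have [d _] := differentiable_flat j t.2.2.
move=> v; apply: (scv_eq (f := fun _ _ t => v * (flat j.+2 t - j%:R * flat j.+1 t))).
  by near=> t; have [_ ->] := differentiable_flat j t.2.2.
apply: scvM; first exact: (@scv_cst _ _ _ _ R^o).
by apply: scvB => //; apply: scvM => //; exact: (@scv_cst _ _ _ _ R^o).
Unshelve. all: by end_near. Qed.

End Flat.

Section PairBasis.
Variables (R : realType) (n : nat).
Notation V := 'rV[R]_n.

Definition pair_basis (j : 'I_n + 'I_n) : V * V :=
  match j with inl i => (delta_mx 0 i, 0) | inr i => (0, delta_mx 0 i) end.

Definition pair_coord (j : 'I_n + 'I_n) (p : V * V) : R :=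
  match j with inl i => p.1 0 i | inr i => p.2 0 i end.

Lemma pair_sumE (c : 'I_n + 'I_n -> R) : \sum_j c j *: pair_basis j =
  (\row_i c (inl i), \row_i c (inr i)).
Proof.
have fs (I : Type) (s : seq I) (F : I -> V * V) : (\sum_(i <- s) F i).1 = \sum_(i <- s) (F i).1.
  by elim: s => [|i s IH]; rewrite ?big_nil // !big_cons /= IH.
have sn (I : Type) (s : seq I) (F : I -> V * V) : (\sum_(i <- s) F i).2 = \sum_(i <- s) (F i).2.
  by elim: s => [|i s IH]; rewrite ?big_nil // !big_cons /= IH.
rewrite big_sumType /=; apply/pair_eqP; rewrite /= !(fs, sn) /=.
rewrite [X in _ + X]big1 => [|i _]; last by rewrite scaler0.
rewrite [X in (_ == _) && (X + _ == _)]big1 => [|i _]; last by rewrite scaler0.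
rewrite addr0 add0r; apply/andP; split; apply/eqP/rowP => i; rewrite mxE summxE (bigD1 i) //=.
  by rewrite !mxE !eqxx mulr1 big1 ?addr0 // => k ki; rewrite !mxE eq_sym (negbTE ki) andbF mulr0.
by rewrite !mxE !eqxx mulr1 big1 ?addr0 // => k ki; rewrite !mxE eq_sym (negbTE ki) andbF mulr0.
Qed.

Lemma pair_coordE (p : V * V) : p = \sum_j pair_coord j p *: pair_basis j.
Proof.
rewrite pair_sumE; case: p => x y; congr pair; apply/rowP => i; by rewrite mxE.
Qed.

Lemma pair_coord_continuous j : continuous (pair_coord j).
Proof.
case: j => i p.
  exact: (@cts_comp _ _ _ fst (fun x : V => x 0 i) p (@cts_fst _ _ p) (@coord_continuous _ _ _ _ _ _)).
exact: (@cts_comp _ _ _ snd (fun x : V => x 0 i) p (@cts_snd _ _ p) (@coord_continuous _ _ _ _ _ _)).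
Qed.

Lemma pair_coord_le j p : `|pair_coord j p| <= `|p|.
Proof.
rewrite prod_normE le_max; case: j => i /=; by rewrite rV_coord_le ?orbT.
Qed.

Lemma scv_pair_coord (I W : topologicalType) k (e0 : I) (w0 : W) (p0 : V * V) j :
  scv k e0 w0 p0 (fun _ _ p => pair_coord j p).
Proof.
have lin : linear (pair_coord j : V * V -> R^o) by case: j => i a x y; rewrite /= !mxE.
pose l : {linear (V * V)%type -> R^o} := HB.pack (pair_coord j : V * V -> R^o)
  (GRing.isLinear.Build R (V * V)%type R^o _ (pair_coord j : V * V -> R^o) lin).
have H : scv k e0 w0 p0 (fun (_ : I) (_ : W) z => l z).
  by apply: scv_lin => z; exact: pair_coord_continuous.
exact: H.
Qed.

Lemma scv_fst_coord (I W : topologicalType) k (e0 : I) (w0 : W) (p0 : V * V) i :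
  scv k e0 w0 p0 (fun _ _ p => p.1 0 i).
Proof. exact: scv_pair_coord (inl i). Qed.

Lemma scv_snd_coord (I W : topologicalType) k (e0 : I) (w0 : W) (p0 : V * V) i :
  scv k e0 w0 p0 (fun _ _ p => p.2 0 i).
Proof. exact: scv_pair_coord (inr i). Qed.

Lemma scv_comp_pair (I W : topologicalType) (Z : normedModType R) k (e0 : I) (w0 : W)
    (z0 : Z) (c d : I -> W -> Z -> V) (h : I -> W -> V * V -> R) :
  (forall i, scv k e0 w0 z0 (fun e w z => c e w z 0 i)) ->
  (forall i, scv k e0 w0 z0 (fun e w z => d e w z 0 i)) ->
  scv k e0 w0 (c e0 w0 z0, d e0 w0 z0) h ->
  scv k e0 w0 z0 (fun e w z => h e w (c e w z, d e w z)).
Proof.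
move=> hc hd hh.
pose cc j e w z := pair_coord j (c e w z, d e w z).
have ccE e w z : \sum_j cc j e w z *: pair_basis j = (c e w z, d e w z) by rewrite -pair_coordE.
apply: (scv_eq (f := fun e w z => h e w (\sum_j cc j e w z *: pair_basis j))).
  by near=> t; rewrite ccE.
by apply: scv_comp; [case=> i; [exact: hc|exact: hd]|rewrite ccE].
Unshelve. all: by end_near. Qed.

Lemma scv_comp_row (I W : topologicalType) (Z : normedModType R) k (e0 : I) (w0 : W)
    (z0 : Z) (c : I -> W -> Z -> V) (h : I -> W -> V -> R) :
  (forall i, scv k e0 w0 z0 (fun e w z => c e w z 0 i)) ->
  scv k e0 w0 (c e0 w0 z0) h ->
  scv k e0 w0 z0 (fun e w z => h e w (c e w z)).
Proof.
move=> hc hh.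
apply: (scv_eq (f := fun e w z => h e w (\sum_j c e w z 0 j *: delta_mx 0 j))).
  by near=> t; rewrite -row_sum_delta.
by apply: (scv_comp (c := fun j e w z => c e w z 0 j)) => //; rewrite -row_sum_delta.
Unshelve. all: by end_near. Qed.

Lemma scv_comp1 (I W : topologicalType) (Z : normedModType R) k (e0 : I) (w0 : W)
    (z0 : Z) (c : I -> W -> Z -> R) (h : I -> W -> R^o -> R) :
  scv k e0 w0 z0 c -> scv k e0 w0 (c e0 w0 z0 : R^o) h ->
  scv k e0 w0 z0 (fun e w z => h e w (c e w z)).
Proof.
move=> hc hh; pose b (_ : 'I_1) : R^o := 1.
have E e w z : \sum_(j < 1) c e w z *: b j = c e w z by rewrite big_ord1 /GRing.scale /= mulr1.
apply: (scv_eq (f := fun e w z => h e w (\sum_(j < 1) c e w z *: b j))).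
  by near=> t; rewrite E.
by apply: (scv_comp (b := b) (c := fun _ => c)) => //; rewrite E.
Unshelve. all: by end_near. Qed.

End PairBasis.

Section Bump.
Variables (R : realType) (n : nat).
Notation V := 'rV[R]_n.

(** In terms of the squared norm no square root is left, which makes the smoothness at the origin
    accessible. *)
Lemma mollifier_bumpE (x : V) : mollifier_bump x = flat 0 (1 - \sum_i x 0 i ^+ 2).
Proof.
have S0 : 0 <= \sum_i x 0 i ^+ 2 by apply: sumr_ge0 => i _; exact: sqr_ge0.
rewrite /mollifier_bump /flat /enorm subr_gt0 -[X in _ < X]sqrtr1 ltr_sqrt // sqr_sqrtr //.
by case: ifP => // _; rewrite expr0 mul1r -invrN opprB.
Qed.

Lemma scv_mollifier_bump (I W : topologicalType) k (e0 : I) (w0 : W) (z0 : V) :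
  scv k e0 w0 z0 (fun _ _ => @mollifier_bump R n).
Proof.
apply: (scv_eq (f := fun _ _ (z : V) => flat 0 (1 - \sum_i z 0 i ^+ 2))).
  by near=> t; rewrite mollifier_bumpE.
apply: (scv_comp1 (h := fun _ _ => flat 0)); last exact: scv_flat.
apply: scvB; first exact: (@scv_cst _ _ _ _ R^o).
apply: scv_sum => i _; apply: scvX; apply: scv_coord.
have H : scv k e0 w0 z0 (fun (_ : I) (_ : W) z => (idfun : {linear V -> V}) z).
  by apply: scv_lin => z; exact: cvg_id.
exact: H.
Unshelve. all: by end_near. Qed.

Lemma scv_continuous (Z : normedModType R) (f : Z -> R) :
  (forall z0, scv 0 (0 : R) (0 : R) z0 (fun _ _ => f)) -> continuous f.
Proof.
move=> h z0; have c := scv_cts (h z0).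
exact: (@cts_comp _ _ _ (fun z : Z => (0 : R, (0 : R, z))) (fun t => f t.2.2) z0
  (cts_pair (@cts_cst _ _ (0 : R) z0) (cts_pair (@cts_cst _ _ (0 : R) z0) (@cts_id _ z0))) c).
Qed.

Lemma mollifier_bump_supported : supported 1 (@mollifier_bump R n).
Proof.
split; first by apply: scv_continuous => z0; exact: scv_mollifier_bump.
move=> v v1; rewrite mollifier_bumpE /flat subr_gt0; case: ifPn => // S1.
suff : `|v| <= 1 by rewrite leNgt v1.
apply: rV_norm_le => // i; rewrite -(@expr_le1 _ 2) // real_normK ?num_real //.
apply: le_trans (ltW S1); rewrite (bigD1 i) //= lerDl.
by apply: sumr_ge0 => j _; exact: sqr_ge0.
Qed.

Lemma Rn_integral_bump_gt0 : 0 < Rn_integral (@mollifier_bump R n).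
Proof.
have [_] := Rn_integral_gt0 ltr01 mollifier_bump_supported
  (fun v => eq_ind_r (fun x => 0 <= x) (flat_ge0 _ _) (mollifier_bumpE v)).
apply; rewrite mollifier_bumpE big1 => [|i _]; last by rewrite mxE expr0n.
by rewrite subr0 /flat ltr01 expr0 mul1r expR_gt0.
Qed.

Lemma mollifier_supported : supported 1 (@mollifier R n).
Proof.
have -> : @mollifier R n = (fun v => (Rn_integral (@mollifier_bump R n))^-1 * mollifier_bump v).
  exact/funext.
by apply: supportedZ => //; exact: mollifier_bump_supported.
Qed.

Lemma Rn_integral_mollifier : Rn_integral (@mollifier R n) = 1.
Proof.
rewrite /mollifier (Rn_integralZ ler01 _ mollifier_bump_supported) // mulVf // gt_eqF //.
exact: Rn_integral_bump_gt0.
Qed.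

Lemma scv_mollifier (I W : topologicalType) k (e0 : I) (w0 : W) (z0 : V) :
  scv k e0 w0 z0 (fun _ _ => @mollifier R n).
Proof. by apply: scvM; [exact: (@scv_cst _ _ _ _ R^o)|exact: scv_mollifier_bump]. Qed.

Lemma scv_mollifier_scaled (r : R) (I W : topologicalType) k (e0 : I) (w0 : W) (z0 : V) :
  scv k e0 w0 z0 (fun _ _ => @mollifier_scaled R n r).
Proof.
apply: scvM; first exact: (@scv_cst _ _ _ _ R^o).
apply: (scv_comp_row (c := fun _ _ z => r^-1 *: z) (h := fun _ _ => @mollifier R n)); last exact: scv_mollifier.
move=> i; apply: (scv_eq (f := fun _ _ (z : V) => r^-1 * z 0 i)); first by near=> t; rewrite mxE.
apply: scvM; first exact: (@scv_cst _ _ _ _ R^o).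
apply: scv_coord.
have H : scv k e0 w0 z0 (fun (_ : I) (_ : W) z => (idfun : {linear V -> V}) z).
  by apply: scv_lin => z; exact: cvg_id.
exact: H.
Unshelve. all: by end_near. Qed.

Lemma mollifier_scaled_supported (r : R) : 0 < r -> supported r (@mollifier_scaled R n r).
Proof.
move=> r0; split; first by apply: scv_continuous => z0; exact: scv_mollifier_scaled.
move=> v rv; rewrite /mollifier_scaled; have [_ ->] := mollifier_supported; first by rewrite mulr0.
by rewrite normrZ gtr0_norm ?invr_gt0 // mulrC ltr_pdivlMr // mul1r.
Qed.

End Bump.

Lemma cts_mul (R : realType) (T : topologicalType) (f g : T -> R) (x : T) :
  {for x, continuous f} -> {for x, continuous g} -> {for x, continuous (fun y => f y * g y)}.
Proof. by move=> cf cg; exact: (cvgM cf cg). Qed.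

Section Mollification.
Variables (R : realType) (n : nat).
Notation V := 'rV[R]_n.

(** The maximum of [e] and 0, in a form whose continuity is immediate. As the size of a shift it
    cancels the shift for [e <= 0]. *)
Definition pos_part (e : R) : R := (e + `|e|) / 2.

Lemma pos_part_ge0 e : 0 <= e -> pos_part e = e.
Proof. by move=> e0; rewrite /pos_part ger0_norm //; lra. Qed.

Lemma pos_part_le0 e : e <= 0 -> pos_part e = 0.
Proof. by move=> e0; rewrite /pos_part ler0_norm // subrr mul0r. Qed.

Lemma pos_part_continuous : continuous pos_part.
Proof.
move=> e; apply: cvgM; last exact: cvg_cst.
by apply: cvgD; [exact: cvg_id|exact: norm_continuous].
Qed.

Lemma pair_coordB j (p q : V * V) (s : R) :
  pair_coord j (p - s *: q) = pair_coord j p - s * pair_coord j q.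
Proof. by case: j => i; rewrite /= !mxE. Qed.

(** The kernel is fixed and [e] only shifts the argument, so the derivatives fall on [f]. At [e = 0]
    the shift vanishes for every [w], hence convergence of [f] at the single point [p0] is
    enough. *)
Lemma scv_mollify (W : topologicalType) (w1 : W) k (p0 : V * V) (a : V -> V * V)
    (f : R -> V * V -> R) : continuous a ->
  (forall w : V, scv k (0 : R) w p0 (fun e _ => f e)) ->
  scv k (0 : R) w1 p0
    (fun e _ p => Rn_integral (fun w => mollifier w * f e (p - pos_part e *: a w))).
Proof.
move=> ca hf; have [cm _] := @mollifier_supported R n.
apply: (scv_Rn_integral (@pair_coordE R n) (@pair_coord_continuous R n)
  (@pair_coord_le R n) (r := 1) ler01); last first.
  near=> s; move=> w w1'; have [_ ->] := @mollifier_supported R n => //.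
  by rewrite mul0r.
move=> w _; apply: scvM.
  apply: scv_param.
    exact: (@cts_comp _ _ _ snd (@mollifier R n) (0 : R, w) (@cts_snd _ _ _) (cm w)).
  by near=> s; exact: cm.
pose c j e (w : V) p := pair_coord j p - pos_part e * pair_coord j (a w).
have cE e w' p : \sum_j c j e w' p *: @pair_basis R n j = p - pos_part e *: a w'.
  by rewrite [RHS]pair_coordE; apply: eq_bigr => j _; rewrite pair_coordB.
apply: (scv_eq (f := fun e w p => f e (\sum_j c j e w p *: @pair_basis R n j))).
  by near=> t; rewrite cE.
apply: (scv_comp (c := c) (h := fun e _ => f e)); last first.
  by rewrite cE pos_part_ge0 // scale0r subr0.
move=> j; apply: scvB; first exact: scv_pair_coord.
have cj : continuous (fun w => pair_coord j (a w)).
  by move=> u; exact: (@cts_comp _ _ _ a (pair_coord j) u (ca u) (@pair_coord_continuous _ _ _ _)).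
apply: (@scv_param _ _ _ _ R^o _ _ _ _ (fun e w => pos_part e * pair_coord j (a w))).
  apply: cvgM.
    exact: (@cts_comp _ _ _ fst pos_part (0 : R, w) (@cts_fst _ _ _) (@pos_part_continuous _)).
  exact: (@cts_comp _ _ _ snd (fun w => pair_coord j (a w)) (0 : R, w) (@cts_snd _ _ _) (@cj _)).
by near=> s; apply: cts_mul; [exact: cts_cst|exact: cj].
Unshelve. all: by end_near. Qed.

End Mollification.

(** * Vertical smoothing *)

Section Homogeneous.
Variables (R : realType) (n : nat).
Notation V := 'rV[R]_n.
Variables (A : set V).
Hypothesis oA : open A.

Definition slit_over : set (V * V) := [set q | A q.1 /\ q.2 != 0].

Lemma open_slit_over : open slit_over.
Proof.
rewrite (_ : slit_over = (fst @^-1` A) `&` (snd @^-1` [set y : V | y != 0])) //.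
apply: openI; first by apply: open_comp => // p _; exact: cts_fst.
apply: open_comp => [p _|]; first exact: cts_snd.
have -> : [set y : V | y != 0] = ~` [set 0].
  by apply/seteqP; split => y /= /eqP.
exact/closed_openC/accessible_closed_set1/hausdorff_accessible/norm_hausdorff.
Qed.

Definition homogeneous (f : V -> V -> R) : Prop :=
  [/\ smooth_on slit_over (fun p => f p.1 p.2),
      forall x w (m : R), A x -> 0 < m -> f x (m *: w) = m * f x w &
      forall x, A x -> f x 0 = 0].

Lemma sphere_compact : compact [set u : V | `|u| = 1].
Proof.
apply: (subclosed_compact _ (@box_compact R n 1)); last by move=> u /= ->.
rewrite (_ : [set _ | _] = (fun u : V => `|u|) @^-1` [set 1]) //.
apply: closed_comp; first by move=> u _; exact: norm_continuous.
exact: closed_eq.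
Qed.

(** On the zero section, compactness of the unit sphere bounds [f y] on it by a constant [B] that
    serves all [y] near [x], and homogeneity gives |f y u| <= B |u|. *)
Lemma homogeneous_cts f x w : homogeneous f -> A x ->
  {for (x, w), continuous (fun p : V * V => f p.1 p.2)}.
Proof.
move=> [sf hf f0] Ax.
have cf y u : A y -> u != 0 -> {for (y, u), continuous (fun p : V * V => f p.1 p.2)}.
  by move=> Ay u0; exact: (sf 0%N (y, u)).
have [->|w0] := eqVneq w 0; last exact: cf.
have [B [B0 HB]] : exists B, 0 < B /\ \forall y \near x, forall u, `|u| = 1 -> `|f y u| <= B.
  have /compact_near_coveringP cov := sphere_compact.
  (* The bound is the second component of the parameter and is taken near +oo: the covering property
     then produces one value for the whole sphere. *)
  have := cov _ (filter_prod (nbhs x) (pinfty_nbhs R)) (fun s u => `|f s.1 u| <= s.2) _.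
  case=> [u u1|[P Q] /= [Px [M [_ HM]]] PQ].
    have u0 : u != 0 by rewrite -normr_gt0 u1.
    have /cvgrPdist_lt /(_ 1 ltr01) := cf x u Ax u0.
    case=> [[P Q] /= [Px Qu] PQ].
    exists (Q, [set s : V * R | P s.1 /\ `|f x u| + 1 <= s.2]).
      split => //=; exists (P, [set s | `|f x u| + 1 <= s]) => //=.
        by split => //; exact: nbhs_pinfty_ge.
    move=> -[u' [y s]] /= [Qu' [Py us]]; have := PQ (y, u') (conj Py Qu').
    rewrite /= distrC => /ltW h; apply: le_trans us.
    by rewrite -lerBlDl (le_trans _ h) // lerB_dist.
  exists (`|M| + 1); split; first by rewrite ltr_wpDl.
  move: Px; apply: filterS => y Py u u1; apply: (PQ (y, `|M| + 1)) => //; split => //=.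
  by apply: HM; rewrite (le_lt_trans (ler_norm M)) // ltrDl.
rewrite /prop_for /continuous_at /= f0 //; apply/cvgrPdist_le => e e0.
have nA : \forall p \near (x, 0 : V), A p.1 /\ forall u, `|u| = 1 -> `|f p.1 u| <= B.
  apply: near_and; have c := @cts_fst _ _ (x, 0 : V).
    exact: (c _ (open_nbhs_nbhs (conj oA Ax))).
  exact: (c _ HB).
have nw : \forall p \near (x, 0 : V), `|p.2| <= e / B.
  have c := @cts_snd _ _ (x, 0 : V).
  have h : \forall w \near (0 : V), `|w| <= e / B.
    apply/nbhs_ballP; exists (e / B) => /=; first by rewrite divr_gt0.
    by move=> w'; rewrite -ball_normE /= sub0r normrN => /ltW.
  exact: (c _ h).
move: nA nw; apply: filterS2 => -[y u] /= [Ay Hy] ue; rewrite sub0r normrN.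
have [->|u0] := eqVneq u 0; first by rewrite f0 // normr0 ltW.
have un : 0 < `|u| by rewrite normr_gt0.
have -> : u = `|u| *: (`|u|^-1 *: u) by rewrite scalerA divff ?scale1r // gt_eqF.
rewrite hf // normrM normr_id.
have h := Hy (`|u|^-1 *: u); apply: (@le_trans _ _ (e / B * B)).
  apply: ler_pM => //; apply: h; rewrite normrZ ger0_norm ?invr_ge0 //.
  by rewrite mulVf // gt_eqF.
by rewrite divfK // gt_eqF.
Qed.

Lemma pair_shift_fst (s : R) (v x w : V) : s *: ((v, 0) : V * V) + (x, w) = (s *: v + x, w).
Proof.
by have -> : (s *: v + x, w) = (s *: v + x, s *: 0 + w) by rewrite scaler0 add0r.
Qed.

Lemma pair_shift_snd (s : R) (v x w : V) : s *: ((0, v) : V * V) + (x, w) = (x, s *: v + w).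
Proof.
by have -> : (x, s *: v + w) = (s *: 0 + x, s *: v + w) by rewrite scaler0 add0r.
Qed.

Lemma derive_fst (F : V * V -> R) (v x w : V) :
  'D_v (fun x => F (x, w)) x = 'D_(v, 0) F (x, w).
Proof.
rewrite /derive; set g := (X in lim (X @ _) = _); set h := (X in _ = lim (X @ _)).
suff -> : g = h by [].
by apply/funext => s; rewrite /g /h /= pair_shift_fst.
Qed.

Lemma derive_snd (F : V * V -> R) (v x w : V) :
  'D_v (fun w => F (x, w)) w = 'D_(0, v) F (x, w).
Proof.
rewrite /derive; set g := (X in lim (X @ _) = _); set h := (X in _ = lim (X @ _)).
suff -> : g = h by [].
by apply/funext => s; rewrite /g /h /= pair_shift_snd.
Qed.

(** A derivative along the base is again homogeneous in the fibre, so it stays continuous on the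
    zero section, where vertical derivatives need not be. *)
Lemma homogeneous_derive f v : homogeneous f ->
  homogeneous (fun x w => 'D_v (fun x => f x w) x).
Proof.
move=> [sf hf f0].
have nA x : A x -> \forall y \near x, A y by move=> Ax; exact: open_nbhs_nbhs.
split.
- rewrite (_ : (fun p => _) = 'D_(v, 0) (fun p : V * V => f p.1 p.2)).
    by move=> k; have [_] := sf k.+1; exact.
  by apply/funext => -[x w] /=; rewrite (derive_fst (fun p => f p.1 p.2)).
- move=> x w m Ax m0; have [->|w0] := eqVneq w 0.
    rewrite scaler0 (_ : 'D_v _ x = 0) ?mulr0 //.
    rewrite (@near_eq_derive _ _ _ _ (cst 0)) ?derive_cst //.
    by have := nA x Ax; apply: filterS => y /f0.
  rewrite (@near_eq_derive _ _ _ _ (m *: (fun x => f x w))); last first.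
    by have := nA x Ax; apply: filterS => y Ay; rewrite hf.
  rewrite deriveZ //.
  have d : differentiable (fun p : V * V => f p.1 p.2) (x, w) by have [d _] := sf 1%N; exact: d.
  have := @diff_derivable _ _ _ _ _ (v, 0) d.
  rewrite /derivable; set g := (X in cvg (X @ _) -> _); set h := (X in _ -> cvg (X @ _)).
  suff -> : g = h by [].
  apply/funext => s; rewrite /g /h; congr (_ *: (_ - _)).
  exact: (congr1 (fun p => f p.1 p.2) (pair_shift_fst s v x w)).
- move=> x Ax; rewrite (@near_eq_derive _ _ _ _ (cst 0)) ?derive_cst //.
  by have := nA x Ax; apply: filterS => y /f0.
Qed.

Lemma homogeneous_differentiable f (w : V) (p : V * V) : homogeneous f -> A p.1 ->
  differentiable (fun p : V * V => f p.1 w) p.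
Proof.
move=> [sf hf f0] Ap; have [->|w0] := eqVneq w 0.
  apply: (@differentiable_near _ _ _ (cst 0)); last exact: differentiable_cst.
  have nA : \forall q \near p, A q.1 by exact: (@cts_fst _ _ p _ (open_nbhs_nbhs (conj oA Ap))).
  by move: nA; apply: filterS => q /f0 ->.
have dF : differentiable (fun p : V * V => f p.1 p.2) (p.1, w) by have [d _] := sf 1%N; exact: d.
have lf : linear (fun p : V * V => (p.1, 0 : V)) by move=> a x y; rewrite /= [LHS]surjective_pairing /=; congr pair; rewrite /= scaler0 addr0.
pose l : {linear (V * V)%type -> (V * V)%type} := HB.pack (fun p : V * V => (p.1, 0 : V))
  (GRing.isLinear.Build _ _ _ _ _ lf).
have dl : differentiable (fun p : V * V => l p + cst (0, w) p) p.
  apply: differentiableD; last exact: differentiable_cst.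
  apply: linear_differentiable => q; apply: cts_pair; [exact: cts_fst|exact: cts_cst].
have E q : l q + cst (0, w) q = (q.1, w) by rewrite /= /cst; congr pair; rewrite /= ?addr0 ?add0r.
have dl2 : differentiable (fun q : V * V => (q.1, w)) p.
  by move: dl; congr (differentiable _ _); apply/funext => q; exact: E.
exact: (@differentiable_comp _ _ _ _ (fun q : V * V => (q.1, w)) (fun p : V * V => f p.1 p.2) p).
Qed.

(** Here the fibre vector is the parameter and may be zero: only base derivatives are taken, and
    [homogeneous_derive] reduces them to [homogeneous_cts]. *)
Lemma scv_homogeneous (I : topologicalType) f k (e0 : I) (w0 : V) (p0 : V * V) :
  homogeneous f -> A p0.1 -> scv k e0 w0 p0 (fun _ w p => f p.1 w).
Proof.
move=> hf Ap.
have nA : \forall t \near (e0, (w0, p0)), A t.2.2.1.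
  have c : {for (e0, (w0, p0)), continuous (fun t : I * (V * (V * V)) => t.2.2.1)}.
    exact: (@cts_comp _ _ _ (fun t : I * (V * (V * V)) => t.2.2) fst (e0, (w0, p0)) (@cts_22 _ _ _ _) (@cts_fst _ _ _)).
  exact: (c _ (open_nbhs_nbhs (conj oA Ap))).
elim: k f hf => [|k IH] f hf.
all: have h1 : {for (e0, (w0, p0)), continuous (fun t : I * (V * (V * V)) => f t.2.2.1 t.2.1)}.
1,3: apply: (@cts_comp _ _ _ (fun t : I * (V * (V * V)) => (t.2.2.1, t.2.1)) (fun p => f p.1 p.2) (e0, (w0, p0))).
1,3: apply: cts_pair; last exact: cts_21.
1,2: exact: (@cts_comp _ _ _ (fun t : I * (V * (V * V)) => t.2.2) fst (e0, (w0, p0)) (@cts_22 _ _ _ _) (@cts_fst _ _ _)).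
1,2: exact: homogeneous_cts.
all: have h2 : \forall t \near (e0, (w0, p0)), {for t.2, continuous (fun s : V * (V * V) => f s.2.1 s.1)}.
1,3: move: nA; apply: filterS => -[e [w p]] /= Ap';
  apply: (@cts_comp _ _ _ (fun s : V * (V * V) => (s.2.1, s.1)) (fun p => f p.1 p.2) (w, p));
  [apply: cts_pair; [exact: (@cts_comp _ _ _ snd fst (w, p) (@cts_snd _ _ _) (@cts_fst _ _ _))|exact: cts_fst]
  |exact: homogeneous_cts].
  by split.
split => //; split.
  by move: nA; apply: filterS => t At; exact: homogeneous_differentiable.
move=> v; apply: (scv_eq (f := fun _ w p => 'D_v.1 (fun x => f x w) p.1)).
  by near=> t.
exact: (IH _ (homogeneous_derive v.1 hf)).
Unshelve. all: by end_near. Qed.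

End Homogeneous.

Section VerticalConvolution.
Variables (R : realType) (n : nat).
Notation V := 'rV[R]_n.
Variables (A : set V) (L : V -> V -> R) (rho : R) (u : R -> R).
Hypothesis oA : open A.
Hypothesis hL : homogeneous A L.
Hypothesis rho0 : 0 < rho.

Definition fiber_convolution (e : R) (x y : V) : R :=
  Rn_integral (fun z => ((1 - u e) * mollifier_scaled e z +
    u e * mollifier_scaled rho z) * L x (y - z)).

Lemma supported_mul (r : R) (f g : V -> R) : supported r f -> continuous g ->
  supported r (fun v => f v * g v).
Proof.
move=> [cf f0] cg; split; last by move=> v rv; rewrite f0 // mul0r.
by move=> v; apply: cts_mul; [exact: cf|exact: cg].
Qed.

Lemma fiber_continuous x : A x -> continuous (L x).
Proof.
move=> Ax w; have c := homogeneous_cts oA (w := w) hL Ax.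
exact: (@cts_comp _ _ _ (fun w => (x, w)) (fun p => L p.1 p.2) w
  (cts_pair (@cts_cst _ _ x w) (@cts_id _ w)) c).
Qed.

Lemma reflect_continuous (y : V) : continuous (fun z : V => y - z).
Proof.
move=> z; have c1 := @cts_cst V V y z.
exact: cvgB c1 (@cts_id V z).
Qed.

(** The two kernels are rewritten differently. Scaling turns the narrow one into the fixed mollifier
    with [e] inside the argument of [L]. Reflection puts [y] into the wide kernel, because there y -
    z may vanish and [L] cannot be differentiated in the fibre. *)
Lemma fiber_convolution_split e x y : 0 < e -> A x ->
  fiber_convolution e x y =
  (1 - u e) * Rn_integral (fun w => mollifier w * L x (y - e *: w)) +
  u e * Rn_integral (fun w => mollifier_scaled rho (y - w) * L x w).
Proof.
move=> e0 Ax; have cL := fiber_continuous Ax.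
have cLy : continuous (fun z : V => L x (y - z)).
  move=> z; exact: (@cts_comp _ _ _ (fun z : V => y - z) (L x) z (@reflect_continuous y z) (cL _)).
(* A common support radius, since [Rn_integral_comb] uses one ball for both summands. *)
pose r := Num.max e rho.
have up r' (f : V -> R) : r' <= r -> supported r' f -> supported r f.
  by move=> rr [cf f0]; split => // v rv; apply: f0; exact: le_lt_trans rv.
have se : supported e (fun z => mollifier_scaled e z * L x (y - z)).
  by apply: supported_mul => //; exact: mollifier_scaled_supported.
have sr : supported rho (fun z => mollifier_scaled rho z * L x (y - z)).
  by apply: supported_mul => //; exact: mollifier_scaled_supported.
have er : e <= r by rewrite le_max lexx.
have rr : rho <= r by rewrite le_max lexx orbT.
have r0 : 0 <= r by rewrite le_max ltW.
transitivity ((1 - u e) * Rn_integral (fun z => mollifier_scaled e z * L x (y - z)) +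
  u e * Rn_integral (fun z => mollifier_scaled rho z * L x (y - z))).
  rewrite -(Rn_integralZ r0 (u e) (up _ _ rr sr)) -(Rn_integral_comb r0 (1 - u e) (up _ _ er se)).
    by congr Rn_integral; apply/funext => z; ring.
  by apply: supportedZ => //; exact: up rr sr.
congr (_ * _ + _ * _).
  have en : e != 0 by rewrite gt_eqF.
  have := Rn_integral_affine 0 (ltW e0) en se; rewrite gtr0_norm // => E.
  transitivity (e ^+ n * (e ^- n * Rn_integral (fun z => mollifier_scaled e z * L x (y - z)))).
    by rewrite mulrA divff ?mul1r // expf_neq0.
  rewrite -E -(Rn_integralZ (r := (e + `|0 : V|) / `|e|)); last first.
  - exact: (@supported_affine_rV R n e e 0 (fun z => mollifier_scaled e z * L x (y - z)) en se).
  - by rewrite divr_ge0 // addr_ge0 // ltW.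
  congr Rn_integral; apply/funext => w; rewrite addr0 /mollifier_scaled.
  by rewrite scalerA mulVf // scale1r !mulrA divff ?mul1r // expf_neq0.
have n1 : (-1 : R) != 0 by rewrite oppr_eq0 oner_neq0.
have := Rn_integral_affine y (ltW rho0) n1 sr; rewrite normrN1 expr1n invr1 mul1r => <-.
congr Rn_integral; apply/funext => w; rewrite scaleN1r [- w + y]addrC; congr (_ * L x _).
by rewrite opprB addrC subrK.
Qed.

Lemma scv_wide (I W : topologicalType) (e0 : I) (w1 : W) k (x0 y0 : V) : A x0 ->
  scv k e0 w1 (x0, y0)
    (fun _ _ p => Rn_integral (fun w => mollifier_scaled rho (p.2 - w) * L p.1 w)).
Proof.
(* For |y| < |y0| + 1 the kernel at y - w vanishes as soon as |w| > r. *)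
move=> Ax; pose r := `|y0| + 1 + rho.
have r0 : 0 <= r by rewrite !addr_ge0 // ltW.
apply: (scv_Rn_integral (@pair_coordE R n) (@pair_coord_continuous R n)
  (@pair_coord_le R n) r0); last first.
  have cy : {for (e0, (x0, y0)), continuous (fun s : I * (V * V) => s.2.2)} by exact: cts_22.
  have hy : \forall y \near y0, `|y| < `|y0| + 1.
    by apply: (cvgr_lt _ (@norm_continuous _ _ y0)); rewrite ltrDl.
  have hn : \forall s \near (e0, (x0, y0)), `|s.2.2| < `|y0| + 1 := cy _ hy.
  move: hn; apply: filterS => -[e [x y]] /= hyy w rw.
  have [_ ->] := mollifier_scaled_supported n rho0; first by rewrite mul0r.
  have := ler_normB y (y - w); rewrite opprB addrC subrK.
  move: rw; rewrite /r; lra.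
move=> w _; apply: scvM; last exact: (@scv_homogeneous R n A oA I L k e0 w (x0, y0) hL Ax).
apply: (scv_comp_row (c := fun _ (w : V) (p : V * V) => p.2 - w) (h := fun _ _ => @mollifier_scaled R n rho)); last first.
  exact: scv_mollifier_scaled.
move=> i; apply: (scv_eq (f := fun _ (w : V) (p : V * V) => p.2 0 i - w 0 i)).
  by near=> t; rewrite !mxE.
apply: scvB; first exact: scv_snd_coord.
apply: (@scv_param _ _ _ _ R^o _ _ _ _ (fun _ (w : V) => w 0 i)).
  exact: (@cts_comp _ _ _ snd (fun w : V => w 0 i) (e0, w) (@cts_snd _ _ _) (@coord_continuous _ _ _ _ _ _)).
by near=> s; exact: coord_continuous.
Unshelve. all: by end_near. Qed.

Lemma right_extension_continuous : u e @[e --> 0^'+] --> (0 : R) ->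
  {for 0, continuous (fun e : R => if 0 < e then u e else 0)}.
Proof.
move=> u0; rewrite /prop_for /continuous_at ltxx; apply/cvgrPdist_lt => e e0.
move/cvgrPdist_lt : u0 => /(_ e e0); rewrite /at_right near_withinE.
by apply: filterS => t; rewrite sub0r normrN; case: ifP => [t0 /(_ isT)|_ _]; rewrite ?sub0r ?normrN ?normr0.
Qed.

(** The wide term disappears with its weight, and the narrow one tends to [L] times the integral of
    the mollifier, that is to [L]. For [e <= 0] the same formula, with weight 0 and no shift, is
    exactly [L]. *)
Theorem scv_fiber_convolution (W : topologicalType) (w1 : W) k (x0 y0 : V) : A x0 -> y0 != 0 ->
  u e @[e --> 0^'+] --> (0 : R) ->
  scv k (0 : R) w1 (x0, y0) (fun e _ p => if 0 < e then fiber_convolution e p.1 p.2 else L p.1 p.2).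
Proof.
move=> Ax y0n u0; pose uu e := if 0 < e then u e else 0.
have nA : \forall t \near ((0 : R), (w1, (x0, y0))), A t.2.2.1.
  have c : {for ((0 : R), (w1, (x0, y0))), continuous (fun t : R * (W * (V * V)) => t.2.2.1)}.
    exact: (@cts_comp _ _ _ (fun t : R * (W * (V * V)) => t.2.2) fst _ (@cts_22 _ _ _ _) (@cts_fst _ _ _)).
  exact: (c _ (open_nbhs_nbhs (conj oA Ax))).
have ca : continuous (fun w : V => (0 : V, w)).
  move=> w; exact: (@cts_pair V V V (fun _ => 0) (fun w => w) w (@cts_cst _ _ _ _) (@cts_id _ _)).
pose P e (p : V * V) := Rn_integral (fun w => mollifier w *
  L (p - pos_part e *: (0 : V, w)).1 (p - pos_part e *: (0 : V, w)).2).
have sP : scv k (0 : R) w1 (x0, y0) (fun e _ p => P e p).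
  apply: (scv_mollify w1 (a := fun w => (0 : V, w)) (f := fun _ p => L p.1 p.2)) => // w.
  case: hL => sL _ _.
  by apply: (scv_smooth _ _ _ (open_slit_over oA) _ sL).
have PE e x y : P e (x, y) = Rn_integral (fun w => mollifier w * L x (y - pos_part e *: w)).
  congr Rn_integral; apply/funext => w; congr (_ * L _ _).
  by rewrite /= scaler0 subr0.
have su : scv k (0 : R) w1 (x0, y0) (fun e _ _ => uu e).
  apply: (@scv_param _ _ _ _ R^o _ _ _ _ (fun e _ => uu e)).
    exact: (@cts_comp _ _ _ fst uu ((0 : R), w1) (@cts_fst _ _ _) (right_extension_continuous u0)).
  by near=> s; exact: cts_cst.
apply: (scv_eq (f := fun e _ p => (1 - uu e) * P e p + uu e *
   Rn_integral (fun w => mollifier_scaled rho (p.2 - w) * L p.1 w))); last first.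
  apply: scvD; apply: scvM => //; last exact: scv_wide.
  by apply: scvB => //; exact: (@scv_cst _ _ _ _ R^o).
move: nA; apply: filterS => -[e [w [x y]]] /= Ax'; rewrite PE /uu.
case: ifPn => [e0|]; first by rewrite pos_part_ge0 ?fiber_convolution_split // ltW.
rewrite -leNgt => e0; rewrite pos_part_le0 // subr0 mul1r mul0r addr0.
transitivity (L x y * Rn_integral (@mollifier R n)); last by rewrite Rn_integral_mollifier mulr1.
rewrite -(@Rn_integralZ R 1 ler01 n (L x y) _ (@mollifier_supported R n)).
by congr Rn_integral; apply/funext => w'; rewrite scale0r subr0 mulrC.
Unshelve. all: by end_near. Qed.

End VerticalConvolution.

(** * Implicit functions *)

Section Implicit.
Variables (R : realType) (n : nat).
Notation V := 'rV[R]_n.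

Definition dilate (s : R) (p : V * V) : V * V := (p.1, s *: p.2).

Lemma dilate_cts (s : R) (p : V * V) :
  {for (s, p), continuous (fun z : R * (V * V) => dilate z.1 z.2)}.
Proof.
apply: cts_pair.
  exact: (@cts_comp _ _ _ snd fst (s, p) (@cts_snd _ _ (s, p)) (@cts_fst _ _ p)).
apply: (@cts_comp _ _ _ (fun z : R * (V * V) => (z.1, z.2.2)) (fun z : R * V => z.1 *: z.2) (s, p)).
  apply: cts_pair; first exact: cts_fst.
  exact: (@cts_comp _ _ _ snd snd (s, p) (@cts_snd _ _ (s, p)) (@cts_snd _ _ p)).
exact: (@scale_continuous R V (s, p.2)).
Qed.

Lemma dilate_shift (s h : R) (p : V * V) :
  h *: ((0, p.2) : V * V) + dilate s p = dilate (s + h) p.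
Proof. by rewrite /dilate pair_shift_snd scalerDl addrC. Qed.

(* If the derivative of [s |-> g t0 (x0, s y0)] does not vanish at [s0], then
   [g t (x, s y)] still takes the value [g t0 (x0, s0 y0)] for some [s] near [s0] when
   [(t, x, y)] is near [(t0, x0, y0)], by the intermediate value theorem. *)
Lemma dilate_IVT (T : topologicalType) (t0 : T) (g : T -> V * V -> R) (p0 : V * V) (s0 r : R) :
  (\forall x \near (t0, dilate s0 p0), {for x.2, continuous (g x.1)}) ->
  (\forall s \near s0, {for (t0, dilate s p0), continuous (fun x : T * (V * V) => g x.1 x.2)}) ->
  differentiable (g t0) (dilate s0 p0) ->
  'D_(0, p0.2) (g t0) (dilate s0 p0) != 0 ->
  g t0 (dilate s0 p0) = r ->
  forall e : R, 0 < e -> \forall x \near (t0, p0), exists2 s, `|s - s0| < e & g x.1 (dilate s x.2) = r.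
Proof.
move=> Hc Hl Hd HD Hr e e0.
set D : R := 'D_(0, p0.2) (g t0) (dilate s0 p0) in HD.
(* The difference quotient tends to [D], so its product with [D] is positive near 0, and multiplying
   by h^2 clears the denominator. Hence the difference with [r] changes sign with [h]. *)
have sgn : \forall h \near (0 : R), h != 0 -> 0 < (g t0 (dilate (s0 + h) p0) - r) * h * D.
  have dv := @diff_derivable _ _ _ _ _ (0, p0.2) Hd.
  have c : (fun h : R => h^-1 *: (g t0 (h *: ((0, p0.2) : V * V) + dilate s0 p0) - g t0 (dilate s0 p0))) @ 0^' --> D.
    exact: dv.
  have D2 : 0 < D ^+ 2 by rewrite exprn_even_gt0.
  have : \forall h \near (0 : R)^', 0 < h^-1 * (g t0 (dilate (s0 + h) p0) - r) * D.
    have c2 : (fun h : R => h^-1 * (g t0 (dilate (s0 + h) p0) - r) * D) @ 0^' --> D * D.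
      apply: cvgM; last exact: cvg_cst.
      rewrite (_ : (fun h => _) = (fun h : R => h^-1 *: (g t0 (h *: ((0, p0.2) : V * V) + dilate s0 p0) - g t0 (dilate s0 p0)))) //.
      by apply/funext => h; rewrite dilate_shift Hr.
    by apply: (cvgr_gt _ c2); rewrite -expr2.
  rewrite near_withinE; apply: filterS => h hh h0; have := hh h0.
  have h2 : 0 < h ^+ 2 by rewrite exprn_even_gt0.
  move/(mulr_gt0 h2); move: (g t0 (dilate (s0 + h) p0) - r) => X.
  by have -> : h ^+ 2 * (h^-1 * X * D) = X * h * D by field.
have Hc' : \forall z \near ((t0, p0), s0), {for dilate z.2 z.1.2, continuous (g z.1.1)}.
  have cm : {for ((t0, p0), s0), continuous (fun z : T * (V * V) * R => (z.1.1, dilate z.2 z.1.2))}.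
    apply: cts_pair.
      exact: (@cts_comp _ _ _ fst fst ((t0, p0), s0) (@cts_fst _ _ _) (@cts_fst _ _ _)).
    apply: (@cts_comp _ _ _ (fun z : T * (V * V) * R => (z.2, z.1.2)) (fun z => dilate z.1 z.2)).
      apply: cts_pair; first exact: cts_snd.
      exact: (@cts_comp _ _ _ fst snd ((t0, p0), s0) (@cts_fst _ _ _) (@cts_snd _ _ _)).
    exact: dilate_cts.
  exact: (cm _ Hc).
case: Hc' => -[U1 U2] /= [U1n U2n] U12.
have near2 : \forall h \near (0 : R), [/\ h != 0 -> 0 < (g t0 (dilate (s0 + h) p0) - r) * h * D,
    {for (t0, dilate (s0 + h) p0), continuous (fun x : T * (V * V) => g x.1 x.2)} & U2 (s0 + h)].
  have ch : (fun h : R => s0 + h) @ 0 --> s0.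
    by rewrite -[X in _ --> X]addr0; apply: cvgD; [exact: cvg_cst|exact: cvg_id].
  by move: sgn (ch _ Hl) (ch _ U2n); apply: filterS3 => h ? ? ?; split.
have /nbhs_ballP [d /= d0 Hd'] := near2.
(* The halves make the inequalities strict: the segment of radius [q] around [s0] stays in the
   neighbourhood just found, and its points are closer than [e] to [s0]. *)
pose q := Num.min (d / 2) (e / 2).
have q0 : 0 < q by rewrite lt_min !divr_gt0.
have qd : q < d by rewrite gt_min; apply/orP; left; lra.
have qe : q < e by rewrite gt_min; apply/orP; right; lra.
have bq (h : R) : `|h| <= q -> ball (0 : R) d h.
  by move=> hq; rewrite /ball /= sub0r normrN (le_lt_trans hq).
have [p1 l1 _] := Hd' q (bq q ltac:(by rewrite ger0_norm // ltW)).
have [p2 l2 _] := Hd' (- q) (bq (- q) ltac:(by rewrite normrN ger0_norm // ltW)).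
have qn : q != 0 by rewrite gt_eqF.
have {}p1 := p1 qn; have {}p2 := p2 ltac:(by rewrite oppr_eq0).
pose F h (x : T * (V * V)) := (g x.1 (dilate (s0 + h) x.2) - r) * h * D.
have nF h : {for (t0, dilate (s0 + h) p0), continuous (fun x : T * (V * V) => g x.1 x.2)} ->
    0 < F h (t0, p0) -> \forall x \near (t0, p0), 0 < F h x.
  move=> l p; have c : {for (t0, p0), continuous (F h)}.
    apply: cts_mul; last exact: cts_cst.
    apply: cts_mul; last exact: cts_cst.
    apply: cvgB; last exact: cts_cst.
    apply: (@cts_comp _ _ _ (fun x : T * (V * V) => (x.1, dilate (s0 + h) x.2)) (fun x => g x.1 x.2) (t0, p0)) => //.
    apply: cts_pair; first exact: cts_fst.
    apply: (@cts_comp _ _ _ (fun x : T * (V * V) => (s0 + h, x.2)) (fun z => dilate z.1 z.2) (t0, p0)).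
      by apply: cts_pair; [exact: cts_cst|exact: cts_snd].
    exact: dilate_cts.
  exact: (cvgr_gt _ c).
have := nF _ l1 p1; have := nF _ l2 p2; have U1' : \forall x \near (t0, p0), U1 x by [].
move: U1'; apply: filterS3 => x Ux x2 x1.
pose phi s := g x.1 (dilate s x.2).
have cphi : {within `[s0 - q, s0 + q], continuous phi}.
  apply: continuous_in_subspaceT => s; rewrite inE /= in_itv /= => /andP[sa sb].
  have [_ _ U2s] := Hd' (s - s0) (bq (s - s0) ltac:(by rewrite ler_norml; apply/andP; split; lra)).
  rewrite addrC subrK in U2s.
  have cg := U12 (x, s) (conj Ux U2s).
  apply: (@cts_comp _ _ _ (fun s => dilate s x.2) (g x.1) s); last exact: cg.
  apply: (@cts_comp _ _ _ (fun s : R => (s, x.2)) (fun z => dilate z.1 z.2) s); last exact: dilate_cts.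
  by apply: cts_pair; [exact: cts_id|exact: cts_cst].
have sq : s0 - q <= s0 + q by lra.
have mm : Num.min (phi (s0 - q)) (phi (s0 + q)) <= r <= Num.max (phi (s0 - q)) (phi (s0 + q)).
  move: x1 x2; rewrite /F -/(phi (s0 + q)) -/(phi (s0 - q)) ge_min le_max.
  move: (phi _) (phi _) => a b.
  rewrite mulrN mulNr => h1 h2.
  have h1' : 0 < (b - r) * D.
    by rewrite -(pmulr_rgt0 _ q0) (_ : q * _ = (b - r) * q * D) //; ring.
  have h2' : (a - r) * D < 0.
    by rewrite -oppr_gt0 -(pmulr_rgt0 _ q0) (_ : q * _ = - ((a - r) * q * D)) //; ring.
  have [D0|D0] := ltP 0 D.
    move: h1' h2'; rewrite pmulr_lgt0 // pmulr_llt0 // subr_gt0 subr_lt0 => ra br.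
    by rewrite (ltW br) (ltW ra) orbT.
  have {}D0 : D < 0 by rewrite lt_neqAle HD.
  move: h1' h2'; rewrite nmulr_lgt0 // nmulr_llt0 // subr_gt0 subr_lt0 => ra br.
  by rewrite (ltW br) (ltW ra) orbT.
have [s] := IVT sq cphi mm; rewrite in_itv /= => /andP[sa sb] phis.
exists s => //; apply: le_lt_trans qe; rewrite ler_norml; apply/andP; split; lra.
Qed.

Lemma norm_pair0_le (w : V) : `|((0, w) : V * V)| <= `|w|.
Proof. by rewrite prod_normE /= normr0 ge_max; apply/andP; split. Qed.

Lemma norm_snd_le (v : V * V) : `|v.2| <= `|v|.
Proof. by rewrite prod_normE le_max lexx orbT. Qed.

Lemma dilateB (s s' : R) (v p : V * V) : dilate s' (v + p) - dilate s p =
  dilate s v + (s' - s) *: ((0, p.2) : V * V) + (s' - s) *: ((0, v.2) : V * V).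
Proof.
case: v => v1 v2; case: p => p1 p2.
have -> : dilate s' ((v1, v2) + (p1, p2)) - dilate s (p1, p2) =
  (v1 + p1 - p1, s' *: (v2 + p2) - s *: p2) by [].
have -> : dilate s (v1, v2) + (s' - s) *: ((0, p2) : V * V) + (s' - s) *: ((0, v2) : V * V) =
  (v1 + (s' - s) *: 0 + (s' - s) *: 0, s *: v2 + (s' - s) *: p2 + (s' - s) *: v2) by [].
by congr pair; [rewrite !scaler0 !addr0 addrK|apply/rowP => i; rewrite !mxE; ring].
Qed.

(** Expanding g(dilate (S p) p) = r at [p0] gives a linear equation for the increment of [S], up to
    an error bounded by small multiples of this increment and of [v]. Continuity of [S] is what
    makes the multiples small, and the part containing the increment is absorbed by the left-hand
    side. *)
Lemma implicit_differentiable (g : V * V -> R) (S : V * V -> R) (p0 : V * V) (r : R) :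
  differentiable g (dilate (S p0) p0) -> {for p0, continuous S} ->
  (\forall p \near p0, g (dilate (S p) p) = r) ->
  'D_(0, p0.2) g (dilate (S p0) p0) != 0 ->
  differentiable S p0 /\ forall v : V * V, 'D_v S p0 =
    - ('D_(0, p0.2) g (dilate (S p0) p0))^-1 * 'D_(dilate (S p0) v) g (dilate (S p0) p0).
Proof.
move=> dg cS Sr; set a : R := 'D_(0, p0.2) g (dilate (S p0) p0) => a0.
set s0 := S p0 in dg a a0 *; set q0 := dilate s0 p0 in dg a a0 *.
pose dgq := 'd g q0.
have aE : a = dgq (0, p0.2) by rewrite /a deriveE.
pose ell v := - a^-1 * dgq (dilate s0 v).
have dil_lin k v w : dilate s0 (k *: v + w) = k *: dilate s0 v + dilate s0 w.
  have -> : dilate s0 (k *: v + w) = (k *: v.1 + w.1, s0 *: (k *: v.2 + w.2)) by [].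
  have -> : k *: dilate s0 v + dilate s0 w = (k *: v.1 + w.1, k *: (s0 *: v.2) + s0 *: w.2) by [].
  by rewrite scalerDr !scalerA mulrC.
have dl k v w : dgq (k *: v + w) = k * (dgq v : R) + (dgq w : R) :> R by exact: linearP.
have lin : linear (ell : V * V -> R^o).
  move=> k v w; suff : ell (k *: v + w) = k * ell v + ell w by [].
  by rewrite /ell dil_lin dl; move: (dgq _ : R) (dgq _ : R) => x y; ring.
have [K K0 HK] : exists2 K : R, 0 < K & forall v, `|dgq v| <= K * `|v|.
  exact: (linear_lipschitz (diff_continuous dg)).
have cdil : continuous (dilate s0).
  move=> v; apply: (@cts_comp _ _ _ (fun v => (s0, v)) (fun z => dilate z.1 z.2)); last exact: dilate_cts.
  by apply: cts_pair; [exact: cts_cst|exact: cts_id].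
have cell : continuous (ell : V * V -> R).
  move=> v; apply: (@cts_mul R _ (fun _ => - a^-1) (fun v => dgq (dilate s0 v)) v); first exact: cts_cst.
  have cdg : continuous dgq by apply: diff_continuous.
  exact: (@cts_comp _ _ _ (dilate s0) (fun z => dgq z : R) v (cdil v) (cdg _)).
suff [d E] : differentiable S p0 /\ 'd S p0 = ell :> (V * V -> R).
  split => // v; rewrite (deriveE _ d) (deriveE _ dg).
  exact: (congr1 (fun f : V * V -> R => f v) E).
apply: differentiable_eps => // e e0.
pose ai := `|a|^-1; have ai0 : 0 < ai by rewrite invr_gt0 normr_gt0.
(* Chosen for |Del v| <= C (|v| + |sig|) when |v| <= 1: the contributions are those of the dilated
   [v], of the radial displacement of [p0] and of the mixed term. *)
pose C := 1 + `|s0| + `|p0| + 1.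
have C0 : 0 < C by rewrite /C; have := normr_ge0 s0; have := normr_ge0 p0; lra.
pose M := ai * K * (1 + `|s0|).
have M0 : 0 <= M by rewrite /M; apply: mulr_ge0; [rewrite mulr_ge0 // ltW|rewrite addr_ge0].
have dil_le v : `|dilate s0 v| <= (1 + `|s0|) * `|v|.
  rewrite /dilate prod_normE /= ge_max; apply/andP; split.
    rewrite mulrDl mul1r (le_trans (_ : _ <= `|v|)) ?lerDl ?mulr_ge0 //.
    by rewrite prod_normE le_max lexx.
  rewrite normrZ mulrDl mul1r ler_wpDl // ler_wpM2l //.
  by rewrite prod_normE le_max lexx orbT.
have ellM v : `|ell v| <= M * `|v|.
  rewrite /ell normrM normrN normfV -/ai /M -!mulrA ler_wpM2l ?(ltW ai0) //.
  by apply: le_trans (HK _) _; rewrite ler_wpM2l // ltW.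
(* [kap <= 1/2] lets kap |tau| be absorbed by |tau|, and kap (M + 1) <= e/2 then leaves e |v|. The
   choice of [eta] below makes the linearization error contribute kap/2. *)
pose kap := Num.min (2^-1) (e / (2 * (M + 1))).
have M1 : 0 < M + 1 by lra.
have kap0 : 0 < kap by rewrite lt_min invr_gt0 ltr0n /= divr_gt0 // mulr_gt0.
have kap2 : kap <= 2^-1 by rewrite ge_min lexx.
have kape : kap * (M + 1) <= e / 2.
  have : kap <= e / (2 * (M + 1)) by rewrite ge_min lexx orbT.
  by rewrite ler_pdivlMr ?mulr_gt0 //; lra.
pose eta := kap / (2 * ai * C).
have eta0 : 0 < eta by rewrite divr_gt0 // !mulr_gt0.
have etaE : ai * eta * C = kap / 2 by rewrite /eta; field; rewrite !gt_eqF.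
have sh : (fun v : V * V => v + p0) @ (0 : V * V) --> p0.
  have h : {for (0 : V * V), continuous (fun v : V * V => v + p0)}.
    exact: cvgD (@cts_id _ (0 : V * V)) (@cts_cst _ _ p0 (0 : V * V)).
  by move: h; rewrite /prop_for /continuous_at add0r.
pose Del v := dilate (S (v + p0)) (v + p0) - q0.
have cDel : Del @ (0 : V * V) --> (0 : V * V).
  have c1 : {for p0, continuous (fun p => dilate (S p) p)}.
    apply: (@cts_comp _ _ _ (fun p => (S p, p)) (fun z => dilate z.1 z.2)); last exact: dilate_cts.
    by apply: cts_pair; [exact: cS|exact: cts_id].
  have c2 : (fun v : V * V => dilate (S (v + p0)) (v + p0)) @ (0 : V * V) --> q0.
    exact: (cvg_comp _ _ sh c1).
  have c3 : {for (0 : V * V), continuous (fun _ : V * V => q0)} by exact: cts_cst.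
  by have := cvgB c2 c3; rewrite (subrr q0) => h; exact: h.
have small : \forall v \near (0 : V * V), `|g (Del v + q0) - g q0 - dgq (Del v)| <= eta * `|Del v|.
  have /diff_locally/eqaddoP/(_ _ eta0) := dg.
  have H : (\forall w \near (0 : V * V), `|(g \o shift q0 - (cst (g q0) + 'd g q0)) w| <= eta * `|w|) ->
     \forall v \near (0 : V * V), `|(g \o shift q0 - (cst (g q0) + 'd g q0)) (Del v)| <= eta * `|Del v|.
    by move=> h; exact: (cDel _ h).
  move/H; apply: filterS => v; rewrite !fctE /= opprD addrA; exact.
have vK : \forall v \near (0 : V * V), ai * K * `|v| <= kap / 2.
  have h : \forall v \near (0 : V * V), `|v| < kap / (2 * ai * K).
    apply/nbhs_ballP; exists (kap / (2 * ai * K)) => /=; first by rewrite divr_gt0 // !mulr_gt0.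
    by move=> v; rewrite -ball_normE /= sub0r normrN.
  move: h; apply: filterS => v; rewrite ltr_pdivlMr ?mulr_gt0 // => /ltW h.
  rewrite ler_pdivlMr //; have -> : ai * K * `|v| * 2 = `|v| * (2 * ai * K) by ring.
  exact: h.
have v1 : \forall v \near (0 : V * V), `|v| <= 1.
  apply/nbhs_ballP; exists 1 => //= v; rewrite -ball_normE /= sub0r normrN; exact: ltW.
have Srr : \forall v \near (0 : V * V), g (dilate (S (v + p0)) (v + p0)) = r := sh _ Sr.
have r0 := nbhs_singleton Sr.
move: small; apply: filter_app; move: (near_and vK (near_and v1 Srr)).
apply: filterS => v [vk [v1' Sv]] hs.
pose sig := S (v + p0) - s0; rewrite -/s0.
have DelE : Del v = dilate s0 v + sig *: ((0, p0.2) : V * V) + sig *: ((0, v.2) : V * V).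
  exact: dilateB.
have gz : g (Del v + q0) - g q0 = 0.
  by rewrite /Del subrK Sv -r0 subrr.
have dD : dgq (Del v) = dgq (dilate s0 v) + sig * a + sig * dgq (0, v.2) :> R.
  have -> : Del v = sig *: ((0, v.2) : V * V) + (sig *: ((0, p0.2) : V * V) + dilate s0 v).
    by rewrite DelE addrC; congr (_ + _); rewrite addrC.
  by rewrite (dl sig (0, v.2)) (dl sig (0, p0.2)) -aE addrC; congr (_ + _); rewrite addrC.
rewrite gz sub0r normrN dD in hs.
(* The remainder to be estimated; multiplication by [a] removes the inverse contained in [ell]. *)
set tau := sig - ell v.
have tauE : a * tau = (dgq (dilate s0 v) + sig * a + sig * dgq (0, v.2)) - sig * dgq (0, v.2).
  by rewrite /tau /ell; field.
have nv2 : `|((0, v.2) : V * V)| <= `|v|.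
  exact: le_trans (norm_pair0_le _) (norm_snd_le _).
have Dle : `|Del v| <= C * (`|v| + `|sig|).
  rewrite DelE; apply: le_trans (ler_normD _ _) _; rewrite normrZ.
  have h1 : `|dilate s0 v + sig *: ((0, p0.2) : V * V)| <= (1 + `|s0|) * `|v| + `|sig| * `|p0|.
    apply: le_trans (ler_normD _ _) _; rewrite normrZ lerD // ler_wpM2l //.
    exact: le_trans (norm_pair0_le _) (norm_snd_le _).
  have h2 : `|sig| * `|((0, v.2) : V * V)| <= `|sig|.
    by rewrite ler_piMr // (le_trans nv2).
  have := normr_ge0 s0; have := normr_ge0 p0; have := normr_ge0 v; have := normr_ge0 sig.
  move: h1 h2; rewrite /C; move: (`|sig|) (`|v|) (`|p0|) (`|s0|) => A B P Q; nra.
have tle : `|tau| <= kap * `|sig| + (kap / 2) * `|v|.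
  have t1 : `|a| * `|tau| <= eta * (C * (`|v| + `|sig|)) + `|sig| * (K * `|v|).
    rewrite -normrM tauE; apply: le_trans (ler_normB _ _) _; apply: lerD.
      by apply: le_trans hs _; apply: ler_wpM2l Dle; exact: ltW.
    rewrite normrM; apply: ler_wpM2l => //; apply: le_trans (HK _) _.
    by apply: ler_wpM2l nv2; exact: ltW.
  have : ai * (`|a| * `|tau|) <= ai * (eta * (C * (`|v| + `|sig|)) + `|sig| * (K * `|v|)).
    by apply: ler_wpM2l t1; exact: ltW.
  rewrite mulrA /ai mulVf ?mul1r ?normr_eq0 // -/ai.
  have -> : ai * (eta * (C * (`|v| + `|sig|)) + `|sig| * (K * `|v|)) =
    (ai * eta * C) * (`|v| + `|sig|) + `|sig| * (ai * K * `|v|) by ring.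
  rewrite etaE => h; apply: le_trans h _.
  have : `|sig| * (ai * K * `|v|) <= `|sig| * (kap / 2) by rewrite ler_wpM2l.
  lra.
have sle : `|sig| <= `|tau| + M * `|v|.
  have -> : sig = tau + ell v by rewrite /tau subrK.
  by apply: le_trans (ler_normD _ _) _; rewrite lerD2l.
have goal : `|tau| <= e * `|v|.
  have h1 : kap * `|sig| <= kap * (`|tau| + M * `|v|) by apply: ler_wpM2l sle; exact: ltW.
  have h2 : kap * `|tau| <= 2^-1 * `|tau| by rewrite ler_wpM2r.
  have h3 : kap * (M + 1) * `|v| <= e / 2 * `|v| by rewrite ler_wpM2r.
  have h4 : 0 <= kap * `|v| by rewrite mulr_ge0 // ltW.
  lra.
by [].
Qed.

End Implicit.

Section ParameterFree.
Variables (R : realType) (I W : topologicalType) (Z Y : normedModType R).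
Variables (e0 : I) (w1 : W) (z0 : Z) (f : I -> Z -> Y).

Lemma scv_fixed k : scv k e0 w1 z0 (fun e _ => f e) ->
  {for (e0, z0), continuous (fun t : I * Z => f t.1 t.2)} /\
  \forall t \near (e0, z0), {for t.2, continuous (f t.1)}.
Proof.
move=> h.
have ci : {for (e0, z0), continuous (fun t : I * Z => (t.1, (w1, t.2)))}.
  apply: cts_pair; first exact: cts_fst.
  by apply: cts_pair; [exact: cts_cst|exact: cts_snd].
split.
  exact: (@cts_comp _ _ _ (fun t : I * Z => (t.1, (w1, t.2))) (fun t => f t.1 t.2.2) _ ci (scv_cts h)).
have N : \forall t \near (e0, z0), {for (w1, t.2), continuous (fun s : W * Z => f t.1 s.2)}
  := ci _ (scv_near_cts h).
move: N; apply: filterS => t ct.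
apply: (@cts_comp _ _ _ (fun z : Z => (w1, z)) (fun s => f t.1 s.2) t.2 _ ct).
by apply: cts_pair; [exact: cts_cst|exact: cts_id].
Qed.

Lemma scv_fixed_diff k : scv k.+1 e0 w1 z0 (fun e _ => f e) ->
  \forall t \near (e0, z0), differentiable (f t.1) t.2.
Proof.
move=> h.
have ci : {for (e0, z0), continuous (fun t : I * Z => (t.1, (w1, t.2)))}.
  apply: cts_pair; first exact: cts_fst.
  by apply: cts_pair; [exact: cts_cst|exact: cts_snd].
exact: (ci _ (scv_diff h)).
Qed.

Lemma scv_fixed_intro :
  {for (e0, z0), continuous (fun t : I * Z => f t.1 t.2)} ->
  (\forall t \near (e0, z0), {for t.2, continuous (f t.1)}) ->
  scv 0 e0 w1 z0 (fun e _ => f e).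
Proof.
move=> h1 h2; split => //.
  apply: (@cts_comp _ _ _ (fun t : I * (W * Z) => (t.1, t.2.2)) (fun t => f t.1 t.2) (e0, (w1, z0)) _ h1).
  by apply: cts_pair; [exact: cts_fst|exact: cts_22].
have := near_drop w1 h2; apply: filterS => t ct.
exact: (@cts_comp _ _ _ snd (f t.1) t.2 (@cts_snd _ _ _) ct).
Qed.

End ParameterFree.

Section ImplicitFamily.
Variables (R : realType) (n : nat) (I W : topologicalType).
Notation V := 'rV[R]_n.
Variables (e0 : I) (w1 : W) (p0 : V * V) (h S : I -> V * V -> R) (r : R).
Notation s0 := (S e0 p0).
Hypothesis hh : forall k, scv k e0 w1 (dilate s0 p0) (fun e _ => h e).
Hypothesis hl : \forall s \near s0,
  {for (e0, dilate s p0), continuous (fun t : I * (V * V) => h t.1 t.2)}.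
Hypothesis Sunique : \forall t \near (e0, p0),
  forall s, 0 < s -> h t.1 (dilate s t.2) = r -> S t.1 t.2 = s.
Hypothesis Ssol : \forall t \near (e0, p0),
  0 < S t.1 t.2 /\ h t.1 (dilate (S t.1 t.2) t.2) = r.
Hypothesis Dneq0 : 'D_(0, p0.2) (h e0) (dilate s0 p0) != 0.

(** The intermediate value theorem supplies a solution near [s0]. Its distance to [s0] is taken
    below [s0], so it is positive, and uniqueness identifies it with the value of [S]. *)
Lemma implicit_cvg : {for (e0, p0), continuous (fun t : I * (V * V) => S t.1 t.2)}.
Proof.
have [s0p hr] := nbhs_singleton Ssol; rewrite /= in s0p hr.
have [_ hc] := scv_fixed (hh 0).
have hd := nbhs_singleton (scv_fixed_diff (hh 1)); rewrite /= in hd.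
apply/cvgrPdist_lt => e epos /=.
have em : 0 < Num.min e s0 by rewrite lt_min epos.
have := dilate_IVT hc hl hd Dneq0 hr em; move: Sunique; apply: filterS2 => t Su [s].
rewrite lt_min => /andP[se ss] hs; rewrite (Su s) //; first by rewrite distrC.
by have := ler_norm (s0 - s); rewrite distrC; move: ss; lra.
Qed.

(* [scv] controls the derivatives along fixed directions only, whereas [y] varies. *)
Let radial e (q : V * V) (y : V) : R := \sum_i y 0 i * 'D_(0, delta_mx 0 i) (h e) q.

Let radialE e q y : differentiable (h e) q -> 'D_(0, y) (h e) q = radial e q y.
Proof.
move=> d; rewrite deriveE // [in LHS](pair_coordE (0, y)) linear_sum big_sumType /=.
rewrite big1 ?add0r => [|i _]; last by rewrite mxE scale0r linear0.
by apply: eq_bigr => i _; rewrite linearZ deriveE.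
Qed.

(** The radial derivative is a combination of derivatives along fixed directions, hence jointly
    continuous along the solution, and it stays nonzero. *)
Let near_radial : \forall t \near (e0, p0),
  differentiable (h t.1) (dilate (S t.1 t.2) t.2) /\
  'D_(0, t.2.2) (h t.1) (dilate (S t.1 t.2) t.2) != 0.
Proof.
have cm : {for (e0, p0), continuous (fun t : I * (V * V) => (t.1, dilate (S t.1 t.2) t.2))}.
  apply: cts_pair; first exact: cts_fst.
  apply: (@cts_comp _ _ _ (fun t : I * (V * V) => (S t.1 t.2, t.2)) (fun z => dilate z.1 z.2)); last exact: dilate_cts.
  by apply: cts_pair; [exact: implicit_cvg|exact: cts_snd].
have d : \forall t \near (e0, p0), differentiable (h t.1) (dilate (S t.1 t.2) t.2).
  exact: (cm _ (scv_fixed_diff (hh 1))).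
have c : {for (e0, p0), continuous (fun t : I * (V * V) => radial t.1 (dilate (S t.1 t.2) t.2) t.2.2)}.
  apply: cts_sum => i; apply: cts_mul.
    exact: (@cts_comp _ _ _ (fun t : I * (V * V) => t.2.2) (fun y : V => y 0 i) _ (@cts_22 _ _ _ _) (@coord_continuous _ _ _ _ _ _)).
  have [ch _] := scv_fixed (scv_derive (0, delta_mx 0 i) (hh 1)).
  exact: (@cts_comp _ _ _ (fun t : I * (V * V) => (t.1, dilate (S t.1 t.2) t.2))
    (fun t => 'D_(0, delta_mx 0 i) (h t.1) t.2) (e0, p0) cm ch).
have r0 : radial e0 (dilate s0 p0) p0.2 != 0.
  by rewrite -radialE //; exact: (nbhs_singleton d).
have nr : \forall t \near (e0, p0), radial t.1 (dilate (S t.1 t.2) t.2) t.2.2 != 0.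
  exact: (cvgr_neq0 _ c).
by move: d nr; apply: filterS2 => t d; rewrite radialE.
Qed.

(** For a fixed [e] close to [e0], the same intermediate value argument at nearby points gives the
    continuity of [S e], which is what [implicit_differentiable] starts from. *)
Let near_fixed : \forall t \near (e0, p0), differentiable (S t.1) t.2 /\
  forall v : V * V, 'D_v (S t.1) t.2 =
    - ('D_(0, t.2.2) (h t.1) (dilate (S t.1 t.2) t.2))^-1 *
      'D_(dilate (S t.1 t.2) v) (h t.1) (dilate (S t.1 t.2) t.2).
Proof.
have cm : {for (e0, p0), continuous (fun t : I * (V * V) => (t.1, dilate (S t.1 t.2) t.2))}.
  apply: cts_pair; first exact: cts_fst.
  apply: (@cts_comp _ _ _ (fun t : I * (V * V) => (S t.1 t.2, t.2)) (fun z => dilate z.1 z.2)); last exact: dilate_cts.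
  by apply: cts_pair; [exact: implicit_cvg|exact: cts_snd].
have hc : \forall t \near (e0, p0), \forall q \near dilate (S t.1 t.2) t.2, {for q, continuous (h t.1)}.
  have [_ c] := scv_fixed (hh 0).
  exact: (cm _ (near_pair_slice c)).
have su := near_pair_slice Sunique; have ss := near_pair_slice Ssol.
have := near_and su ss; move: hc near_radial; apply: filterS3 => -[e p] /= hc [d D0] [su1 ss1].
have [sp hr] := nbhs_singleton ss1.
have cS : {for p, continuous (S e)}.
  apply/cvgrPdist_lt => eps epos /=.
  have em : 0 < Num.min eps (S e p) by rewrite lt_min epos.
  have c1 : {for S e p, continuous (fun s => dilate s p)}.
    apply: (@cts_comp _ _ _ (fun s : R => (s, p)) (fun z => dilate z.1 z.2)); last exact: dilate_cts.
    by apply: cts_pair; [exact: cts_id|exact: cts_cst].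
  (* [e] is fixed here, whereas [dilate_IVT] is stated for families: the parameter in [R] is a
     dummy. *)
  have A1 : \forall x \near ((0 : R), dilate (S e p) p), {for x.2, continuous (fun q => h e q)}.
    exact: (@cts_snd _ _ ((0 : R), dilate (S e p) p) _ hc).
  have A2 : \forall s \near S e p, {for ((0 : R), dilate s p), continuous (fun x : R * (V * V) => h e x.2)}.
    have H : \forall s \near S e p, {for dilate s p, continuous (h e)} := c1 _ hc.
    move: H; apply: filterS => s c.
    exact: (@cts_comp _ _ _ snd (h e) ((0 : R), dilate s p) (@cts_snd _ _ _) c).
  have IV := @dilate_IVT R n R (0 : R) (fun _ => h e) p (S e p) r A1 A2 d D0 hr _ em.
  have ci : {for p, continuous (fun q : V * V => ((0 : R), q))}.
    by apply: cts_pair; [exact: cts_cst|exact: cts_id].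
  have IV2 : \forall q \near p, exists2 s, `|s - S e p| < Num.min eps (S e p) & h e (dilate s q) = r := ci _ IV.
  move: su1 IV2; apply: filterS2 => q Su [s].
  rewrite lt_min => /andP[se sse] hs; rewrite (Su s) //; first by rewrite distrC.
  by have := ler_norm (S e p - s); rewrite distrC; move: sse; lra.
apply: (@implicit_differentiable R n (h e) (S e) p r) => //.
by move: ss1; apply: filterS => q [].
Qed.

(** The derivative of [S] is expressed through [S] and the derivatives of [h] at the dilated point,
    so the convergence of [S] at order k gives that of its derivative at order k. *)
Theorem scv_implicit k : scv k e0 w1 p0 (fun e _ => S e).
Proof.
have near_c : \forall t \near (e0, p0), {for t.2, continuous (S t.1)}.
  by move: near_fixed; apply: filterS => t [d _]; exact: differentiable_continuous.
elim: k => [|k IH]; first exact: (scv_fixed_intro w1 implicit_cvg near_c).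
have [h1 h2 _] := scv_fixed_intro w1 implicit_cvg near_c.
split => //; split.
  have H : \forall t \near (e0, (w1, p0)), differentiable (S t.1) t.2.2 /\ _ := near_drop w1 near_fixed.
  by move: H; apply: filterS => t [].
move=> v.
have comp (H : I -> V * V -> R) : scv k e0 w1 (dilate s0 p0) (fun e _ => H e) ->
    scv k e0 w1 p0 (fun e _ p => H e (dilate (S e p) p)).
  move=> hH; apply: (scv_comp_pair (c := fun _ _ p => p.1) (d := fun e _ p => S e p *: p.2)
    (h := fun e _ => H e)) => //.
    by move=> i; exact: scv_fst_coord.
  move=> i; apply: (scv_eq (f := fun e _ (p : V * V) => S e p * p.2 0 i)).
    by near=> t; rewrite mxE.
  by apply: scvM IH _; exact: scv_snd_coord.
have cD u : scv k e0 w1 p0 (fun e _ p => 'D_u (h e) (dilate (S e p) p)).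
  exact: (comp (fun e => 'D_u (h e)) (scv_derive u (hh k.+1))).
pose rad e (p : V * V) := radial e (dilate (S e p) p) p.2.
have crad : scv k e0 w1 p0 (fun e _ => rad e).
  by apply: scv_sum => i _; apply: scvM; [exact: scv_snd_coord|exact: cD].
(* The direction [dilate (S e p) v] moves with [p]; it is split as (v.1, 0) plus S times (0, v.2),
   two fixed directions. *)
pose num e (p : V * V) := \sum_j pair_coord j (v.1, 0) * 'D_(pair_basis R j) (h e) (dilate (S e p) p) +
  S e p * \sum_j pair_coord j (0, v.2) * 'D_(pair_basis R j) (h e) (dilate (S e p) p).
have cnum : scv k e0 w1 p0 (fun e _ => num e).
  apply: scvD; last apply: scvM IH _.
    by apply: scv_sum => j _; apply: scvM; [exact: (@scv_cst _ _ _ _ R^o)|exact: cD].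
  by apply: scv_sum => j _; apply: scvM; [exact: (@scv_cst _ _ _ _ R^o)|exact: cD].
have r0 : rad e0 p0 != 0.
  have [d D0] := nbhs_singleton near_radial.
  by rewrite /rad -radialE.
have := scvM (scvN (scvV (f := fun e _ => rad e) r0 crad)) cnum; apply: scv_eq.
have H : \forall t \near (e0, (w1, p0)), (differentiable (S t.1) t.2.2 /\
  forall v : V * V, 'D_v (S t.1) t.2.2 =
    - ('D_(0, t.2.2.2) (h t.1) (dilate (S t.1 t.2.2) t.2.2))^-1 *
      'D_(dilate (S t.1 t.2.2) v) (h t.1) (dilate (S t.1 t.2.2) t.2.2)) /\
  (differentiable (h t.1) (dilate (S t.1 t.2.2) t.2.2) /\ _)
  := near_drop w1 (near_and near_fixed near_radial).
move: H; apply: filterS => t [[_ ->] [d _]]; rewrite radialE //; congr (_ * _).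
have Dsum u : 'D_u (h t.1) (dilate (S t.1 t.2.2) t.2.2) =
  \sum_j pair_coord j u * 'D_(pair_basis R j) (h t.1) (dilate (S t.1 t.2.2) t.2.2).
  rewrite deriveE // [in LHS](pair_coordE u) linear_sum; apply: eq_bigr => j _.
  by rewrite linearZ deriveE.
rewrite /num -!Dsum !deriveE //.
have -> : dilate (S t.1 t.2.2) v = (v.1, 0) + S t.1 t.2.2 *: ((0, v.2) : V * V).
  have -> : (v.1, 0) + S t.1 t.2.2 *: ((0, v.2) : V * V) = (v.1 + S t.1 t.2.2 *: 0, 0 + S t.1 t.2.2 *: v.2) by [].
  by rewrite scaler0 addr0 add0r.
by rewrite linearD linearZ.
Unshelve. all: by end_near. Qed.

End ImplicitFamily.

Section SmoothedNorm.
Variables (R : realType) (n : nat).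
Notation V := 'rV[R]_n.
Variables (A : set V) (L : V -> V -> R) (rho r tau : R) (u : R -> R) (G : R -> V -> V -> R).
Hypothesis oA : open A.
Hypothesis hL : homogeneous A L.
Hypothesis rho0 : 0 < rho.
Hypothesis u0 : u e @[e --> 0^'+] --> (0 : R).
Hypothesis tau0 : 0 < tau.
Hypothesis rL : forall x y, A x -> y != 0 -> 0 < r / L x y.
Hypothesis GP : forall e, 0 < e < tau -> forall x, A x -> asymmetric_norm (G e x) /\
  [set y | G e x y = r] = [set y | fiber_convolution L rho u e x y = r].

Let h (e : R) (p : V * V) := if 0 < e then fiber_convolution L rho u e p.1 p.2 else L p.1 p.2.
(* Families indexed by [e > 0] are extended to [e <= 0] by their limit. *)
Definition norm_family (e : R) (p : V * V) : R := if 0 < e then G e p.1 p.2 else L p.1 p.2.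
Let S e p := r / norm_family e p.

Variables (x0 y0 : V).
Hypothesis Ax : A x0.
Hypothesis y0n : y0 != 0.

Let L0 : L x0 y0 != 0.
Proof. by have := rL Ax y0n; apply: contraTneq => ->; rewrite invr0 mulr0 ltxx. Qed.

Let r_neq0 : r != 0.
Proof. by have := rL Ax y0n; apply: contraTneq => ->; rewrite mul0r ltxx. Qed.

Let S0E : S 0 (x0, y0) = r / L x0 y0.
Proof. by rewrite /S /norm_family ltxx. Qed.

Let S0p : 0 < S 0 (x0, y0). Proof. by rewrite S0E rL. Qed.

Let hcvg (W : topologicalType) (w1 : W) k (s : R) : 0 < s -> scv k (0 : R) w1 (dilate s (x0, y0)) (fun e _ => h e).
Proof.
move=> s0; apply: (scv_fiber_convolution oA hL rho0) => //=.
by rewrite scaler_eq0 negb_or gt_eqF.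
Qed.

(** Euler's relation, read off the difference quotient along the ray, on which [L] is linear. It
    provides the nonzero derivative that the implicit function argument needs. *)
Lemma homogeneous_radial_derive (s : R) : 0 < s ->
  'D_(0, y0) (fun p : V * V => L p.1 p.2) (dilate s (x0, y0)) = L x0 y0.
Proof.
move=> s0; have [_ hh _] := hL.
apply/cvg_lim => //.
have near_s : \forall t \near (0 : R)^', L x0 y0 =
    t^-1 *: (((fun p : V * V => L p.1 p.2) \o shift (dilate s (x0, y0))) (t *: ((0, y0) : V * V)) - L (dilate s (x0, y0)).1 (dilate s (x0, y0)).2).
  rewrite near_withinE.
  have : \forall t \near (0 : R), - s < t by apply: lt_nbhsr; rewrite oppr_lt0.
  apply: filterS => t ts tn.
  have -> : ((fun p : V * V => L p.1 p.2) \o shift (dilate s (x0, y0))) (t *: ((0, y0) : V * V)) =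
      (fun p : V * V => L p.1 p.2) (dilate (s + t) (x0, y0)).
    by rewrite -dilate_shift.
  rewrite /= !hh //; last by rewrite -ltrBlDl sub0r.
  by rewrite -mulrBl addrAC subrr add0r /GRing.scale /= mulrA mulVf // mul1r.
by apply: cvg_trans (near_eq_cvg near_s) (cvg_cst _).
Qed.

Let Dneq0 : 'D_(0, (x0, y0).2) (h 0) (dilate (S 0 (x0, y0)) (x0, y0)) != 0.
Proof.
rewrite (_ : h 0 = (fun p : V * V => L p.1 p.2)) ?homogeneous_radial_derive //.
by apply/funext => p; rewrite /h ltxx.
Qed.

Let hl : \forall s \near S 0 (x0, y0),
  {for ((0 : R), dilate s (x0, y0)), continuous (fun t : R * (V * V) => h t.1 t.2)}.
Proof.
have : \forall s \near S 0 (x0, y0), 0 < s by exact: lt_nbhsr.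
by apply: filterS => s s0; have [] := scv_fixed (hcvg (0 : R) 0 s0).
Qed.

Let near_dom : \forall t \near ((0 : R), (x0, y0)), [/\ t.1 < tau, A t.2.1 & t.2.2 != 0].
Proof.
have nO : \forall p \near (x0, y0), slit_over A p.
  by apply: open_nbhs_nbhs; split; [exact: open_slit_over|].
have nO2 : \forall t \near ((0 : R), (x0, y0)), slit_over A t.2 := @cts_snd _ _ ((0 : R), (x0, y0)) _ nO.
have nt : \forall t \near ((0 : R), (x0, y0)), t.1 < tau := @cts_fst _ _ ((0 : R), (x0, y0)) _ (lt_nbhsl tau0).
by move: nO2 nt; apply: filterS2 => t [].
Qed.

(** By homogeneity a ray meets the level [r] of the norm at one positive parameter only, [r] divided
    by the norm of [y]. *)
Let Sunique : \forall t \near ((0 : R), (x0, y0)),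
  forall s, 0 < s -> h t.1 (dilate s t.2) = r -> S t.1 t.2 = s.
Proof.
move: near_dom; apply: filterS => -[e [x y]] /= [et Ax' yn] s s0.
rewrite /h /S /norm_family /=; case: ifPn => [e0 hr|e0 hr].
  have [[_ _ Gh _] GE] : _ := GP (e := e) ltac:(by rewrite e0) Ax'.
  have : [set y | G e x y = r] (s *: y) by rewrite GE.
  rewrite /= Gh ?(ltW s0) // => Gr; rewrite -Gr mulfK //.
  by apply: contra_eq_neq Gr => ->; rewrite mulr0 eq_sym.
have [_ hh _] := hL; rewrite hh // in hr; rewrite -hr mulfK //.
by apply: contra_eq_neq hr => ->; rewrite mulr0 eq_sym.
Qed.

(* Only [0 < r / L] is known a priori; [r] is a value of the nonnegative [G e x]. *)
Lemma radius_gt0 : 0 < r.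
Proof.
have [_ hc] := scv_fixed (hcvg (0 : R) 0 S0p).
have hd := nbhs_singleton (scv_fixed_diff (hcvg (0 : R) 1 S0p)); rewrite /= in hd.
have hr : h 0 (dilate (S 0 (x0, y0)) (x0, y0)) = r.
  by have [_ hh _] := hL; rewrite /h ltxx /= hh // S0E divfK.
(* At [e = 0] the level [r] is attained on the ray of [y0]. By the intermediate value theorem it is
   still attained for some [e > 0], which makes [r] a value of the norm [G e x0]. *)
have IV := near_and (dilate_IVT hc hl hd Dneq0 hr S0p) near_dom.
have ci : {for (0 : R), continuous (fun e : R => (e, (x0, y0)))}.
  by apply: cts_pair; [exact: cts_id|exact: cts_cst].
have IV2 : \forall e \near (0 : R), (exists2 s, `|s - S 0 (x0, y0)| < S 0 (x0, y0) & h e (dilate s (x0, y0)) = r) /\ [/\ e < tau, A x0 & y0 != 0] := ci _ IV.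
have /nbhs_ballP [d /= d0 Hd] := IV2.
have d2 : 0 < d / 2 by rewrite divr_gt0.
have [[s ss hs] [et _ _]] := Hd (d / 2) ltac:(by rewrite /ball /= sub0r normrN gtr0_norm //; lra).
have s0 : 0 < s.
  have := ler_norm (S 0 (x0, y0) - s); rewrite distrC; move: ss; lra.
have [[G0 _ _ _] GE] : _ := GP (e := d / 2) ltac:(by rewrite d2) Ax.
rewrite lt_neqAle eq_sym r_neq0 /=.
have : [set y | G (d / 2) x0 y = r] (s *: y0) by rewrite GE; move: hs; rewrite /h d2.
by move=> /= <-.
Qed.

Let Ssol : \forall t \near ((0 : R), (x0, y0)),
  0 < S t.1 t.2 /\ h t.1 (dilate (S t.1 t.2) t.2) = r.
Proof.
move: near_dom; apply: filterS => -[e [x y]] /= [et Ax' yn].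
rewrite /h /S /norm_family /=; case: ifPn => [e0|e0].
  have [[G0 Gn Gh _] GE] : _ := GP (e := e) ltac:(by rewrite e0) Ax'.
  have Gy : 0 < G e x y by rewrite lt_neqAle G0 andbT eq_sym; apply: contra_neq yn; exact: Gn.
  have rG : 0 < r / G e x y by rewrite divr_gt0 ?radius_gt0.
  split => //.
  have : [set y | G e x y = r] ((r / G e x y) *: y) by rewrite /= Gh ?(ltW rG) // divfK // gt_eqF.
  by rewrite GE.
have rLy := rL Ax' yn; split => //.
have [_ hh _] := hL; rewrite hh // divfK //.
by apply: contraTneq rLy => ->; rewrite invr0 mulr0 ltxx.
Qed.

Theorem scv_norm_family (W : topologicalType) (w1 : W) k :
  scv k (0 : R) w1 (x0, y0) (fun e _ => norm_family e).
Proof.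
have sS := scv_implicit (fun k => hcvg w1 k S0p) hl Sunique Ssol Dneq0 k.
have S0n : S 0 (x0, y0) != 0 by rewrite gt_eqF.
have := scvM (@scv_cst R R W (V * V)%type R^o k 0 w1 (x0, y0) r) (scvV (f := fun e _ => S e) S0n sS).
apply: scv_eq; near=> t.
by rewrite /S invfM invrK mulrA divff ?mul1r.
Unshelve. all: by end_near. Qed.

End SmoothedNorm.

Lemma cts_vanish (R : realType) (T : topologicalType) (f : T -> R) (P : T -> Prop) (x : T) :
  (\forall y \near x, P y) -> (forall y, P y -> f y = 0) -> {for x, continuous f}.
Proof.
move=> nP fP; apply: (@cts_near _ _ (fun _ => 0)); last exact: cts_cst.
by move: nP; apply: filterS => y Py; rewrite fP.
Qed.

(** * Smoothing in the base *)

Section HorizontalSmoothing.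
Variables (R : realType) (n : nat).
Notation V := 'rV[R]_n.
Variables (A : set V) (L : V -> V -> R) (rho r tau : R) (u : R -> R) (G : R -> V -> V -> R).
Hypothesis oA : open A.
Hypothesis hL : homogeneous A L.
Hypothesis rho0 : 0 < rho.
Hypothesis u0 : u e @[e --> 0^'+] --> (0 : R).
Hypothesis tau0 : 0 < tau.
Hypothesis rL : forall x y, A x -> y != 0 -> 0 < r / L x y.
Hypothesis GP : forall e, 0 < e < tau -> forall x, A x -> asymmetric_norm (G e x) /\
  [set y | G e x y = r] = [set y | fiber_convolution L rho u e x y = r].
Variable delta : R.
Hypothesis delta0 : 0 < delta.

Definition base_convolution (e : R) (x y : V) : R :=
  Rn_integral (fun z => mollifier_scaled (e * delta) (x - z) * G (e * delta) z y ^+ 2).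

Let f (e : R) (p : V * V) : R := norm_family L G (e * delta) p ^+ 2.
Let a (w : V) : V * V := (delta *: w, 0).

Let shiftE e (w : V) (p : V * V) : p - e *: a w = (p.1 - e *: (delta *: w), p.2).
Proof.
have -> : p - e *: a w = (p.1 - e *: (delta *: w), p.2 - e *: 0) by [].
by rewrite scaler0 subr0.
Qed.

Let ca : continuous a.
Proof.
move=> w; apply: cts_pair; last exact: cts_cst.
have : differentiable ( *:%R delta : V -> V) w by [].
exact: differentiable_continuous.
Qed.

Variables (x0 y0 : V).
Hypothesis Ax : A x0.
Hypothesis y0n : y0 != 0.

Let sf (W : topologicalType) (w1 : W) k : scv k (0 : R) w1 (x0, y0) (fun e _ => f e).
Proof.
have h : scv k (0 : R) w1 (x0, y0) (fun e _ p => norm_family L G e p ^+ 2).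
  by apply: scvX; exact: (scv_norm_family oA hL rho0 u0 tau0 rL GP).
have cr : {for (0 : R), continuous (fun e : R => e * delta)}.
  by apply: cts_mul; [exact: cts_id|exact: cts_cst].
have ci : continuous (fun w : W => w) by move=> w; exact: cts_id.
have := @scv_map R R W (V * V)%type R W R (fun e => e * delta) (fun w => w) k 0 w1 (x0, y0)
   (fun e _ p => norm_family L G e p ^+ 2) cr ci.
by rewrite mul0r => /(_ h).
Qed.

(** Nothing is known of [G] beyond [A], so continuity is obtained only on the window of points x - e
    delta w with |w| <= 1, by compactness from the continuity contained in the convergence at
    [e = 0]. *)
Let near_cts : \forall t \near ((0 : R), (x0, y0)), forall w : V, `|w| <= 1 ->
  {for (t.2.1 - pos_part t.1 *: (delta *: w), t.2.2), continuous (f t.1)}.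
Proof.
have [_ N] := scv_fixed (sf (0 : R) 0).
have H (w : V) : `|w| <= 1 -> \forall t \near ((0 : R), (w, (x0, y0))),
    {for t.2.2 - pos_part t.1 *: a t.2.1, continuous (f t.1)}.
  move=> _.
  have cm : {for ((0 : R), (w, (x0, y0))), continuous (fun t : R * (V * (V * V)) => (t.1, t.2.2 - pos_part t.1 *: a t.2.1))}.
    apply: cts_pair; first exact: cts_fst.
    apply: cvgB; first exact: cts_22.
    apply: (@cts_comp _ _ _ (fun t : R * (V * (V * V)) => (pos_part t.1, a t.2.1)) (fun z : R * (V * V) => z.1 *: z.2) ((0 : R), (w, (x0, y0)))); last exact: (@scale_continuous R (V * V)%type).
    apply: cts_pair.
      exact: (@cts_comp _ _ _ fst (@pos_part R) ((0 : R), (w, (x0, y0))) (@cts_fst _ _ _) (@pos_part_continuous R _)).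
    exact: (@cts_comp _ _ _ (fun t : R * (V * (V * V)) => t.2.1) a ((0 : R), (w, (x0, y0))) (@cts_21 _ _ _ _) (@ca _)).
  move: cm; rewrite /prop_for /continuous_at /= pos_part_ge0 // scale0r subr0 => cm.
  exact: (cm _ N).
have nb : \forall t \near ((0 : R), (x0, y0)), forall w : V, `|w| <= 1 ->
    {for t.2 - pos_part t.1 *: a w, continuous (f t.1)}.
  exact: (near_box (P := fun t : R * (V * (V * V)) => {for t.2.2 - pos_part t.1 *: a t.2.1, continuous (f t.1)}) H).
move: nb; apply: filterS => -[e p] /= hp w w1; have := hp w w1.
by rewrite shiftE.
Qed.

(** Substitution z = x - psi w, which again leaves a fixed kernel. The integrand is continuous
    everywhere: it is zero near the points with |x - z| > psi, and the other points lie in the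
    window of [near_cts]. *)
Let base_convolutionE : \forall t \near ((0 : R), (x0, y0)), 0 < t.1 ->
  base_convolution t.1 t.2.1 t.2.2 =
  Rn_integral (fun w => mollifier w * f t.1 (t.2 - pos_part t.1 *: a w)).
Proof.
move: near_cts; apply: filterS => -[e [x y]] /= hc e0.
have ep : 0 < e * delta by rewrite mulr_gt0.
set psi := e * delta in ep *.
have pn : - psi != 0 by rewrite oppr_eq0 gt_eqF.
pose F (z : V) := mollifier_scaled psi (x - z) * G psi z y ^+ 2.
have [cm m0] := mollifier_scaled_supported n ep.
have sF : supported (`|x| + psi) F.
  split; last first.
    move=> v hv; rewrite /F m0 ?mul0r //.
    have tri : `|v| <= `|x| + `|x - v|.
      by have := ler_normB x (x - v); rewrite opprB addrC subrK.
    by rewrite -(ltrD2l `|x|) (lt_le_trans hv).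
  move=> /= z; have [zx|zx] := leP `|x - z| psi; last first.
    have cz : {for z, continuous (fun z : V => `|x - z|)}.
      exact: (@cts_comp _ _ _ (fun z : V => x - z) (fun v : V => `|v|) z (@reflect_continuous _ _ x z) (@norm_continuous _ _ _)).
    apply: (@cts_vanish _ V F (fun z => psi < `|x - z|) z (cvgr_gt _ cz _ zx)) => z' hz.
    by rewrite /F m0 ?mul0r.
  apply: (@cts_mul R V (fun z : V => mollifier_scaled psi (x - z)) (fun z : V => G psi z y ^+ 2) z).
    exact: (@cts_comp _ _ _ (fun z : V => x - z) (mollifier_scaled psi) z (@reflect_continuous _ _ x z) (cm _)).
  pose w := psi^-1 *: (x - z).
  have w1 : `|w| <= 1 by rewrite normrZ gtr0_norm ?invr_gt0 // mulrC ler_pdivrMr // mul1r.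
  have := hc w w1; rewrite pos_part_ge0 ?(ltW e0) // scalerA -/psi /w scalerA divff ?gt_eqF // scale1r.
  rewrite opprB addrC subrK => cf.
  have cp : {for z, continuous (fun z : V => (z, y))} by apply: cts_pair; [exact: cts_id|exact: cts_cst].
  have := @cts_comp _ _ _ (fun z : V => (z, y)) (f e) z cp cf.
  by rewrite /f /norm_family -/psi ep.
have xp0 : 0 <= `|x| + psi by rewrite addr_ge0 // ltW.
have := Rn_integral_affine x xp0 pn sF; rewrite normrN gtr0_norm // => E.
transitivity (psi ^+ n * (psi ^- n * Rn_integral F)).
  by rewrite mulrA divff ?mul1r // expf_neq0 // gt_eqF.
rewrite -E -(Rn_integralZ (r := (`|x| + psi + `|x|) / `|- psi|)); last first.
- exact: (@supported_affine_rV R n (`|x| + psi) (- psi) x F pn sF).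
- by rewrite divr_ge0 // addr_ge0.
congr Rn_integral; apply/funext => w; rewrite /F /f /norm_family -/psi ep pos_part_ge0 ?(ltW e0) // shiftE /=.
have -> : - psi *: w + x = x - e *: (delta *: w) by rewrite scalerA scaleNr addrC.
rewrite opprB addrC subrK scalerA -/psi /mollifier_scaled scalerA mulVf ?gt_eqF // scale1r !mulrA.
by rewrite divff ?mul1r // expf_neq0 // gt_eqF.
Qed.

Theorem scv_base_convolution (W : topologicalType) (w1 : W) k :
  scv k (0 : R) w1 (x0, y0)
    (fun e _ p => if 0 < e then Num.sqrt (base_convolution e p.1 p.2) ^+ 2 else L p.1 p.2 ^+ 2).
Proof.
have sm := scv_mollify w1 ca (fun w => sf w k).
have L2 : 0 < L x0 y0 ^+ 2.
  rewrite exprn_even_gt0 //=; have := rL Ax y0n.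
  by apply: contraTneq => ->; rewrite invr0 mulr0 ltxx.
have E0 e p : e <= 0 -> Rn_integral (fun w => mollifier w * f e (p - pos_part e *: a w)) = L p.1 p.2 ^+ 2.
  move=> e0; rewrite pos_part_le0 //.
  transitivity (L p.1 p.2 ^+ 2 * Rn_integral (@mollifier R n)); last by rewrite Rn_integral_mollifier mulr1.
  rewrite -(@Rn_integralZ R 1 ler01 n _ _ (@mollifier_supported R n)).
  congr Rn_integral; apply/funext => w; rewrite scale0r subr0 mulrC /f /norm_family ltNge.
  by rewrite (_ : e * delta <= 0) // mulr_le0_ge0 // ltW.
(* Squaring undoes the square root only where its argument is nonnegative; this holds near the point
   because the limit L^2 is positive. *)
have pos : \forall t \near ((0 : R), (w1, (x0, y0))),
    0 < Rn_integral (fun w => mollifier w * f t.1 (t.2.2 - pos_part t.1 *: a w)).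
  by apply: (cvgr_gt _ (scv_cts sm)); rewrite /= E0.
apply: scv_eq sm.
have H : \forall t \near ((0 : R), (w1, (x0, y0))), 0 < t.1 ->
  base_convolution t.1 t.2.2.1 t.2.2.2 =
  Rn_integral (fun w => mollifier w * f t.1 (t.2.2 - pos_part t.1 *: a w)) := near_drop w1 base_convolutionE.
move: H pos; apply: filterS2 => t H p; case: ifPn => [t0|].
  by rewrite H // sqr_sqrtr // ltW.
by rewrite -leNgt => t0; rewrite E0.
Qed.

End HorizontalSmoothing.

Lemma diff_comp_near (K : numFieldType) (U V W : normedModType K) (f : U -> V) (g : V -> W)
    (h : U -> W) (x v : U) : (\forall a \near x, g (f a) = h a) ->
  differentiable f x -> differentiable g (f x) -> 'd h x v = 'd g (f x) ('d f x v).
Proof.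
move=> E d1 d2; have d3 : differentiable (g \o f) x by exact: differentiable_comp.
have [_ ->] := diff_near (f := g \o f) E d3.
by rewrite diff_comp.
Qed.

(** * Charts and natural coordinates *)

Section Charts.
Variables (R : realType) (n : nat) (M : smooth_manifold R n).
Notation V := 'rV[R]_n.
Implicit Types (c : chart R n M) (x : M).

Lemma cmap_image c (W : set M) : cmap c @` (cdom c `&` W) = cimg c `&` (cinv c @^-1` W).
Proof.
apply/seteqP; split => a /=.
  by move=> [x [cx Wx] <-]; split; [exists x|rewrite /= cmapK].
by move=> [[x cx <-]]; rewrite cmapK // => Wx; exists x.
Qed.

Lemma open_cmap_image c (W : set M) : open W -> open (cmap c @` (cdom c `&` W)).
Proof.
move=> oW; rewrite cmap_image openE => a /= [ca Wa].
have n1 : nbhs a (cimg c) by apply: open_nbhs_nbhs; split => //; exact: cimg_open.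
have n2 : nbhs a (cinv c @^-1` W).
  by apply: (cinv_continuous ca); exact: open_nbhs_nbhs.
exact: filterI.
Qed.

Lemma cinvK c a : cimg c a -> cmap c (cinv c a) = a.
Proof. by move=> [x cx <-]; rewrite cmapK. Qed.

Lemma cinv_dom c a : cimg c a -> cdom c (cinv c a).
Proof. by move=> [x cx <-]; rewrite cmapK. Qed.

Lemma cimg_cmap c x : cdom c x -> cimg c (cmap c x).
Proof. by exists x. Qed.

Lemma near_cmap c x (W : set M) : cdom c x -> nbhs x W ->
  \forall a \near cmap c x, cimg c a /\ W (cinv c a).
Proof.
move=> cx nW; have ca := cimg_cmap cx.
have n1 : nbhs (cmap c x) (cimg c) by apply: open_nbhs_nbhs; split => //; exact: cimg_open.
have n2 : nbhs (cmap c x) (cinv c @^-1` W).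
  by apply: (cinv_continuous ca); rewrite cmapK.
by move: n1 n2; apply: filterS2.
Qed.

Definition transition c c' : V -> V := cmap c' \o cinv c.

Lemma scv_transition c c' (I W : topologicalType) k (e0 : I) (w0 : W) x :
  atlas c -> atlas c' -> cdom c x -> cdom c' x ->
  scv k e0 w0 (cmap c x) (fun _ _ => transition c c').
Proof.
move=> ac ac' cx c'x.
apply: (scv_smooth (A := cmap c @` (cdom c `&` cdom c'))).
- by apply: open_cmap_image; exact: cdom_open.
- by exists x.
- exact: atlas_compatible.
Qed.

Lemma differentiable_transition c c' x :
  atlas c -> atlas c' -> cdom c x -> cdom c' x ->
  differentiable (transition c c') (cmap c x).
Proof.
move=> ac ac' cx c'x.
have := scv_diff (scv_transition 1 (0 : R) (0 : R) ac ac' cx c'x).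
by move=> /nbhs_singleton.
Qed.

Lemma near_cdom c x : cdom c x -> nbhs x (cdom c).
Proof. by move=> cx; apply: open_nbhs_nbhs; split => //; exact: cdom_open. Qed.

Lemma diff_transition_comp c c' c'' x (v : V) : atlas c -> atlas c' -> atlas c'' ->
  cdom c x -> cdom c' x -> cdom c'' x ->
  'd (transition c' c'') (cmap c' x) ('d (transition c c') (cmap c x) v) =
  'd (transition c c'') (cmap c x) v.
Proof.
move=> ac ac' ac'' cx c'x c''x.
have d1 := differentiable_transition ac ac' cx c'x.
have d2 : differentiable (transition c' c'') (transition c c' (cmap c x)).
  by rewrite /transition /= cmapK //; exact: differentiable_transition.
have E : \forall a \near cmap c x, transition c' c'' (transition c c' a) = transition c c'' a.
  have := near_cmap cx (near_cdom c'x); apply: filterS => a [ca c'a].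
  by rewrite /transition /= cmapK.
have -> : cmap c' x = transition c c' (cmap c x) by rewrite /transition /= cmapK.
by apply: esym; apply: diff_comp_near.
Qed.

Lemma diff_transition_id c x (v : V) : atlas c -> cdom c x ->
  'd (transition c c) (cmap c x) v = v.
Proof.
move=> ac cx.
have E : \forall a \near cmap c x, id a = transition c c a.
  have := near_cmap cx (near_cdom cx); apply: filterS => a [ca _].
  by rewrite /transition /= cinvK.
have [d E1] := is_diff_id (cmap c x).
have [_ E2] := @diff_near R V V _ _ (cmap c x) E d.
exact: etrans (congr1 (fun h : V -> V => h v) E2) (congr1 (fun h : V -> V => h v) E1).
Qed.

Lemma atlas_chart_at x : atlas (chart_at x).
Proof. by rewrite /chart_at; case: cid => c /= []. Qed.

Lemma cdom_chart_at x : cdom (chart_at x) x.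
Proof. by rewrite /chart_at; case: cid => c /= []. Qed.

Lemma tvec_pointK c x (y : V) : atlas c -> cdom c x ->
  tvec_coord c (tvec_point c x y) = y.
Proof.
move=> ac cx; have ax := atlas_chart_at x; have dx' := cdom_chart_at x.
exact: etrans (diff_transition_comp y ac ax ac cx dx' cx) (diff_transition_id y ac cx).
Qed.

Lemma tvec_coordK c x (v : tangent x) : atlas c -> cdom c x ->
  tvec_point c x (tvec_coord c v) = v.
Proof.
move=> ac cx.
have ax := atlas_chart_at x; have dx' := cdom_chart_at x.
exact: etrans (diff_transition_comp v ax ac ax dx' cx dx') (diff_transition_id v ax dx').
Qed.

Lemma tvec_coord_point c c' x (y : V) : atlas c -> atlas c' -> cdom c x -> cdom c' x ->
  tvec_coord c' (tvec_point c x y) = 'd (transition c c') (cmap c x) y.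
Proof.
move=> ac ac' cx c'x.
exact: (diff_transition_comp y ac (atlas_chart_at x) ac' cx (cdom_chart_at x) c'x).
Qed.

Lemma TVec_eq x x' (v v' : V) : x = x' -> v = v' -> @TVec R n M x v = @TVec R n M x' v'.
Proof. by move=> -> ->. Qed.

Lemma tcoordK c (p : tangent_bundle M) : atlas c -> cdom c (base p) -> tpoint c (tcoord c p) = p.
Proof.
case: p => x v /= ac cx; apply: TVec_eq => /=; first by rewrite cmapK.
by rewrite cmapK // tvec_coordK.
Qed.

Lemma tvec_coord0 c x : tvec_coord c ((0 : V) : tangent x) = 0.
Proof. exact: linear0. Qed.

Lemma tvec_point0 c x : tvec_point c x (0 : V) = (0 : V).
Proof. exact: linear0. Qed.

Lemma tcoord_img_slit c : atlas c -> tcoord_img (@slit R n M) c = slit_over (cimg c).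
Proof.
move=> ac; apply/seteqP; split => -[a y] /= [ca sa]; split => //=; move: sa; rewrite /slit /=.
  by apply: contra_neq => ->; rewrite tvec_point0.
move=> y0; apply: contra_neq y0 => E.
by rewrite -(@tvec_pointK c (cinv c a) y) ?E ?tvec_coord0 //; exact: cinv_dom.
Qed.

Lemma slit_tcoord c (p : tangent_bundle M) : atlas c -> cdom c (base p) ->
  slit p -> slit_over (cimg c) (tcoord c p).
Proof.
move=> ac cp sp; rewrite -tcoord_img_slit //; split; first exact: cimg_cmap.
by rewrite tcoordK.
Qed.

Lemma near_base (I W : topologicalType) (e0 : I) (w0 : W) c (q : V * V) (A : set M) :
  cimg c q.1 -> nbhs (cinv c q.1) A ->
  \forall t \near (e0, (w0, q)), cimg c t.2.2.1 /\ A (cinv c t.2.2.1).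
Proof.
move=> ca nA.
have N : \forall a \near q.1, cimg c a /\ A (cinv c a).
  by rewrite -{1}(cinvK ca); apply: near_cmap => //; exact: cinv_dom.
have c221 : {for (e0, (w0, q)), continuous (fun t : I * (W * (V * V)) => t.2.2.1)}.
  exact: (@cts_comp _ _ _ (fun t : I * (W * (V * V)) => t.2.2) fst (e0, (w0, q)) (@cts_22 _ _ _ _) (@cts_fst _ _ _)).
exact: (c221 _ N).
Qed.

Lemma scv_fst (I W : topologicalType) k (e0 : I) (w0 : W) (q : V * V) (g : V -> R) :
  scv k e0 w0 q.1 (fun _ _ => g) -> scv k e0 w0 q (fun _ _ p => g p.1).
Proof.
move=> hg; apply: (scv_comp_row (c := fun _ _ p => p.1) (h := fun _ _ => g)) => // i.
exact: scv_fst_coord.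
Qed.

Definition ttransition c c' (q : V * V) : V * V :=
  (transition c c' q.1, 'd (transition c c') (q.1) (q.2)).

Lemma tcoord_tpoint c c' (q : V * V) : atlas c -> atlas c' -> cimg c q.1 -> cdom c' (cinv c q.1) ->
  tcoord c' (tpoint c q) = ttransition c c' q.
Proof.
case: q => a y ac ac' ca c'a; rewrite /tcoord /ttransition /=; congr (_, _).
by rewrite tvec_coord_point ?cinvK //; exact: cinv_dom.
Qed.

(** The fibre part of a change of natural coordinates is linear in [y] with the partial derivatives
    of the base transition as coefficients; once expanded in the basis, it involves fixed directions
    only. *)
Lemma scv_ttransition c c' (I W : topologicalType) k (e0 : I) (w0 : W) (q : V * V)
    (f : I -> W -> V * V -> R) :
  atlas c -> atlas c' -> cimg c q.1 -> cdom c' (cinv c q.1) ->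
  scv k e0 w0 (ttransition c c' q) f ->
  scv k e0 w0 q (fun e w p => f e w (ttransition c c' p)).
Proof.
move=> ac ac' ca c'a hf.
have cq := cinv_dom ca.
have st m : scv m e0 w0 q.1 (fun _ _ => transition c c').
  by rewrite -(cinvK ca); exact: scv_transition.
apply: (scv_comp_pair (c := fun _ _ p => transition c c' p.1)
  (d := fun _ _ p => 'd (transition c c') (p.1) (p.2)) (h := f)) => // i.
  apply: (scv_fst (g := fun a => transition c c' a 0 i)).
  exact: (scv_coord i (f := fun _ _ => transition c c')).
apply: (scv_eq (f := fun _ _ (p : V * V) => \sum_j p.2 0 j * 'D_(delta_mx 0 j) (transition c c') (p.1) 0 i)).
  have N := near_base e0 w0 ca (near_cdom c'a).
  move: N; apply: filterS => -[e [w [a y]]] /= [ca' c'a'].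
  have d : differentiable (transition c c') a.
    by rewrite -(cinvK ca'); apply: differentiable_transition => //; exact: cinv_dom.
  rewrite [in RHS](row_sum_delta y) linear_sum summxE; apply: eq_bigr => j _.
  by rewrite linearZ mxE deriveE.
apply: scv_sum => j _; apply: scvM; first exact: scv_snd_coord.
apply: (scv_fst (g := fun a => 'D_(delta_mx 0 j) (transition c c') a 0 i)).
apply: (scv_coord i (f := fun _ _ => 'D_(delta_mx 0 j) (transition c c'))).
exact: (scv_derive (f := fun _ _ => transition c c')).
Qed.

End Charts.

Section FinslerCharts.
Variables (R : realType) (n : nat) (M : smooth_manifold R n).
Notation V := 'rV[R]_n.
Variable F : tangent_bundle M -> R.
Hypothesis hF : is_finsler F.

(** With factor 2, homogeneity at the zero vector reads F(0) = 2 F(0). *)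
Lemma finsler0 x : F (@TVec R n M x (0 : V)) = 0.
Proof.
have [_ /(_ x) [_ h _]] := hF; have := h 2 0 (ltr0Sn _ 1); rewrite scaler0 => E; lra.
Qed.

Lemma finsler_homogeneous c : atlas c -> homogeneous (cimg c) (local_expr F c).
Proof.
move=> ac; have [sF hx] := hF; split.
- by rewrite -tcoord_img_slit //; exact: sF.
- move=> x w m _ m0; rewrite /local_expr /tpoint /=.
  have [_ h _] := hx (cinv c x); rewrite -(h m (tvec_point c (cinv c x) w)) //.
  by congr F; apply: TVec_eq => //; rewrite /tvec_point linearZ.
- move=> x _; rewrite /local_expr /tpoint /= tvec_point0; exact: finsler0.
Qed.

End FinslerCharts.

Lemma smooth_on_sub (R : realType) (V W : normedModType R) (A B : set V) (f : V -> W) :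
  A `<=` B -> smooth_on B f -> smooth_on A f.
Proof.
move=> AB sf k; have := sf k; move=> {sf}; move: f; elim: k => [|k IH] f /=; first by move=> h x /AB/h.
by move=> [h1 h2]; split => [x /AB/h1 //|v]; exact/IH/h2.
Qed.

Lemma homogeneous_sub (R : realType) n (A B : set 'rV[R]_n) f :
  A `<=` B -> homogeneous B f -> homogeneous A f.
Proof.
move=> AB [h1 h2 h3]; split.
- by apply: smooth_on_sub h1 => -[x y] /= [/AB].
- by move=> x w m /AB; exact: h2.
- by move=> x /AB; exact: h3.
Qed.

(** * Euclidean norm, radii of the unit spheres and local smoothing *)

Section EuclideanNorm.
Variables (R : realType) (n : nat).
Implicit Types x y : 'rV[R]_n.

Lemma enormZ (m : R) x : enorm (m *: x) = `|m| * enorm x.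
Proof.
rewrite /enorm (_ : \sum_i _ = m ^+ 2 * \sum_i x 0 i ^+ 2).
  by rewrite sqrtrM ?sqr_ge0 // sqrtr_sqr.
by rewrite mulr_sumr; apply: eq_bigr => i _; rewrite mxE exprMn.
Qed.

Lemma coord_le_enorm x i : `|x 0 i| <= enorm x.
Proof.
rewrite /enorm -sqrtr_sqr ler_wsqrtr // (bigD1 i) //= lerDl.
by apply: sumr_ge0 => j _; exact: sqr_ge0.
Qed.

Lemma norm_le_enorm x : `|x| <= enorm x.
Proof. by apply: rV_norm_le => [|i]; [exact: sqrtr_ge0|exact: coord_le_enorm]. Qed.

Lemma enorm_gt0 x : x != 0 -> 0 < enorm x.
Proof. by move=> x0; apply: lt_le_trans (norm_le_enorm x); rewrite normr_gt0. Qed.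

End EuclideanNorm.

Section SmoothingBounds.
Variables (R : realType) (n : nat) (M : smooth_manifold R n).
Notation V := 'rV[R]_n.
Variable F : tangent_bundle M -> R.
Hypothesis hF : is_finsler F.
Variables (c : chart R n M) (U : set M).
Hypothesis ac : atlas c.
Hypothesis Uc : closure U `<=` cdom c.
Hypothesis b0 : 0 < smoothing_bound F c U.

Let r := radius_max F c U.
Let s := radius_min F c U.

Let r0 : r != 0.
Proof. by apply: contraTneq b0 => E; rewrite /smoothing_bound -/r E mulr0 invr0 mulr0 ltxx. Qed.

Let s0 : s != 0.
Proof. by apply: contraTneq b0 => E; rewrite /smoothing_bound -/s E mul0r ltxx. Qed.

(** Positivity of the bound makes the two radii nonzero and of the same sign; it also excludes
    dimension 0, where the bound is 0. *)
Lemma radius_ratio_gt0 : 0 < 2 * radius_max F c U / radius_min F c U.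
Proof.
have n0 : (0 : R) < 16 * n%:R.
  rewrite mulr_gt0 // lt_neqAle ler0n andbT eq_sym; apply: contraTneq b0 => E.
  by rewrite /smoothing_bound E mulr0 mul0r invr0 mulr0 ltxx.
have : 0 < s / r.
  have -> : s / r = (16 * n%:R) * smoothing_bound F c U.
    rewrite /smoothing_bound -/s -/r; move: n0; move: (n%:R : R) => m m0.
    by field; rewrite r0 /= -[m]mulr1; apply/eqP => E; move: m0; nra.
  by rewrite mulr_gt0.
by rewrite -invr_gt0 invf_div => h; rewrite -mulrA mulr_gt0.
Qed.

(** No sign of [F] is given. On the Euclidean unit sphere its values lie between the two radii,
    which have the same sign, so they share that sign; homogeneity extends this to all nonzero
    vectors. *)
Lemma radius_div_gt0 (x y : V) : (cmap c @` U) x -> y != 0 ->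
  0 < radius_max F c U / local_expr F c x y.
Proof.
move=> Ax y0.
(* By convention [sup] and [inf] are 0 for a set that has none, so nonzero radii are genuine
   bounds. *)
have hr : has_sup (sphere_values F c U).
  by apply: contra_neqP r0 => /sup_out.
have hs : has_inf (sphere_values F c U).
  by apply: contra_neqP s0 => /inf_out.
have e0 := enorm_gt0 y0.
pose y' := (enorm y)^-1 *: y.
have y'1 : enorm y' = 1 by rewrite enormZ ger0_norm ?invr_ge0 ?ltW // mulVf // gt_eqF.
have Sv : sphere_values F c U (local_expr F c x y').
  exists x; last by exists y'.
  by case: Ax => p Up <-; exists p => //; exact: subset_closure.
have Ur : local_expr F c x y' <= r by apply: ub_le_sup Sv; case: hr.
have Us : s <= local_expr F c x y' by apply: ge_inf Sv; case: hs.
have [_ hh _] := finsler_homogeneous hF ac.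
have cx : cimg c x by case: Ax => p Up <-; exists p => //; apply: Uc; exact: subset_closure.
have -> : local_expr F c x y = enorm y * local_expr F c x y'.
  by rewrite hh ?invr_gt0 // mulrA divff ?mul1r // gt_eqF.
suff : 0 < r / local_expr F c x y' by move=> h; rewrite invfM mulrCA mulr_gt0 ?invr_gt0.
have rs : 0 < r / s.
  by have := radius_ratio_gt0; rewrite -mulrA pmulr_rgt0.
have [rp|rn|E] := ltrgtP r 0.
- have : s < 0 by rewrite ltNge; apply/negP => sp; move: rs; rewrite ltNge mulr_le0_ge0 ?invr_ge0 // ltW.
  by move=> sn; rewrite -mulrNN -invrN divr_gt0 ?oppr_gt0 // (le_lt_trans Ur).
- have : 0 < s by rewrite ltNge; apply/negP => sp; move: rs; rewrite ltNge mulr_ge0_le0 ?invr_le0 // ltW.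
  by move=> sp; rewrite divr_gt0 // (lt_le_trans sp).
- by move: r0; rewrite E eqxx.
Qed.

End SmoothingBounds.

(** Compactness gives one radius [d] such that the balls of radius [d] centred in [K] stay inside
    [A], while the frontier of the open set [A] misses [A]. An empty frontier gives the distance
    +oo. *)
Lemma euclid_dist_frontier_gt0 (R : realType) n (A V K : set 'rV[R]_n) :
  open A -> compact K -> V `<=` K -> K `<=` A ->
  (0 < euclid_dist (frontier V) (frontier A))%E.
Proof.
move=> oA cK VK KA.
have clK : closed K by apply: compact_closed => //; exact: norm_hausdorff.
have : \forall d \near 0^'+, K `<=` [set a | ball a d `<=` A].
  move/compact_near_coveringP : cK; apply => a Ka.
  have nA : nbhs a A by apply: open_nbhs_nbhs; split => //; exact: KA.
  have /nbhs_ballP[d /= d0 dA] := nA.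
  have d2 : 0 < d / 2 by rewrite divr_gt0.
  exists (ball a (d / 2), [set e | 0 < e < d / 2]) => /=.
    split; first exact: nbhsx_ballx.
    have h1 : \forall e \near (0 : R)^'+, 0 < e by exact: nbhs_right_gt.
    have h2 : \forall e \near (0 : R)^'+, e < d / 2 by exact: nbhs_right_lt.
    by move: h1 h2; apply: filterS2 => e e0 e2; apply/andP.
  move=> [a' e] /= [ba /andP[e0 e2]] z bz; apply: dA.
  apply: (@le_ball _ _ _ (d / 2 + e)); first by lra.
  exact: ball_triangle ba bz.
move=> /(filterI (nbhs_right_gt 0)) H.
have [d [d0 dA]] : exists d : R, 0 < d /\ K `<=` [set a | ball a d `<=` A].
  by have /filter_ex[d [? ?]] := H; exists d.
apply: (@lt_le_trans _ _ d%:E); first by rewrite lte_fin.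
apply: le_ereal_inf_tmp => _ [a [Va _]] [z [_ zA]] <-; rewrite lee_fin.
have Ka : K a by rewrite (closure_id K).1 //; exact: closure_subset Va.
apply: le_trans (norm_le_enorm _); rewrite leNgt; apply/negP => h.
have Az : A z by apply: (dA a Ka); rewrite -ball_normE.
by apply: zA; move: oA; rewrite openE; exact.
Qed.

Section LocalSmoothing.
Variables (R : realType) (n : nat) (M : smooth_manifold R n).
Notation V := 'rV[R]_n.
Variables (F : tangent_bundle M -> R) (S : smoothing_data M).
Hypothesis hF : is_finsler F.
Hypothesis hS : valid_smoothing_data F S.
Variable l : sd_index S.
Let c := sd_chart l.
Let U := sd_U l.

Lemma sd_atlas : atlas c.
Proof. by have [[/(_ l)[]]] := hS. Qed.

Lemma sd_subset_cdom : U `<=` cdom c.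
Proof. have [[/(_ l)[_ _ _ h] _ _] _ _ _] := hS; exact: subset_trans (@subset_closure _ _) h. Qed.

Lemma sd_open : open U.
Proof. by have [[/(_ l)[_ h _ _]]] := hS. Qed.

Lemma sd_support_subset : closed_support (sd_phi l) `<=` U.
Proof. by have [_ [_ _ /(_ l)]] := hS. Qed.

Lemma sd_imageE : cmap c @` U = cmap c @` (cdom c `&` U).
Proof. by rewrite setIidr //; exact: sd_subset_cdom. Qed.

Lemma sd_image_open : open (cmap c @` U).
Proof. by rewrite sd_imageE; apply: open_cmap_image; exact: sd_open. Qed.

Lemma sd_image_subset : cmap c @` U `<=` cimg c.
Proof. by move=> _ [x Ux <-]; apply: cimg_cmap; exact: sd_subset_cdom. Qed.

Lemma sd_bound_gt0 : 0 < smoothing_bound F c U.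
Proof. by have [_ _ /(_ l)[_ _ _ /andP[t0 tb] _] _] := hS; exact: lt_trans tb. Qed.

Lemma sd_delta_gt0 : 0 < sd_delta l.
Proof.
have [_ _ /(_ l)[_ _ _ /andP[t0 _] _] _] := hS.
have [[/(_ l)[_ oU cU Uc] _ _] _ _ _] := hS.
have cS : compact (closed_support (sd_phi l)).
  apply: subclosed_compact cU _; first exact: closed_closure.
  by move=> x /sd_support_subset; exact: subset_closure.
have nu0 : (0 < sd_nu l)%E.
  apply: (@euclid_dist_frontier_gt0 _ _ _ _ (cmap c @` closed_support (sd_phi l))).
  - exact: sd_image_open.
  - apply: continuous_compact cS; apply: continuous_in_subspaceT => x.
    by rewrite inE => /sd_support_subset /sd_subset_cdom; exact: cmap_continuous.
  - by apply: image_subset; exact: interior_subset.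
  - by apply: image_subset; exact: sd_support_subset.
(* When the distance is +oo the minimum is the finite number [sd_tau l], so [fine] loses nothing. *)
rewrite /sd_delta; move: nu0; case: (sd_nu l) => [v||] //=.
  by rewrite -EFin_min /= lte_fin lt_min t0.
by move=> _; rewrite minEle leey.
Qed.

Theorem scv_local_smoothing (W : topologicalType) (w1 : W) k (x0 y0 : V) :
  (cmap c @` U) x0 -> y0 != 0 ->
  scv k (0 : R) w1 (x0, y0) (fun e _ p =>
    if 0 < e then local_smoothing l e p.1 p.2 ^+ 2 else local_expr F c p.1 p.2 ^+ 2).
Proof.
move=> Ax y0n; have [[/(_ l)[_ oU cU Uc] _ _] _ /(_ l)[_ _ u0 /andP[t0 _] _] /(_ l) GP] := hS.
have hL := homogeneous_sub sd_image_subset (finsler_homogeneous hF sd_atlas).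
apply: (scv_base_convolution (u := sd_u l) (tau := sd_tau l) sd_image_open hL
  (radius_ratio_gt0 sd_bound_gt0) u0 t0 (r := radius_max F c U)) => //.
- by move=> x y; apply: (radius_div_gt0 hF sd_atlas Uc sd_bound_gt0).
- exact: sd_delta_gt0.
Qed.

End LocalSmoothing.

(** * Gluing *)

Section GlobalSmoothing.
Variables (R : realType) (n : nat) (M : smooth_manifold R n).
Notation V := 'rV[R]_n.
Variables (F : tangent_bundle M -> R) (F_ : R -> tangent_bundle M -> R).
Hypothesis hF : is_finsler F.
Variable S : smoothing_data M.
Hypothesis hS : valid_smoothing_data F S.
Hypothesis FE : forall e : R, 0 < e < 1 -> forall p, 0 <= F_ e p /\
  F_ e p ^+ 2 = \sum_(l \in [set: sd_index S]) sd_phi l (base p) *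
    (let q := tcoord (sd_chart l) p in local_smoothing l e q.1 q.2) ^+ 2.

Definition square_family c (e : R) (q : V * V) : R :=
  if 0 < e then local_expr (F_ e) c q.1 q.2 ^+ 2 else local_expr F c q.1 q.2 ^+ 2.

Variable c : chart R n M.
Hypothesis ac : atlas c.
Variable q0 : V * V.
Hypothesis cq0 : cimg c q0.1.
Hypothesis yq0 : q0.2 != 0.

Let summand (l : sd_index S) (e : R) (q : V * V) : R :=
  sd_phi l (cinv c q.1) *
  (if 0 < e then (let q' := tcoord (sd_chart l) (tpoint c q) in local_smoothing l e q'.1 q'.2) ^+ 2
   else local_expr F c q.1 q.2 ^+ 2).

Let x0 := cinv c q0.1.

(** If [x0] is outside the closed support of the cut-off, the summand vanishes near it; otherwise
    [x0] lies in [sd_U l], and the local convergence is transported through the change of natural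
    coordinates. *)
Let scv_summand (W : topologicalType) (w1 : W) k l : scv k (0 : R) w1 q0 (fun e _ => summand l e).
Proof.
have [x0l|x0l] := pselect (closed_support (sd_phi l) x0); last first.
  have N : nbhs x0 (~` closed_support (sd_phi l)).
    by apply: open_nbhs_nbhs; split => //; apply: closed_openC; exact: closed_closure.
  apply: (scv_eq (f := fun _ _ _ => (0 : R))); last exact: (@scv_cst _ _ _ _ R^o).
  have N' := near_base (0 : R) w1 cq0 N; move: N'; apply: filterS => t [_ h].
  rewrite /summand; have -> : sd_phi l (cinv c t.2.2.1) = 0; last by rewrite mul0r.
  by apply: contra_notP h => /eqP h; exact: subset_closure.
set c' := sd_chart l; have ac' : atlas c' by exact: (sd_atlas hS).
have Ux0 : sd_U l x0 by exact: (sd_support_subset hS).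
have c'x0 : cdom c' x0 by exact: (sd_subset_cdom hS).
have sphi : scv k (0 : R) w1 q0 (fun _ _ p => sd_phi l (cinv c p.1)).
  apply: (scv_fst (g := fun a => sd_phi l (cinv c a))).
  have [_ [sp _ _ _] _ _] := hS.
  by apply: (scv_smooth (A := cimg c)) => //; [exact: cimg_open|exact: (sp l c ac)].
have A0 : (cmap c' @` sd_U l) (ttransition c c' q0).1.
  by exists x0.
have sl0 : slit_over (cimg c) q0 by [].
rewrite -tcoord_img_slit // in sl0; have h := slit_tcoord ac' (p := tpoint c q0) c'x0 sl0.2.
rewrite tcoord_tpoint // in h.
have sl : scv k (0 : R) w1 (ttransition c c' q0) (fun e _ p =>
    if 0 < e then local_smoothing l e p.1 p.2 ^+ 2 else local_expr F c' p.1 p.2 ^+ 2).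
  rewrite [ttransition c c' q0]surjective_pairing.
  apply: (scv_local_smoothing hF hS w1 k A0); case: h => _ h2; exact: h2.
have := scvM sphi (scv_ttransition ac ac' cq0 c'x0 sl); apply: scv_eq.
have N := near_base (0 : R) w1 cq0 (near_cdom c'x0); move: N; apply: filterS => t [ct c't].
rewrite /summand -/c' tcoord_tpoint //=; congr (_ * _); case: ifP => // _.
have E : tpoint c' (ttransition c c' t.2.2) = tpoint c t.2.2 by rewrite -tcoord_tpoint // tcoordK.
exact: (congr1 (fun p => F p ^+ 2) E).
Qed.

(** Local finiteness replaces the sum over all indices by a fixed finite sum near [x0]. For [e <= 0]
    this sum is the square of [F] because the partition of unity adds up to 1. *)
Lemma scv_square_family (W : topologicalType) (w1 : W) k :
  scv k (0 : R) w1 q0 (fun e _ => square_family c e).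
Proof.
have [[_ _ /(_ x0)[B nB finB]] [_ _ supU sum1] _ _] := hS.
set J := [set l | _] in finB.
have sumJ x (g : sd_index S -> R) : B x ->
    \sum_(l \in [set: sd_index S]) sd_phi l x * g l = \sum_(l <- fset_set J) sd_phi l x * g l.
  move=> Bx; rewrite -fsbig_finite //; apply/esym/fsbig_widen => // l [_ Jl] /=.
  have -> : sd_phi l x = 0; last by rewrite mul0r.
  apply: contra_notP Jl => /eqP h; exists x; split => //.
  by apply: supU; exact: subset_closure.
have sJ : scv k (0 : R) w1 q0 (fun e _ q => \sum_(l <- fset_set J) summand l e q).
  by apply: scv_sum => l _; exact: scv_summand.
apply: scv_eq sJ.
have N := near_base (0 : R) w1 cq0 nB.
have N1 : \forall t \near ((0 : R), (w1, q0)), t.1 < 1 := @cts_fst _ _ ((0 : R), (w1, q0)) _ (lt_nbhsl ltr01).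
move: N N1; apply: filterS2 => -[e [w q]] /= [cq Bq] e1.
rewrite /square_family; case: ifP => e0.
  have [_ ->] := FE (e := e) ltac:(by rewrite e0 e1) (tpoint c (q.1, q.2)).
  rewrite sumJ //=; apply: eq_bigr => l _.
  by rewrite /summand e0.
transitivity (\sum_(l <- fset_set J) sd_phi l (cinv c q.1) * local_expr F c q.1 q.2 ^+ 2).
  by apply: eq_bigr => l _; rewrite /summand e0.
rewrite -mulr_suml.
have := sumJ (cinv c q.1) (fun _ => 1) Bq; under eq_fsbigr do rewrite mulr1.
rewrite sum1 (eq_bigr (fun l => sd_phi l (cinv c q.1))) => [<-|l _]; by rewrite ?mul1r ?mulr1.
Qed.

End GlobalSmoothing.

(** * Finsler tensors *)

Section Hessian.
Variables (R : realType) (n : nat).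
Notation V := 'rV[R]_n.

(** Linearity of [T] makes the two difference quotients the same function of the increment. *)
Lemma derive_comp_linear (f : V -> R) (T : V -> V) (v y : V) : linear T ->
  'D_v (fun z => f (T z)) y = 'D_(T v) f (T y).
Proof.
move=> lT; rewrite /derive; set g := (X in lim (X @ _) = _); set h := (X in _ = lim (X @ _)).
suff -> : g = h by [].
by apply/funext => s; rewrite /g /h /= lT.
Qed.

Lemma derive_sum_basis (f : V -> R) (v y : V) : differentiable f y ->
  'D_v f y = \sum_i v 0 i * 'D_(delta_mx 0 i) f y.
Proof.
move=> df; rewrite deriveE // [in LHS](row_sum_delta v) linear_sum.
by apply: eq_bigr => i _; rewrite linearZ deriveE.
Qed.

(** Iterated derivatives along [v] give a coordinate-free form of the Hessian, which can be
    transported by a linear map. *)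
Lemma hessian_quadratic (N : V -> R) (v y : V) : smooth_on [set y | y != 0] N -> y != 0 ->
  (v *m hessian_half_sq N y *m v^T) 0 0 = 2^-1 * 'D_v ('D_v (fun z => N z ^+ 2)) y.
Proof.
move=> sN y0; set P := fun z => N z ^+ 2.
have oS : open [set y : V | y != 0].
  have -> : [set y : V | y != 0] = ~` [set 0].
    by apply/seteqP; split => y' /= /eqP.
  exact/closed_openC/accessible_closed_set1/hausdorff_accessible/norm_hausdorff.
have sP k : scv k (0 : R) (0 : R) y (fun _ _ => P).
  exact: (scvX 2 (f := fun _ _ => N) (scv_smooth _ _ _ oS y0 sN)).
have nd : \forall z \near y, differentiable P z.
  have ci : {for y, continuous (fun z : V => ((0 : R), ((0 : R), z)))}.
    by apply: cts_pair; [exact: cts_cst|apply: cts_pair; [exact: cts_cst|exact: cts_id]].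
  exact: (ci _ (scv_diff (sP 1%N))).
have dd i : differentiable ('D_(delta_mx 0 i) P) y.
  exact: (nbhs_singleton (scv_diff (scv_derive (delta_mx 0 i) (sP 2%N)))).
have E : \forall z \near y, \sum_i v 0 i * 'D_(delta_mx 0 i) P z = 'D_v P z.
  by move: nd; apply: filterS => z /derive_sum_basis ->.
have ds i : differentiable (fun z => v 0 i * 'D_(delta_mx 0 i) P z) y.
  exact: (@differentiableZ _ _ _ _ (v 0 i) _ (dd i)).
rewrite -(near_eq_derive v E) derive_bigsum //.
rewrite mxE; under eq_bigr do rewrite mxE mulr_suml.
rewrite exchange_big mulr_sumr; apply: eq_bigr => i _ /=.
rewrite (derive_sum_basis v (ds i)) mulr_sumr; apply: eq_bigr => j _.
have -> : 'D_(delta_mx 0 j) (fun z => v 0 i * 'D_(delta_mx 0 i) P z) y =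
    v 0 i * 'D_(delta_mx 0 j) ('D_(delta_mx 0 i) P) y.
  by rewrite (@deriveZ _ _ _ ('D_(delta_mx 0 i) P)) //; exact: diff_derivable.
rewrite !mxE -/P; ring.
Qed.

(** Positive definiteness is given in the components of [chart_at], whereas the tensors use those of
    an arbitrary chart; the linear map [T] between the fibres carries one to the other. *)
Lemma hessian_comp_linear (N : V -> R) (T : V -> V) (v y : V) : linear T ->
  smooth_on [set y | y != 0] N -> smooth_on [set y | y != 0] (fun z => N (T z)) ->
  y != 0 -> T y != 0 ->
  (v *m hessian_half_sq (fun z => N (T z)) y *m v^T) 0 0 =
  (T v *m hessian_half_sq N (T y) *m (T v)^T) 0 0.
Proof.
move=> lT sN sNT y0 Ty0.
have E1 := hessian_quadratic v sNT y0; have E2 := hessian_quadratic (T v) sN Ty0.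
have E3 : 'D_v (fun z => N (T z) ^+ 2) = (fun z => 'D_(T v) (fun z => N z ^+ 2) (T z)).
  by apply/funext => z; exact: (derive_comp_linear (fun z => N z ^+ 2)).
have E4 := derive_comp_linear ('D_(T v) (fun z => N z ^+ 2)) v y lT.
rewrite E3 E4 -E2 in E1; exact: E1.
Qed.

End Hessian.

Section Determinant.
Variables (R : realType) (I W : topologicalType) (Z : normedModType R).
Variables (e0 : I) (w0 : W) (z0 : Z).

Lemma scv_det m k (A : I -> W -> Z -> 'M[R]_m) :
  (forall i j, scv k e0 w0 z0 (fun e w z => A e w z i j)) ->
  scv k e0 w0 z0 (fun e w z => \det (A e w z)).
Proof.
move=> hA; apply: scv_sum => s _; apply: scvM; first exact: (@scv_cst _ _ _ _ R^o).
by apply: scv_prod => i _; exact: hA.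
Qed.

(** Cramer's rule: the determinant stays nonzero near the limit, so there [invmx] is the adjugate,
    polynomial in the entries, divided by it. *)
Lemma scv_invmx m k (A : I -> W -> Z -> 'M[R]_m) :
  \det (A e0 w0 z0) != 0 ->
  (forall i j, scv k e0 w0 z0 (fun e w z => A e w z i j)) ->
  forall i j, scv k e0 w0 z0 (fun e w z => invmx (A e w z) i j).
Proof.
move=> d0 hA i j; have sd := scv_det hA.
have sc : scv k e0 w0 z0 (fun e w z => cofactor (A e w z) j i).
  apply: scvM; first exact: (@scv_cst _ _ _ _ R^o).
  apply: (scv_det (A := fun e w z => row' j (col' i (A e w z)))) => a b.
  by apply: scv_eq (hA (lift j a) (lift i b)); near=> t; rewrite !mxE.
have := scvM (scvV d0 sd) sc; apply: scv_eq.
have N : \forall t \near (e0, (w0, z0)), \det (A t.1 t.2.1 t.2.2) != 0.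
  exact: (cvgr_neq0 _ (scv_cts sd) d0).
move: N; apply: filterS => t dt.
by rewrite /invmx unitmxE unitfE dt !mxE.
Unshelve. all: by end_near. Qed.

End Determinant.

Section TensorFamilies.
Variables (R : realType) (n : nat).
Notation V := 'rV[R]_n.
Variables (q0 : V * V) (L : R -> V -> V -> R).

(** All orders are kept at once, since the tensors are built by repeated differentiation; the second
    parameter of [scv] is a dummy. *)
Definition smooth_family (f : R -> V -> V -> R) : Prop :=
  forall k, scv k (0 : R) (0 : R) q0 (fun e _ q => f e q.1 q.2).

Lemma smooth_familyM f g : smooth_family f -> smooth_family g ->
  smooth_family (fun e x y => f e x y * g e x y).
Proof. by move=> hf hg k; apply: scvM; [exact: hf|exact: hg]. Qed.

Lemma smooth_familyD f g : smooth_family f -> smooth_family g ->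
  smooth_family (fun e x y => f e x y + g e x y).
Proof. by move=> hf hg k; apply: scvD; [exact: hf|exact: hg]. Qed.

Lemma smooth_familyB f g : smooth_family f -> smooth_family g ->
  smooth_family (fun e x y => f e x y - g e x y).
Proof. by move=> hf hg k; apply: scvB; [exact: hf|exact: hg]. Qed.

Lemma smooth_family_sum (J : finType) (f : J -> R -> V -> V -> R) :
  (forall j, smooth_family (f j)) -> smooth_family (fun e x y => \sum_j f j e x y).
Proof. by move=> hf k; apply: scv_sum => j _; exact: hf. Qed.

Lemma smooth_family_cst (a : R) : smooth_family (fun _ _ _ => a).
Proof. by move=> k; exact: (@scv_cst _ _ _ _ R^o). Qed.

Lemma smooth_family_coord i : smooth_family (fun _ _ y => y 0 i).
Proof. by move=> k; exact: scv_snd_coord. Qed.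

Lemma dxE j (f : V -> V -> R) q : 'D_(delta_mx 0 j, 0) (fun q => f q.1 q.2) q = dx j f q.1 q.2.
Proof. by case: q => x y; rewrite /dx (derive_fst (fun q => f q.1 q.2)). Qed.

Lemma dyE j (f : V -> V -> R) q : 'D_(0, delta_mx 0 j) (fun q => f q.1 q.2) q = dy j f q.1 q.2.
Proof. by case: q => x y; rewrite /dy (derive_snd (fun q => f q.1 q.2)). Qed.

Lemma smooth_family_dx j f : smooth_family f -> smooth_family (fun e => dx j (f e)).
Proof.
move=> hf k; have := scv_derive (delta_mx 0 j, 0) (hf k.+1); apply: scv_eq.
by near=> t; exact: dxE.
Unshelve. all: by end_near. Qed.

Lemma smooth_family_dy j f : smooth_family f -> smooth_family (fun e => dy j (f e)).
Proof.
move=> hf k; have := scv_derive (0, delta_mx 0 j) (hf k.+1); apply: scv_eq.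
by near=> t; exact: dyE.
Unshelve. all: by end_near. Qed.

Hypothesis hL : smooth_family (fun e x y => L e x y ^+ 2).
Hypothesis det0 : \det (\matrix_(a, b) g_ (L 0) a b q0.1 q0.2) != 0.

Lemma smooth_family_g i j : smooth_family (fun e => g_ (L e) i j).
Proof.
apply: smooth_familyM; first exact: smooth_family_cst.
by do 2 apply: smooth_family_dy.
Qed.

Lemma smooth_family_g_inv i j : smooth_family (fun e => g_inv (L e) i j).
Proof.
move=> k; apply: (scv_invmx (A := fun e _ q => \matrix_(a, b) g_ (L e) a b q.1 q.2)) => // a b.
by apply: scv_eq (smooth_family_g a b k); near=> t; rewrite mxE.
Unshelve. all: by end_near. Qed.

Lemma smooth_family_C i j k : smooth_family (fun e => C_ (L e) i j k).
Proof.
apply: smooth_familyM; first exact: smooth_family_cst.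
by apply: smooth_family_dy; exact: smooth_family_g.
Qed.

Lemma smooth_family_C_up i j k : smooth_family (fun e => C_up (L e) i j k).
Proof.
apply: smooth_family_sum => s; apply: smooth_familyM; [exact: smooth_family_g_inv|exact: smooth_family_C].
Qed.

Lemma smooth_family_gamma i j k : smooth_family (fun e => gamma (L e) i j k).
Proof.
apply: smooth_familyM; first exact: smooth_family_cst.
apply: smooth_family_sum => s; apply: smooth_familyM; first exact: smooth_family_g_inv.
by apply: smooth_familyD; first apply: smooth_familyB; apply: smooth_family_dx; exact: smooth_family_g.
Qed.

Lemma smooth_family_sigma i : smooth_family (fun e => sigma (L e) i).
Proof.
apply: smooth_family_sum => j; apply: smooth_family_sum => k.
by apply: smooth_familyM; first apply: smooth_familyM;
  [exact: smooth_family_gamma|exact: smooth_family_coord|exact: smooth_family_coord].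
Qed.

Lemma smooth_family_N i j : smooth_family (fun e => N_ (L e) i j).
Proof.
apply: smooth_familyB; apply: smooth_family_sum => k.
  by apply: smooth_familyM; [exact: smooth_family_gamma|exact: smooth_family_coord].
apply: smooth_family_sum => r; apply: smooth_family_sum => s.
apply: smooth_familyM; last exact: smooth_family_coord.
apply: smooth_familyM; last exact: smooth_family_coord.
by apply: smooth_familyM; [exact: smooth_family_C_up|exact: smooth_family_gamma].
Qed.

Lemma smooth_family_Gamma l j k : smooth_family (fun e => Gamma (L e) l j k).
Proof.
have hCN a b c d : smooth_family (fun e x y => \sum_s C_ (L e) a b s x y * N_ (L e) s c x y).
  apply: smooth_family_sum => s.
  by apply: smooth_familyM; [exact: smooth_family_C|exact: smooth_family_N].
apply: smooth_familyB; first exact: smooth_family_gamma.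
apply: smooth_family_sum => i; apply: smooth_familyM; first exact: smooth_family_g_inv.
by apply: smooth_familyD; first apply: smooth_familyB; exact: hCN.
Qed.

Lemma smooth_family_A_dot i j k : smooth_family (fun e => A_dot (L e) i j k).
Proof.
apply: smooth_familyB; last exact: smooth_family_Gamma.
apply: smooth_familyM; first exact: smooth_family_cst.
by do 2 apply: smooth_family_dy; exact: smooth_family_sigma.
Qed.

Lemma cts_finsler_forms kind j i (Z : V * V -> V * V) :
  (forall a, scv 0 (0 : R) (0 : R) q0 (fun _ _ q => (Z q).1 0 a)) ->
  (forall a, scv 0 (0 : R) (0 : R) q0 (fun _ _ q => (Z q).2 0 a)) ->
  scv 0 (0 : R) (0 : R) q0 (fun e _ q => finsler_forms kind (L e) j i q (Z q)).
Proof.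
move=> Z1 Z2.
have hO : scv 0 (0 : R) (0 : R) q0 (fun e _ q => omega (L e) j i q (Z q)).
  apply: scv_sum => k _; exact: scvM (smooth_family_Gamma i j k 0) (Z1 k).
have hA : scv 0 (0 : R) (0 : R) q0 (fun e _ q => A_dot_form (L e) j i q (Z q)).
  apply: scv_sum => k _; exact: scvM (smooth_family_A_dot i j k 0) (Z1 k).
have hd k : scv 0 (0 : R) (0 : R) q0 (fun e _ q => delta_y (L e) k q (Z q)).
  apply: scvD (Z2 k) _; apply: scv_sum => s _; exact: scvM (smooth_family_N k s 0) (Z1 s).
have hC : scv 0 (0 : R) (0 : R) q0 (fun e _ q => C_form (L e) j i q (Z q)).
  apply: scv_sum => k _; exact: scvM (smooth_family_C_up i j k 0) (hd k).
case: kind; [exact: hO|exact: scvD hO hC|exact: scvD (scvD hO hC) hA|exact: scvD hO hA].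
Qed.

End TensorFamilies.

Section FinslerNondegenerate.
Variables (R : realType) (n : nat) (M : smooth_manifold R n).
Notation V := 'rV[R]_n.
Variable F : tangent_bundle M -> R.
Hypothesis hF : is_finsler F.
Variable c : chart R n M.
Hypothesis ac : atlas c.

Lemma fiber_smooth x : cimg c x -> smooth_on [set y | y != 0] (local_expr F c x).
Proof.
move=> cx; apply: (smooth_scv (e0 := (0 : R)) (w0 := (0 : R))) => y y0 k.
have [sL _ _] := finsler_homogeneous hF ac.
have sq : scv k (0 : R) (0 : R) (x, y) (fun _ _ p => local_expr F c p.1 p.2).
  apply: (scv_smooth _ _ _ _ _ sL); last by [].
  by apply: open_slit_over; exact: cimg_open.
apply: (scv_comp_pair (c := fun _ _ _ => x) (d := fun _ _ y => y) (h := fun _ _ p => local_expr F c p.1 p.2)) => //.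
  by move=> i; exact: (@scv_cst _ _ _ _ R^o).
move=> i; apply: (scv_coord i (f := fun _ _ (z : V) => z)).
by apply: (scv_lin _ _ _ _ (l := (idfun : {linear V -> V}))) => z; exact: cts_id.
Qed.

(** A kernel vector of the matrix would make the Hessian form vanish on its nonzero image in the
    fibre, against positive definiteness. *)
Lemma finsler_det_neq0 x y : cimg c x -> y != 0 ->
  \det (\matrix_(a, b) g_ (local_expr F c) a b x y) != 0.
Proof.
move=> cx y0; apply/negP => /det0P [v v0 vG].
pose T := tvec_point c (cinv c x).
have [_ /(_ (cinv c x)) [sN _ pN]] := hF.
have T0 w : w != 0 -> T w != 0.
  apply: contra_neq => Tw; rewrite -(@tvec_pointK _ _ _ c (cinv c x) w) //; last exact: cinv_dom.
  by rewrite -/T Tw tvec_coord0.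
have lT : linear T by move=> a u w; exact: linearP.
have E := hessian_comp_linear v lT sN (fiber_smooth cx) y0 (T0 y y0).
have := pN (T y) (T0 y y0) (T v) (T0 v v0).
rewrite -E (_ : hessian_half_sq _ y = \matrix_(a, b) g_ (local_expr F c) a b x y) //.
by rewrite vG mul0mx mxE ltxx.
Qed.

End FinslerNondegenerate.

Lemma cts_of_scv (R : realType) (Z Y : normedModType R) (f : Z -> Y) (z0 : Z) :
  scv 0 (0 : R) (0 : R) z0 (fun _ _ => f) -> {for z0, continuous f}.
Proof.
move=> /scv_cts c.
exact: (@cts_comp _ _ _ (fun z : Z => (0 : R, (0 : R, z))) (fun t => f t.2.2) z0
  (cts_pair (@cts_cst _ _ (0 : R) z0) (cts_pair (@cts_cst _ _ (0 : R) z0) (@cts_id _ z0))) c).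
Qed.

Lemma cts_slice (R : realType) (Z Y : normedModType R) (f : R -> Z -> Y) (z0 : Z) :
  scv 0 (0 : R) (0 : R) z0 (fun e _ => f e) -> {for (0 : R), continuous (fun e => f e z0)}.
Proof.
move=> /scv_cts c.
exact: (@cts_comp _ _ _ (fun e : R => (e, (0 : R, z0))) (fun t => f t.1 t.2.2) (0 : R)
  (cts_pair (@cts_id _ _) (cts_pair (@cts_cst _ _ (0 : R) _) (@cts_cst _ _ z0 _))) c).
Qed.

Lemma cts_open (S T : topologicalType) (f : S -> T) (x : S) (B : set T) :
  {for x, continuous f} -> open B -> B (f x) -> nbhs x (f @^-1` B).
Proof. by move=> cf oB Bx; apply: cf; exact: open_nbhs_nbhs. Qed.

(** * Topology of the tangent bundle *)

Section TangentTopology.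
Variables (R : realType) (n : nat) (M : smooth_manifold R n).
Notation V := 'rV[R]_n.
Implicit Types c : chart R n M.

Lemma ttransition_continuous c c' (q : V * V) : atlas c -> atlas c' -> cimg c q.1 ->
  cdom c' (cinv c q.1) -> {for q, continuous (ttransition c c')}.
Proof.
move=> ac ac' ca c'a.
apply: (cts_pair (f := fun p => (ttransition c c' p).1) (g := fun p => (ttransition c c' p).2));
  apply: cts_of_scv; apply: scv_row => i.
  by apply: (scv_ttransition (f := fun _ _ p => p.1 0 i)) => //; exact: scv_fst_coord.
by apply: (scv_ttransition (f := fun _ _ p => p.2 0 i)) => //; exact: scv_snd_coord.
Qed.

(** Open sets of TM are tested through [tpoint], so the preimage of an open set under [tcoord c] has
    to be examined in every other chart, where it becomes a preimage under a change of natural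
    coordinates. *)
Lemma tcoord_continuous c (p : tangent_bundle M) : atlas c -> cdom c (base p) ->
  {for p, continuous (tcoord c)}.
Proof.
move=> ac cp A /= nA.
have /nbhs_interior nA' := nA.
pose B := [set p | cdom c (base p) /\ (interior A) (tcoord c p)].
have oB : open B.
  move=> c' ac'; rewrite openE => -[a y] /= [c'a [ca Aq]].
  have N1 : nbhs ((a, y) : V * V) (fun q : V * V => cimg c' q.1 /\ cdom c (cinv c' q.1)).
    have cf : {for ((a, y) : V * V), continuous fst} by exact: cts_fst.
    have N : \forall a' \near a, cimg c' a' /\ cdom c (cinv c' a').
      by rewrite -{1}(cinvK c'a); apply: near_cmap; [exact: cinv_dom|exact: near_cdom].
    exact: (cf _ N).
  have N2 : nbhs ((a, y) : V * V) (ttransition c' c @^-1` (interior A)).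
    apply: cts_open (@open_interior _ A) _.
      exact: (ttransition_continuous (q := (a, y)) ac' ac c'a ca).
    by have := tcoord_tpoint (q := (a, y)) ac' ac c'a ca; move=> <-.
  rewrite /interior; move: N1 N2; apply: filterS2 => -[a' y'] /= [c'a' ca'] A'.
  split; first exact: c'a'.
  split; first exact: ca'.
  by have := tcoord_tpoint (q := (a', y')) ac' ac c'a' ca'; move=> ->.
have Bp : B p by split => //; exact: nbhs_singleton nA'.
have nB : nbhs p B by apply: open_nbhs_nbhs.
by move: nB; apply: filterS => p' [_ /interior_subset].
Qed.

Lemma slit_open : open (@slit R n M).
Proof.
move=> c ac; rewrite -[X in open X]/(tcoord_img slit c).
by rewrite tcoord_img_slit //; apply: open_slit_over; exact: cimg_open.
Qed.

Lemma chart_slit_open c : open (chart_slit c).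
Proof.
move=> c' ac'.
rewrite (_ : [set q | _] = slit_over (cmap c' @` (cdom c' `&` cdom c))).
  by apply: open_slit_over; apply: open_cmap_image; exact: cdom_open.
rewrite cmap_image; apply/seteqP; split => q /=.
  move=> [c'q [cq sq]]; have : tcoord_img slit c' q by [].
  by rewrite tcoord_img_slit // => -[].
move=> [[c'q cq] q2].
have : slit_over (cimg c') q by [].
by rewrite -tcoord_img_slit // => -[_ sq].
Qed.

End TangentTopology.

(** * The limit norm and the C^0-Finsler structure *)

Section FiberNorm.
Variables (R : realType) (n : nat).
Notation V := 'rV[R]_n.
Variables (A : set V) (L : V -> V -> R) (rho r tau : R) (u : R -> R) (G : R -> V -> V -> R).
Hypothesis oA : open A.
Hypothesis hL : homogeneous A L.
Hypothesis rho0 : 0 < rho.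
Hypothesis u0 : u e @[e --> 0^'+] --> (0 : R).
Hypothesis tau0 : 0 < tau.
Hypothesis rL : forall x y, A x -> y != 0 -> 0 < r / L x y.
Hypothesis GP : forall e, 0 < e < tau -> forall x, A x -> asymmetric_norm (G e x) /\
  [set y | G e x y = r] = [set y | fiber_convolution L rho u e x y = r].

(* The triangle inequality passes to the limit from the norms [G e x]. *)
Lemma limit_asymmetric_norm x : A x -> asymmetric_norm (L x).
Proof.
move=> Ax; have [_ hh L0] := hL.
have Lpos y : y != 0 -> 0 < L x y.
  move=> y0; have := rL Ax y0.
  rewrite pmulr_rgt0 ?invr_gt0 //.
  exact: (radius_gt0 oA hL rho0 u0 tau0 rL GP Ax y0).
have Lge0 y : 0 <= L x y by have [->|/Lpos/ltW //] := eqVneq y 0; rewrite L0.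
split => //.
- by move=> y E; apply: contra_eqP E => /eqP /Lpos; rewrite lt0r => /andP[].
- move=> m y; rewrite le_eqVlt => /predU1P[<-|m0]; last exact: hh.
  by rewrite scale0r L0 // mul0r.
move=> y z; have [->|y0] := eqVneq y 0; first by rewrite add0r lerDr.
have [->|z0] := eqVneq z 0; first by rewrite addr0 lerDl.
have [->|yz0] := eqVneq (y + z) 0; first by rewrite L0 // addr_ge0.
have cN w : w != 0 -> {for (0 : R), continuous (fun e => norm_family L G e (x, w))}.
  move=> w0; apply: cts_slice.
  exact: (scv_norm_family oA hL rho0 u0 tau0 rL GP).
have cD : {for (0 : R), continuous (fun e => norm_family L G e (x, y + z) -
    (norm_family L G e (x, y) + norm_family L G e (x, z)))}.
  have c1 := cN _ yz0; have c2 := cN _ y0; have c3 := cN _ z0.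
  exact: (cvgB c1 (cvgD c2 c3)).
rewrite leNgt; apply/negP => lt.
have D0 : 0 < norm_family L G 0 (x, y + z) - (norm_family L G 0 (x, y) + norm_family L G 0 (x, z)).
  by rewrite /norm_family ltxx subr_gt0.
have N : \forall e \near (0 : R), 0 < norm_family L G e (x, y + z) -
    (norm_family L G e (x, y) + norm_family L G e (x, z)).
  exact: (cvgr_gt _ cD _ D0).
have N2 : \forall e \near (0 : R), e < tau := lt_nbhsl tau0.
have N3 : \forall e \near (0 : R), 0 < norm_family L G e (x, y + z) -
    (norm_family L G e (x, y) + norm_family L G e (x, z)) /\ e < tau := near_and N N2.
have /nbhs_ballP [d /= d0 Hd] := N3.
have [Dp et] := Hd (d / 2) ltac:(by rewrite /ball /= sub0r normrN gtr0_norm ?divr_gt0 //; lra).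
have d2 : 0 < d / 2 by rewrite divr_gt0.
have [[_ _ _ tri] _] := GP (e := d / 2) ltac:(by rewrite d2) Ax.
by move: Dp; rewrite /norm_family d2 subr_gt0 ltNge tri.
Qed.

End FiberNorm.

Section FinslerNorm.
Variables (R : realType) (n : nat) (M : smooth_manifold R n).
Notation V := 'rV[R]_n.
Variables (F : tangent_bundle M -> R) (S : smoothing_data M).
Hypothesis hF : is_finsler F.
Hypothesis hS : valid_smoothing_data F S.

(** Any index [l] with [x] in [sd_U l] gives the norm property in the coordinates of its chart; the
    linear isomorphism between the fibre and its components carries it over. *)
Lemma finsler_asymmetric_norm x : asymmetric_norm (fun v : V => F (@TVec R n M x v)).
Proof.
have [[ch /(_ x)[l Ux] _] _ /(_ l)[_ _ u0 /andP[t0 _] _] /(_ l) GP] := hS.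
have [ac oU _ Uc] := ch l.
have hL := homogeneous_sub (sd_image_subset hS (l := l)) (finsler_homogeneous hF ac).
have b0 := sd_bound_gt0 hS l.
have cx : cdom (sd_chart l) x by apply: Uc; exact: subset_closure.
have Ax : (cmap (sd_chart l) @` sd_U l) (cmap (sd_chart l) x) by exists x.
have [L0 Ln Lh Lt] := limit_asymmetric_norm (@sd_image_open _ _ _ _ _ hS l) hL (radius_ratio_gt0 b0)
  u0 t0 (radius_div_gt0 hF ac Uc b0) GP Ax.
pose T (v : V) : V := tvec_coord (sd_chart l) (v : tangent x).
have E (v : V) : F (@TVec R n M x v) = local_expr F (sd_chart l) (cmap (sd_chart l) x) (T v).
  by rewrite /local_expr -[in LHS](tcoordK (p := @TVec R n M x v) ac cx).
have lT : linear T by move=> a y z; exact: linearP.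
have T0 : T 0 = 0 by exact: tvec_coord0.
split => [y|y|m y m0|y z]; rewrite !E //.
- by move=> /Ln Ty; rewrite -(@tvec_coordK _ _ _ (sd_chart l) x y) // -/(T y) Ty tvec_point0.
- by have := lT m y 0; rewrite T0 !addr0 => ->; exact: Lh.
- by have := lT 1 y z; rewrite !scale1r => ->.
Qed.

(** Continuity is asked at zero vectors too, where [F] is not smooth; homogeneity provides it. *)
Lemma finsler_C0_finsler : C0_finsler (fun p (v : tangent (base p)) => F (TVec v)).
Proof.
split => [c ac q w [cq _]|p _]; last exact: finsler_asymmetric_norm.
have cL := homogeneous_cts (w := w) (@cimg_open _ _ _ c) (finsler_homogeneous hF ac) cq.
apply: (@cts_comp _ _ _ (fun s : (V * V) * V => (s.1.1, s.2)) (fun p => local_expr F c p.1 p.2) (q, w)) cL.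
apply: cts_pair; last exact: cts_snd.
exact: (@cts_comp _ _ _ fst fst (q, w) (@cts_fst _ _ _) (@cts_fst _ _ _)).
Qed.

End FinslerNorm.

(** * Sections and connections *)

Section Sections.
Variables (R : realType) (n : nat) (M : smooth_manifold R n).
Notation V := 'rV[R]_n.
Implicit Types (c : chart R n M) (p : tangent_bundle M).

Lemma tvec_coord_linear c x : linear (fun v : V => tvec_coord c (v : tangent x)).
Proof. by move=> a v w; exact: linearP. Qed.

Lemma smooth_sectionP (W : set (tangent_bundle M)) (s : section M) : open W ->
  smooth_section_on W s <-> forall c, atlas c -> forall q, tcoord_img W c q -> forall k i,
    scv k (0 : R) (0 : R) q (fun _ _ q => section_coord c s (tpoint c q) 0 i).
Proof.
move=> oW; split => h c ac.
  move=> q Wq k i; apply: (scv_coord i (f := fun _ _ => section_coord c s \o tpoint c)).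
  by apply: scv_smooth (h c ac) => //; exact: oW.
apply: (smooth_scv (e0 := (0 : R)) (w0 := (0 : R))) => q Wq k.
by apply: scv_row => i; exact: h.
Qed.

Lemma smooth_functionP (W : set (tangent_bundle M)) (f : tangent_bundle M -> R) : open W ->
  smooth_function_on W f <-> forall c, atlas c -> forall q, tcoord_img W c q -> forall k,
    scv k (0 : R) (0 : R) q (fun _ _ q => f (tpoint c q)).
Proof.
move=> oW; split => h c ac.
  by move=> q Wq k; apply: scv_smooth (h c ac) => //; exact: oW.
by apply: (smooth_scv (e0 := (0 : R)) (w0 := (0 : R))) => q Wq k; exact: h.
Qed.

Definition scale_section (f : tangent_bundle M -> R) (s : section M) : section M :=
  fun p => f p *: (s p : V).

Definition add_section (s s' : section M) : section M := fun p => (s p : V) + s' p.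

Lemma smooth_scale_section W f s : open W -> smooth_function_on W f ->
  smooth_section_on W s -> smooth_section_on W (scale_section f s).
Proof.
move=> oW /(smooth_functionP _ oW) hf /(smooth_sectionP _ oW) hs; apply/smooth_sectionP => // c ac q Wq k i.
apply: scv_eq (scvM (hf c ac q Wq k) (hs c ac q Wq k i)); near=> t.
rewrite /section_coord /scale_section.
have := @tvec_coord_linear c (base (tpoint c t.2.2)) (f (tpoint c t.2.2)) (s (tpoint c t.2.2)) 0.
by rewrite tvec_coord0 !addr0 => ->; rewrite mxE.
Unshelve. all: by end_near. Qed.

Lemma smooth_add_section W s s' : open W -> smooth_section_on W s ->
  smooth_section_on W s' -> smooth_section_on W (add_section s s').
Proof.
move=> oW /(smooth_sectionP _ oW) hs /(smooth_sectionP _ oW) hs'; apply/smooth_sectionP => // c ac q Wq k i.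
apply: scv_eq (scvD (hs c ac q Wq k i) (hs' c ac q Wq k i)); near=> t.
rewrite /section_coord /add_section.
have := @tvec_coord_linear c (base (tpoint c t.2.2)) 1 (s (tpoint c t.2.2)) (s' (tpoint c t.2.2)).
by rewrite !scale1r => ->; rewrite mxE.
Unshelve. all: by end_near. Qed.

Lemma smooth_zero_section W : open W -> smooth_section_on W (fun p => 0 : V).
Proof.
move=> oW; apply/smooth_sectionP => // c ac q Wq k i.
apply: (scv_eq (f := fun _ _ _ => (0 : R))); last exact: (@scv_cst _ _ _ _ R^o).
by near=> t; rewrite /section_coord tvec_coord0 mxE.
Unshelve. all: by end_near. Qed.

Definition indicator (W : set (tangent_bundle M)) p : R := if pselect (W p) then 1 else 0.

Lemma indicator_in W p : W p -> indicator W p = 1.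
Proof. by rewrite /indicator; case: pselect. Qed.

Lemma indicator_out W p : ~ W p -> indicator W p = 0.
Proof. by rewrite /indicator; case: pselect. Qed.

(** Smoothness on [W] tests only points of the open set [W], and near each of them the function is
    constantly 1. *)
Lemma smooth_indicator W : open W -> smooth_function_on W (indicator W).
Proof.
move=> oW; apply/smooth_functionP => // c ac q Wq k.
apply: (scv_eq (f := fun _ _ _ => (1 : R))); last exact: (@scv_cst _ _ _ _ R^o).
have N : \forall q' \near q, tcoord_img W c q'.
  by apply: open_nbhs_nbhs; split => //; exact: oW.
have N' : \forall t \near ((0 : R), ((0 : R), q)), tcoord_img W c t.2.2 := @cts_22 _ _ _ ((0 : R), ((0 : R), q)) _ N.
by move: N'; apply: filterS => t [_ Wt]; rewrite indicator_in.
Qed.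

Lemma chart_slit_coord c c' (q : V * V) : tcoord_img (chart_slit c) c' q ->
  cimg c' q.1 /\ cdom c (cinv c' q.1).
Proof. by move=> [c'q [cq _]]. Qed.

Lemma smooth_section_coord c (s : section M) j : atlas c -> smooth_section_on (chart_slit c) s ->
  smooth_function_on (chart_slit c) (fun p => section_coord c s p 0 j).
Proof.
move=> ac hs; have oW : open (chart_slit c) := @chart_slit_open R n M c.
apply/smooth_functionP => // c' ac' q Wq k; have [c'q cq] := chart_slit_coord Wq.
have Wq2 : tcoord_img (chart_slit c) c (ttransition c' c q).
  rewrite -tcoord_tpoint //; case: Wq => _ [cp sp]; split; first exact: cimg_cmap.
  by rewrite tcoordK.
have /(smooth_sectionP _ oW)/(_ c ac _ Wq2 k j) h := hs.
have := scv_ttransition ac' ac c'q cq h; apply: scv_eq.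
have N := near_base (0 : R) (0 : R) c'q (near_cdom cq).
move: N; apply: filterS => -[e [w q']] /= [c'q' cq'].
have E : tpoint c (ttransition c' c q') = tpoint c' q' by rewrite -tcoord_tpoint // tcoordK.
by rewrite E.
Qed.

Lemma smooth_frame c j : atlas c -> smooth_section_on (chart_slit c) (frame c j).
Proof.
move=> ac; have oW : open (chart_slit c) := @chart_slit_open R n M c.
apply/smooth_sectionP => // c' ac' q Wq k i; have [c'q cq] := chart_slit_coord Wq.
have E0 : (ttransition c' c q).1 = cmap c (cinv c' q.1) by [].
have h : scv k (0 : R) (0 : R) (ttransition c' c q)
    (fun _ _ (p : V * V) => 'D_(delta_mx 0 j) (transition c c') p.1 0 i).
  apply: (scv_fst (g := fun a => 'D_(delta_mx 0 j) (transition c c') a 0 i)).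
  apply: (scv_coord i (f := fun _ _ => 'D_(delta_mx 0 j) (transition c c'))).
  apply: (scv_derive (f := fun _ _ => transition c c')); rewrite E0.
  by apply: scv_transition => //; exact: cinv_dom.
have := scv_ttransition ac' ac c'q cq h; apply: scv_eq.
have N := near_base (0 : R) (0 : R) c'q (near_cdom cq).
move: N; apply: filterS => -[e [w q']] /= [c'q' cq'].
rewrite /section_coord /frame /= tvec_coord_point //; last exact: cinv_dom.
rewrite deriveE //.
by apply: differentiable_transition => //; exact: cinv_dom.
Qed.

Lemma section_expand c (s : section M) p : atlas c -> chart_slit c p ->
  (s p : V) = \sum_j section_coord c s p 0 j *: (frame c j p : V).
Proof.
move=> ac [cp _]; rewrite -[in LHS](tvec_coordK (s p) ac cp) /section_coord.
rewrite [in LHS](row_sum_delta (tvec_coord c (s p))) /tvec_point linear_sum.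
by apply: eq_bigr => j _; rewrite linearZ.
Qed.

End Sections.

Section ConnectionDifference.
Variables (R : realType) (n : nat) (M : smooth_manifold R n).
Notation V := 'rV[R]_n.
Variables (D1 D2 : linear_connection M) (X : vector_field M).

Definition connection_diff (s : section M) p : V := (D1 X s p : V) - D2 X s p.

Variable W : set (tangent_bundle M).
Hypothesis oW : open W.
Hypothesis Ws : W `<=` slit.
Hypothesis hX : smooth_vfield_on W X.

(** The term X(f) s of the Leibniz rule is the same for both connections and cancels. *)
Lemma connection_diff_scale f s p : smooth_function_on W f -> smooth_section_on W s -> W p ->
  connection_diff (scale_section f s) p = f p *: connection_diff s p.
Proof.
move=> hf hs Wp; rewrite /connection_diff.
have E1 := @nabla_leibniz _ _ _ D1 W f X s oW Ws hf hX hs p Wp.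
have E2 := @nabla_leibniz _ _ _ D2 W f X s oW Ws hf hX hs p Wp.
rewrite /scale_section E1 E2 scalerBr opprD addrACA subrr add0r //.
Qed.

Lemma connection_diff_add s s' p : smooth_section_on W s -> smooth_section_on W s' -> W p ->
  connection_diff (add_section s s') p = connection_diff s p + connection_diff s' p.
Proof.
move=> hs hs' Wp; rewrite /connection_diff.
have E1 := @nabla_additive _ _ _ D1 W X s s' oW Ws hX hs hs' p Wp.
have E2 := @nabla_additive _ _ _ D2 W X s s' oW Ws hX hs hs' p Wp.
by rewrite /add_section E1 E2 opprD addrACA.
Qed.

(* Multiplying by the indicator of [W] does not change the difference on [W], but
   makes two sections that agree on [W] equal. *)
Lemma connection_diff_local s s' p : smooth_section_on W s -> smooth_section_on W s' ->
  (forall q, W q -> s q = s' q) -> W p -> connection_diff s p = connection_diff s' p.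
Proof.
move=> hs hs' E Wp; have sI := smooth_indicator oW.
have I1 := indicator_in Wp.
have := connection_diff_scale sI hs Wp; rewrite I1 scale1r => <-.
have := connection_diff_scale sI hs' Wp; rewrite I1 scale1r => <-.
congr connection_diff; apply: functional_extensionality_dep => q.
rewrite /scale_section; have [Wq|nWq] := pselect (W q); first by rewrite E.
by rewrite indicator_out // !scale0r.
Qed.

Lemma connection_diff_zero p : W p -> connection_diff (fun _ => 0 : V) p = 0.
Proof.
move=> Wp; have h0 := smooth_zero_section oW.
have := connection_diff_add h0 h0 Wp.
rewrite (_ : add_section _ _ = (fun _ => 0 : V)).
  by move=> /(congr1 (fun v => v - connection_diff (fun _ => 0 : V) p)); rewrite addrK subrr.
by apply: functional_extensionality_dep => q; rewrite /add_section addr0.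
Qed.

Lemma connection_diff_sum (J : Type) (r : seq J) (f : J -> tangent_bundle M -> R)
    (s : J -> section M) :
  (forall j, smooth_function_on W (f j)) -> (forall j, smooth_section_on W (s j)) ->
  smooth_section_on W (fun p => \sum_(j <- r) f j p *: (s j p : V)) /\
  forall p, W p -> connection_diff (fun p => \sum_(j <- r) f j p *: (s j p : V)) p =
    \sum_(j <- r) f j p *: connection_diff (s j) p.
Proof.
move=> hf hs; elim: r => [|j r [IH1 IH2]].
  have -> : (fun p => \sum_(j <- [::]) f j p *: (s j p : V)) = (fun _ => 0 : V) :> section M.
    by apply: functional_extensionality_dep => q; rewrite big_nil.
  by split => [|p Wp]; [exact: smooth_zero_section|rewrite big_nil connection_diff_zero].
have -> : (fun p => \sum_(i <- j :: r) f i p *: (s i p : V)) =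
    add_section (scale_section (f j) (s j)) (fun p => \sum_(i <- r) f i p *: (s i p : V)) :> section M.
  by apply: functional_extensionality_dep => q; rewrite big_cons.
have h1 := smooth_scale_section oW (hf j) (hs j).
split => [|p Wp]; first exact: smooth_add_section.
by rewrite big_cons connection_diff_add // connection_diff_scale // IH2.
Qed.

End ConnectionDifference.

Lemma scv_pair_coord_comp (R : realType) n (I W : topologicalType) (Z : normedModType R) k
    (e0 : I) (w0 : W) (z0 : Z) (f : I -> W -> Z -> 'rV[R]_n * 'rV[R]_n) j :
  scv k e0 w0 z0 f -> scv k e0 w0 z0 (fun e w z => pair_coord j (f e w z)).
Proof.
have lin : linear (pair_coord j : 'rV[R]_n * 'rV[R]_n -> R^o) by case: j => i a x y; rewrite /= !mxE.
pose l : {linear ('rV[R]_n * 'rV[R]_n)%type -> R^o} := HB.pack (pair_coord j : 'rV[R]_n * 'rV[R]_n -> R^o)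
  (GRing.isLinear.Build R ('rV[R]_n * 'rV[R]_n)%type R^o _ (pair_coord j : 'rV[R]_n * 'rV[R]_n -> R^o) lin).
by move=> hf; apply: (scv_post (l := l)) hf => x; exact: pair_coord_continuous.
Qed.

(** * Uniform convergence of the covariant derivatives *)

Section Convergence.
Variables (R : realType) (n : nat) (M : smooth_manifold R n).
Notation V := 'rV[R]_n.
Variables (F : tangent_bundle M -> R) (F_ : R -> tangent_bundle M -> R).
Hypothesis hF : is_finsler F.
Variable S : smoothing_data M.
Hypothesis hS : valid_smoothing_data F S.
Hypothesis FE : forall e : R, 0 < e < 1 -> forall p, 0 <= F_ e p /\
  F_ e p ^+ 2 = \sum_(l \in [set: sd_index S]) sd_phi l (base p) *
    (let q := tcoord (sd_chart l) p in local_smoothing l e q.1 q.2) ^+ 2.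
Variables (X : vector_field M) (E : section M).
Hypothesis hX : smooth_vfield_on slit X.
Hypothesis hE : smooth_section_on slit E.
Variables (kind : connection_kind) (D : linear_connection M) (D_ : R -> linear_connection M).
Hypothesis hD : is_connection_of kind F D.
Hypothesis hD_ : forall e : R, 0 < e < 1 -> is_connection_of kind (F_ e) (D_ e).

Section NearPoint.
Variable c : chart R n M.
Hypothesis ac : atlas c.

Let L (e : R) : V -> V -> R := if 0 < e then local_expr (F_ e) c else local_expr F c.

Let theta (e : R) j i (q : V * V) : R :=
  finsler_forms kind (L e) j i q (vfield_coord c X (tpoint c q)).

(** For [0 < e < 1], the components of the difference of the covariant derivatives. For [e <= 0] the
    structure [L e] is frozen at that of [F], so the expression vanishes. *)
Definition diff_coord (e : R) (q : V * V) : V :=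
  \row_i \sum_j section_coord c E (tpoint c q) 0 j * (theta e j i q - theta 0 j i q).

Let chart_slit_sub : chart_slit c `<=` slit. Proof. by move=> p []. Qed.

Let chart_open : open (chart_slit c) := @chart_slit_open R n M c.

Let hXc : smooth_vfield_on (chart_slit c) X.
Proof.
by move=> c' ac'; apply: smooth_on_sub (hX ac') => q [cq Wq]; split => //; exact: chart_slit_sub.
Qed.

Let hEc : smooth_section_on (chart_slit c) E.
Proof.
by move=> c' ac'; apply: smooth_on_sub (hE ac') => q [cq Wq]; split => //; exact: chart_slit_sub.
Qed.

Lemma connection_diff_coord (e : R) p : 0 < e < 1 -> chart_slit c p ->
  tvec_coord c (connection_diff (D_ e) D X E p : tangent (base p)) = diff_coord e (tcoord c p).
Proof.
move=> e01 Wp; have [cp sp] := Wp.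
have hc j := smooth_section_coord j ac hEc.
have hf j := smooth_frame j ac.
have [hs ds] := connection_diff_sum (D_ e) D chart_open chart_slit_sub hXc (index_enum _) hc hf.
have -> : connection_diff (D_ e) D X E p = \sum_j \sum_i
    (section_coord c E p 0 j * (theta e j i (tcoord c p) - theta 0 j i (tcoord c p))) *: (frame c i p : V).
  (* The frame expansion agrees with [E] only over the chart, hence the appeal to locality. *)
  rewrite (connection_diff_local (D_ e) D chart_open chart_slit_sub hXc hEc hs _ Wp); last first.
    by move=> q Wq; exact: section_expand.
  rewrite ds //; apply: eq_bigr => j _.
  have h1 := hD_ e01 ac chart_open (fun p h => h) hXc Wp j.
  have h2 := hD ac chart_open (fun p h => h) hXc Wp j.
  rewrite /connection_diff h1 h2 -sumrB scaler_sumr; apply: eq_bigr => i _.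
  have L0 : L 0 = local_expr F c by rewrite /L ltxx.
  have Le : L e = local_expr (F_ e) c by rewrite /L; have /andP[-> _] := e01.
  by rewrite /theta (tcoordK ac cp) L0 Le -scalerBl scalerA.
apply/rowP => i; rewrite mxE.
pose T (v : V) : V := tvec_coord c (v : tangent (base p)).
have lT : linear T by exact: tvec_coord_linear.
pose l : {linear V -> V} := HB.pack T (GRing.isLinear.Build _ _ _ _ T lT).
have TZ a v : T (a *: v) = a *: T v.
  by have := lT a v 0; rewrite /T tvec_coord0 !addr0.
rewrite -[tvec_coord c _]/(l _) linear_sum summxE; apply: eq_bigr => j _.
rewrite linear_sum summxE (bigD1 i) //= big1 => [|i' i'i].
  rewrite addr0 TZ /T /frame tvec_pointK // mxE mxE !eqxx mulr1.
  by rewrite tcoordK.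
by rewrite TZ /T /frame tvec_pointK // mxE mxE [i == i']eq_sym (negbTE i'i) andbF mulr0.
Qed.

Variable q0 : V * V.
Hypothesis Aq0 : slit_over (cimg c) q0.

Let smooth_L : smooth_family q0 (fun e x y => L e x y ^+ 2).
Proof.
have [cq0 yq0] := Aq0.
move=> k; apply: scv_eq (scv_square_family hF hS FE ac cq0 yq0 (0 : R) k).
by near=> t; rewrite /square_family /L; case: ifP.
Unshelve. all: by end_near. Qed.

Let scv_theta j i : scv 0 (0 : R) (0 : R) q0 (fun e _ => theta e j i).
Proof.
have [cq0 yq0] := Aq0.
have sZ : scv 0 (0 : R) (0 : R) q0 (fun _ _ q => vfield_coord c X (tpoint c q)).
  apply: (scv_smooth (A := tcoord_img slit c)) (hX ac).
    exact: slit_open.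
  by rewrite tcoord_img_slit.
apply: (cts_finsler_forms (L := L) smooth_L).
- by rewrite /L ltxx; exact: finsler_det_neq0.
- by move=> a; exact: (scv_pair_coord_comp (inl a) sZ).
- by move=> a; exact: (scv_pair_coord_comp (inr a) sZ).
Qed.

Let scv_diff_coord i : scv 0 (0 : R) (0 : R) q0 (fun e _ q => diff_coord e q 0 i).
Proof.
apply: (scv_eq (f := fun e _ q => \sum_j section_coord c E (tpoint c q) 0 j * (theta e j i q - theta 0 j i q))).
  by near=> t; rewrite mxE.
apply: scv_sum => j _; apply: scvM.
  have /(smooth_sectionP _ (@slit_open R n M))/(_ c ac q0) h := hE.
  by apply: h; rewrite tcoord_img_slit.
apply: scvB; first exact: scv_theta.
(* The family frozen at its limit is obtained by the constant reparametrization of [e] by 0. *)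
have cr : {for (0 : R), continuous (fun _ : R => (0 : R))} by exact: cts_cst.
have ci : continuous (fun w : R => w) by move=> w; exact: cts_id.
exact: (@scv_map R R R (V * V)%type R R R (fun _ => 0) (fun w => w) 0 (0 : R) (0 : R) q0
   (fun e _ => theta e j i) cr ci (scv_theta j i)).
Unshelve. all: by end_near. Qed.

(** The difference is jointly continuous at [(0, q0)] and vanishes there, so [F] is evaluated near a
    zero vector: it is the continuity of [F] on the zero section that gives the bound. *)
Lemma near_diff_small d : 0 < d -> \forall t \near ((0 : R), q0),
  local_expr F c t.2.1 (diff_coord t.1 t.2) < d.
Proof.
move=> d0; have [cq0 yq0] := Aq0.
have cY : {for ((0 : R), q0), continuous (fun t : R * (V * V) => diff_coord t.1 t.2)}.
  have c1 := scv_cts (scv_row scv_diff_coord).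
  exact: (@cts_comp _ _ _ (fun t : R * (V * V) => (t.1, ((0 : R), t.2))) (fun t => diff_coord t.1 t.2.2) ((0 : R), q0)
    (cts_pair (@cts_fst _ _ _) (cts_pair (@cts_cst _ _ (0 : R) _) (@cts_snd _ _ _))) c1).
have Y0 : diff_coord 0 q0 = 0.
  by apply/rowP => i; rewrite !mxE big1 // => j _; rewrite subrr mulr0.
have hL := finsler_homogeneous hF ac.
have cL := homogeneous_cts (w := 0) (@cimg_open _ _ _ c) hL cq0.
have cG : {for ((0 : R), q0), continuous (fun t : R * (V * V) => local_expr F c t.2.1 (diff_coord t.1 t.2))}.
  apply: (@cts_comp _ _ _ (fun t : R * (V * V) => (t.2.1, diff_coord t.1 t.2)) (fun p => local_expr F c p.1 p.2) ((0 : R), q0)).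
    apply: cts_pair cY.
    exact: (@cts_comp _ _ _ snd fst ((0 : R), q0) (@cts_snd _ _ _) (@cts_fst _ _ _)).
  by rewrite /= Y0.
apply: (cvgr_lt _ cG); rewrite /= Y0.
by have [_ _ ->] := hL.
Qed.

End NearPoint.

(** Continuity of [tcoord] pulls the estimate in coordinates back to TM. The neighbourhood of [p0]
    and the range of [e] are independent of each other, as a covering argument requires. *)
Lemma near_connection_diff_small (p0 : tangent_bundle M) d : slit p0 -> 0 < d ->
  \forall p \near p0 & e \near (0 : R)^'+, 0 < e < 1 ->
    F (@TVec R n M (base p) (connection_diff (D_ e) D X E p)) < d.
Proof.
move=> sp d0; set c := chart_at (base p0).
have ac : atlas c by exact: atlas_chart_at.
have cp : cdom c (base p0) by exact: cdom_chart_at.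
have N := near_diff_small ac (slit_tcoord ac cp sp) d0.
case: N => -[A1 A2] /= [n1 n2] HA.
exists (chart_slit c `&` tcoord c @^-1` A2, A1) => /=.
  split; last by exact: cvg_within n1.
  apply: filterI; last exact: (tcoord_continuous ac cp n2).
  by apply: open_nbhs_nbhs; split => //; exact: (@chart_slit_open R n M c).
move=> [p e] /= [[Wp Ap] Ae] e01; have [cp' _] := Wp.
have := HA (e, tcoord c p) (conj Ae Ap); rewrite /= -connection_diff_coord //.
set v := connection_diff _ _ _ _ _.
by have := tcoordK (p := @TVec R n M (base p) v) ac cp' => E1; rewrite -[in X in _ -> X]E1.
Qed.

End Convergence.

Theorem theorem8p5 (R : realType) (n : nat) (M : smooth_manifold R n)
  (F : tangent_bundle M -> R) (F_ : R -> tangent_bundle M -> R)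
  (hF : is_finsler F) (hF_ : is_mollifier_smoothing F F_)
  (X : vector_field M) (hX : smooth_vfield_on slit X)
  (E : section M) (hE : smooth_section_on slit E)
  (kind : connection_kind)
  (D : linear_connection M) (hD : is_connection_of kind F D)
  (D_ : R -> linear_connection M)
  (hD_ : forall e : R, 0 < e < 1 -> is_connection_of kind (F_ e) (D_ e))
  (K : set (tangent_bundle M)) (hK : compact K) (hK0 : K `<=` slit) :
  converges_uniformly K (fun e => D_ e X E) (D X E).
Proof.
have [S hS FE] := hF_.
have smooth_nabla (D' : linear_connection M) : smooth_section_on slit (D' X E).
  by apply: nabla_smooth => //; exact: slit_open.
(* The clause of order 0 in smoothness is continuity. *)
split; [by move=> e _ c ac q; exact: (smooth_nabla (D_ e) c ac 0)|
  by move=> c ac q; exact: (smooth_nabla D c ac 0)|].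
exists (fun p (v : tangent (base p)) => F (TVec v)); first exact: (finsler_C0_finsler hF hS).
move=> d d0.
have /compact_near_coveringP cov := hK.
(* Near each point of [K] the estimate holds for all small [e > 0]; compactness makes the range of
   [e] common to all of [K]. *)
have near_small : \forall e \near (0 : R)^'+, K `<=` (fun p => 0 < e < 1 ->
    F (@TVec R n M (base p) (connection_diff (D_ e) D X E p)) < d).
  apply: cov => p Kp.
  have sp : slit p := hK0 p Kp.
  have h := near_connection_diff_small hF hS FE hX hE hD hD_ sp d0.
  exact: h.
move: near_small; rewrite near_withinE => /nbhs_ballP[b /= b0 Hb].
exists b => // p e Kp /andP[e0 eb] e1.
apply: (Hb e _ e0 p Kp); last by rewrite e0.
by rewrite /ball /= sub0r normrN gtr0_norm.
Qed.
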